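(* Let $K$ be a commutative ring, $B$ a $K$-algebra, $I\subseteq B$ a two-sided ideal and $A=B/I$. Assume that $B$ and $A$ are projective as $K$-modules. (1) If $\mathrm{Tor}^B_i(A,A)=0$ for all $i>0$, then the canonical short exact sequence $0\to I\to B\to A\to0$ gives rise to a long exact sequence $$\cdots\to\mathrm{HH}^n(B,I)\to\mathrm{HH}^n(B)\xrightarrow{\;k_n\;}\mathrm{HH}^n(A)\to\mathrm{HH}^{n+1}(B,I)\to\cdots$$ in Hochschild cohomology. The map $k_\ast\colon\mathrm{HH}^\ast(B)\to\mathrm{HH}^\ast(A)$ is a homomorphism of strict Gerstenhaber algebras, that is, $k_\ast$ is a homomorphism of graded $K$-algebras, $k_{m+n-1}(\{\alpha,\beta\}_B)=\{k_m(\alpha),k_n(\beta)\}_A$ for $\alpha\in\mathrm{HH}^m(B)$, $\beta\in\mathrm{HH}^n(B)$, and $k_{4n-1}(sq_B(\alpha))=sq_A(k_{2n}(\alpha))$ for $\alpha\in\mathrm{HH}^{2n}(B)$. (2) If $I$ is a stratifying ideal, with corresponding stratifying idempotent $e\in B$, then the short exact sequence $0\to I\to B\to A\to0$ gives rise to a long exact sequence $$\cdots\to\mathrm{Ext}^n_{B^{\mathrm{ev}}}(A,B)\to\mathrm{HH}^n(B)\xrightarrow{\;l_n\;}\mathrm{HH}^n(eBe)\to\mathrm{Ext}^{n+1}_{B^{\mathrm{ev}}}(A,B)\to\cdots$$ in Hochschild cohomology. The map $l_\ast\colon\mathrm{HH}^\ast(B)\to\mathrm{HH}^\ast(eBe)$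 is a homomorphism of strict Gerstenhaber algebras, that is, $l_\ast$ is a homomorphism of graded $K$-algebras, $l_{m+n-1}(\{\alpha,\beta\}_B)=\{l_m(\alpha),l_n(\beta)\}_{eBe}$ for $\alpha\in\mathrm{HH}^m(B)$, $\beta\in\mathrm{HH}^n(B)$, and $l_{4n-1}(sq_B(\alpha))=sq_{eBe}(l_{2n}(\alpha))$ for $\alpha\in\mathrm{HH}^{2n}(B)$.
   Context: Conventions. Algebras are unital and associative; $\otimes=\otimes_K$; $\Lambda^{\mathrm{ev}}=\Lambda\otimes\Lambda^{\mathrm{op}}$; $\mathrm{HH}^n(B,M)=\mathrm{Ext}^n_{B^{\mathrm{ev}}}(B,M)$ for a $B^{\mathrm{ev}}$-module $M$. An idempotent $e\in B$ is stratifying if $\mathrm{Tor}^{eBe}_i(Be,eB)=0$ for all $i>0$ and the multiplication map $Be\otimes_{eBe}eB\to BeB$ is an isomorphism; a two-sided ideal is stratifying if it is of the form $BeB$ for a stratifying idempotent $e$. The sequence in (1) is obtained by applying $\mathrm{Hom}_{B^{\mathrm{ev}}}(B,-)$ and using the isomorphism $\mathrm{HH}^n(B,A)\cong H^n\mathrm{Hom}_{B^{\mathrm{ev}}}(\mathbb B,A)\cong H^n\mathrm{Hom}_{A^{\mathrm{ev}}}(A\otimes_B\mathbb B\otimes_BA,A)\cong\mathrm{HH}^n(A)$, where $\mathbb B$ is the bar resolution of $B$ and $A\otimes_B\mathbb B\otimes_BA$ is a projective resolution of $A$ over $A^{\mathrm{ev}}$ (by the Tor-vanishing). The sequence in (2)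 is obtained by applying $\mathrm{Hom}_{B^{\mathrm{ev}}}(-,B)$ and using $\mathrm{Ext}^n_{B^{\mathrm{ev}}}(I,B)\cong\mathrm{Ext}^n_{B^{\mathrm{ev}}}(Be\otimes_{eBe}eB,B)\cong\mathrm{HH}^n(eBe)$, the last isomorphism coming from the adjunction between $Be\otimes_{eBe}(-)\otimes_{eBe}eB$ and $e(-)e$ applied to a projective resolution of $eBe$ over $(eBe)^{\mathrm{ev}}$. Hochschild cohomology. For a $K$-projective $K$-algebra $\Lambda$, $\mathrm{HH}^\ast(\Lambda)=\mathrm{HH}^\ast(\Lambda,\Lambda)$ is the cohomology of the Hochschild cocomplex $C^n(\Lambda,\Lambda)=\mathrm{Hom}_K(\Lambda^{\otimes n},\Lambda)$ with its usual differential, identified via the bar resolution with the graded algebra $\mathrm{Ext}^\ast_{\Lambda^{\mathrm{ev}}}(\Lambda,\Lambda)$. Its strict Gerstenhaber structure consists of: the cup product $(f\cup g)(a_1\otimes\cdots\otimes a_{m+n})=f(a_1\otimes\cdots\otimes a_m)g(a_{m+1}\otimes\cdots\otimes a_{m+n})$; the bracket $\{-,-\}_\Lambda$ induced by $\{f,g\}=f\bullet g-(-1)^{(m-1)(n-1)}g\bullet f$ (degree $-1$), where for $f\in C^m$, $g\in C^n$, $f\bullet g=\sum_{i=1}^m(-1)^{(i-1)(n-1)}f\bullet_i g$ and $(f\bullet_i g)(a_1\otimes\cdots\otimes a_{m+n-1})=f(a_1\otimes\cdots\otimes a_{i-1}\otimes g(a_i\otimes\cdots\otimes a_{i+n-1})\otimes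 a_{i+n}\otimes\cdots\otimes a_{m+n-1})$; and the squaring map $sq_\Lambda\colon\mathrm{HH}^{2n}(\Lambda)\to\mathrm{HH}^{4n-1}(\Lambda)$ induced by $f\mapsto f\bullet f$. *)

(* Defs.v *)
From HB Require Import structures.
From mathcomp Require Import all_boot all_algebra.
From mathcomp Require Import boolp functions.

Set Implicit Arguments.
Unset Strict Implicit.
Unset Printing Implicit Defensive.

Import GRing.Theory.
Local Open Scope ring_scope.
Local Open Scope quotient_scope.

Section Submodules.
Variables (K : comPzRingType) (V : lmodType K).

Record submod := Submod {
  sm_mem :> V -> Prop;
  sm_0 : sm_mem 0;
  sm_lin : forall (k : K) (u v : V), sm_mem u -> sm_mem v -> sm_mem (k *: u + v)
}.

Variable P : submod.

Definition smem : {pred V} := fun v => `[< P v >].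

Fact smem_closed : submod_closed smem.
Proof.
split=> [|k u v /asboolP Pu /asboolP Pv]; first by apply/asboolP/sm_0.
exact/asboolP/sm_lin.
Qed.

HB.instance Definition _ := GRing.isSubmodClosed.Build K V smem smem_closed.

Definition subM := {v : V | smem v}.
HB.instance Definition _ := SubType.on subM.
HB.instance Definition _ := Choice.on subM.
HB.instance Definition _ := [SubChoice_isSubLmodule of subM by <:].

Definition inM (v : V) (Pv : P v) : subM := exist _ v (asboolT Pv).

Lemma subMP (x : subM) : P (val x).
Proof. exact/asboolP/(valP x). Qed.

Definition quoM := Quotient.quot smem.
HB.instance Definition _ := EqQuotient.on quoM.
HB.instance Definition _ := GRing.Zmodule.on quoM.

Lemma quoM_eq (u v : V) : \pi_quoM u = \pi_quoM v <-> P (u - v).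
Proof.
by split=> [/eqmodP /= | h]; [move/asboolP | apply/eqmodP/asboolP].
Qed.

Definition qscale (k : K) (x : quoM) : quoM := \pi_quoM (k *: repr x).

Lemma pi_qscale k v : \pi_quoM (k *: v) = qscale k (\pi_quoM v).
Proof.
apply/quoM_eq; rewrite -scalerBr -[X in P X]addr0; apply: sm_lin (sm_0 P).
by apply/quoM_eq; rewrite reprK.
Qed.

Lemma pi_qadd (u v : V) : \pi_quoM (u + v) = \pi_quoM u + \pi_quoM v.
Proof. exact: (@Quotient.pi_add V smem). Qed.

Lemma quoMW (x : quoM) : exists v, x = \pi_quoM v.
Proof. by exists (repr x); rewrite reprK. Qed.

Fact qscaleA a b x : qscale a (qscale b x) = qscale (a * b) x.
Proof. by have [v ->] := quoMW x; rewrite -!pi_qscale scalerA. Qed.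
Fact qscale1 x : qscale 1 x = x.
Proof. by have [v ->] := quoMW x; rewrite -pi_qscale scale1r. Qed.
Fact qscaleDr a x y : qscale a (x + y) = qscale a x + qscale a y.
Proof.
have [v ->] := quoMW x; have [w ->] := quoMW y.
by rewrite -pi_qadd -!pi_qscale scalerDr pi_qadd.
Qed.
Fact qscaleDl x a b : qscale (a + b) x = qscale a x + qscale b x.
Proof. by have [v ->] := quoMW x; rewrite -!pi_qscale scalerDl pi_qadd. Qed.

HB.instance Definition _ :=
  GRing.Zmodule_isLmodule.Build K quoM qscaleA qscale1 qscaleDr qscaleDl.

End Submodules.

Section Subquotient.
Variables (K : comPzRingType) (V : lmodType K) (Z D : submod V).

Fact sub_in_0 : D (val (0 : subM Z)). Proof. exact: sm_0. Qed.
Fact sub_in_lin (k : K) (u v : subM Z) :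
  D (val u) -> D (val v) -> D (val (k *: u + v)).
Proof. exact: sm_lin. Qed.

Definition sub_in : submod (subM Z) :=
  @Submod K (subM Z) (fun z => D (val z)) sub_in_0 sub_in_lin.
(* The module Z / (Z :&: D); below, D is always contained in Z. *)
Definition subquo : lmodType K := quoM sub_in.

(* The class of v when Z v holds (and 0 otherwise). *)
Definition hcl (v : V) : subquo :=
  \pi_(quoM sub_in) (insubd (0 : subM Z) v).

Definition hrep (x : subquo) : V := val (repr x : subM Z).

End Subquotient.

Definition linear_fun (K : comPzRingType) (U V : lmodType K) (f : U -> V) :=
  forall (k : K) (u v : U), f (k *: u + v) = k *: f u + f v.

Definition bilinear_fun (K : comPzRingType) (U V W : lmodType K)
    (f : U -> V -> W) :=
  (forall v, linear_fun (f^~ v)) /\ (forall u, linear_fun (f u)).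

Definition projective_module (K : comPzRingType) (P : lmodType K) : Prop :=
  forall (M N : lmodType K) (g : {linear M -> N}) (f : {linear P -> N}),
    (forall y, exists x, g x = y) ->
    exists h : {linear P -> M}, forall p, g (h p) = f p.

Section LinearFun.
Variables (K : comPzRingType) (U V : lmodType K) (f : U -> V).
Hypothesis fl : linear_fun f.

Lemma lfD u v : f (u + v) = f u + f v.
Proof. by have := fl 1 u v; rewrite !scale1r. Qed.
Lemma lf0 : f 0 = 0.
Proof. by apply: (addrI (f 0)); rewrite -lfD !addr0. Qed.
Lemma lfZ k u : f (k *: u) = k *: f u.
Proof. by have := fl k u 0; rewrite lf0 !addr0. Qed.
Lemma lfN u : f (- u) = - f u.
Proof. by rewrite -scaleN1r lfZ scaleN1r. Qed.
Lemma lfB u v : f (u - v) = f u - f v.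
Proof. by rewrite lfD lfN. Qed.
Lemma lf_sum (I : Type) (r : seq I) (F : I -> U) :
  f (\sum_(i <- r) F i) = \sum_(i <- r) f (F i).
Proof. by apply: (big_morph f lfD lf0). Qed.
End LinearFun.

(* The library's [algType] requires 1 != 0; the zero algebra has to be
   allowed here (it is B/I for I = B, and eBe for e = 0). *)
Record kalg (K : comPzRingType) := KAlg {
  kcar :> lmodType K;
  kone : kcar;
  kmul : kcar -> kcar -> kcar;
  kmul_bilinear : bilinear_fun kmul;
  kmulA : associative kmul;
  kmul1x : left_id kone kmul;
  kmulx1 : right_id kone kmul
}.

Notation "x ** y" := (kmul x y) (at level 40, left associativity).

Record alghom (K : comPzRingType) (R S : kalg K) := AlgHom {
  ah :> R -> S;
  ah_linear : linear_fun ah;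
  ah_mul : forall x y, ah (x ** y) = ah x ** ah y;
  ah_one : ah (kone R) = kone S
}.

(* An (R, S)-bimodule on which K acts centrally, i.e. a module over
   R (x) S^op.  For R = S this is an R^ev-module; for R = K (resp. S = K)
   it is a right S-module (resp. a left R-module). *)
Record bimod (K : comPzRingType) (R S : kalg K) := Bimod {
  bcar :> lmodType K;
  lact : R -> bcar -> bcar;
  ract : bcar -> S -> bcar;
  lact_bilinear : bilinear_fun lact;
  ract_bilinear : bilinear_fun ract;
  lact_mul : forall x y m, lact (x ** y) m = lact x (lact y m);
  lact_one : forall m, lact (kone R) m = m;
  ract_mul : forall m x y, ract m (x ** y) = ract (ract m x) y;
  ract_one : forall m, ract m (kone S) = m;
  lract : forall x m y, ract (lact x m) y = lact x (ract m y)
}.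

Definition is_bihom (K : comPzRingType) (R S : kalg K) (M N : bimod R S)
    (f : M -> N) : Prop :=
  [/\ linear_fun f, (forall x m, f (lact x m) = lact x (f m))
    & (forall m y, f (ract m y) = ract (f m) y)].

Record bihom (K : comPzRingType) (R S : kalg K) (M N : bimod R S) := Bihom {
  bh :> M -> N;
  bhP : is_bihom bh
}.

Section BihomTheory.
Variables (K : comPzRingType) (R S : kalg K).

Lemma bh_lin (M N : bimod R S) (f : bihom M N) : linear_fun f.
Proof. by case: f => f []. Qed.
Lemma bh_l (M N : bimod R S) (f : bihom M N) x m : f (lact x m) = lact x (f m).
Proof. by case: f => f []. Qed.
Lemma bh_r (M N : bimod R S) (f : bihom M N) m x : f (ract m x) = ract (f m) x.
Proof. by case: f => f []. Qed.

Lemma lact_lin (M : bimod R S) x : linear_fun (lact (b := M) x).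
Proof. by case: (lact_bilinear M). Qed.
Lemma ract_lin (M : bimod R S) x : linear_fun ((@ract K R S M)^~ x).
Proof. by case: (ract_bilinear M). Qed.

Fact idbh_is_bihom (M : bimod R S) : is_bihom (@id M).
Proof. by []. Qed.
Definition idbh (M : bimod R S) := Bihom (idbh_is_bihom M).

End BihomTheory.

Definition biprojective (K : comPzRingType) (R S : kalg K) (P : bimod R S) :
    Prop :=
  forall (M N : bimod R S) (g : bihom M N) (f : bihom P N),
    (forall y, exists x, g x = y) ->
    exists h : bihom P M, forall p, g (h p) = f p.

Section BasicBimodules.
Variable K : comPzRingType.

Fact scaleK_bilinear : bilinear_fun (fun x y : K^o => x * y : K^o).
Proof.
split=> [v k u w|u k v w].
  by rewrite mulrDl -mulrA.
by rewrite mulrDr; congr (_ + _); exact: mulrCA.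
Qed.

Definition kbase : kalg K :=
  KAlg scaleK_bilinear (@mulrA K) (@mul1r K) (@mulr1 K).

Section Alg.
Variable R : kalg K.

Lemma kmul_linl (y : R) : linear_fun ((@kmul K R)^~ y).
Proof. by case: (kmul_bilinear R). Qed.
Lemma kmul_linr (x : R) : linear_fun (kmul x).
Proof. by case: (kmul_bilinear R). Qed.

Definition reg : bimod R R :=
  @Bimod K R R R (@kmul K R) (@kmul K R) (kmul_bilinear R) (kmul_bilinear R)
    (fun x y m => esym (kmulA x y m)) (@kmul1x K R)
    (fun m x y => kmulA m x y) (@kmulx1 K R) (fun x m y => esym (kmulA x m y)).

Fact unit_linear : linear_fun (fun k : kbase => (k : K) *: kone R).
Proof. by move=> k u v; rewrite scalerDl scalerA. Qed.
Fact unit_mul (x y : kbase) :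
  ((x ** y : kbase) : K) *: kone R = ((x : K) *: kone R) ** ((y : K) *: kone R).
Proof.
by rewrite (lfZ (kmul_linl _)) (lfZ (kmul_linr _)) kmul1x scalerA.
Qed.
Fact unit_one : (kone kbase : K) *: kone R = kone R.
Proof. exact: scale1r. Qed.
Definition unit_hom : alghom kbase R := AlgHom unit_linear unit_mul unit_one.

Fact id_linear : linear_fun (@id R). Proof. by []. Qed.
Definition id_hom : alghom R R := @AlgHom K R R id id_linear (fun x y => erefl) erefl.
End Alg.

Section Restriction.
Variables (R R' S S' : kalg K) (f : alghom R' R) (g : alghom S' S) (M : bimod R S).

Fact res_l_bilinear : bilinear_fun (fun x (m : M) => lact (f x) m).
Proof.
split=> [m k x y|x]; last exact: lact_lin.
by rewrite ah_linear; case: (lact_bilinear M) => h _; exact: h.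
Qed.
Fact res_r_bilinear : bilinear_fun (fun (m : M) y => ract m (g y)).
Proof.
split=> [y|m k x y]; first exact: ract_lin.
by rewrite ah_linear; case: (ract_bilinear M) => _; exact.
Qed.
Fact res_l_mul x y (m : M) : lact (f (x ** y)) m = lact (f x) (lact (f y) m).
Proof. by rewrite ah_mul lact_mul. Qed.
Fact res_l_one (m : M) : lact (f (kone R')) m = m.
Proof. by rewrite ah_one lact_one. Qed.
Fact res_r_mul (m : M) x y : ract m (g (x ** y)) = ract (ract m (g x)) (g y).
Proof. by rewrite ah_mul ract_mul. Qed.
Fact res_r_one (m : M) : ract m (g (kone S')) = m.
Proof. by rewrite ah_one ract_one. Qed.

Definition res : bimod R' S' :=
  Bimod res_l_bilinear res_r_bilinear res_l_mul res_l_one res_r_mul res_r_one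
    (fun x m y => lract (f x) m (g y)).
End Restriction.

Section Ideal.
Variable B : kalg K.

Record ideal := Ideal {
  id_mem :> submod B;
  id_l : forall b x, id_mem x -> id_mem (b ** x);
  id_r : forall x b, id_mem x -> id_mem (x ** b)
}.

Variable I : ideal.

Definition ideal_lact (b : B) (x : subM I) : subM I := inM (id_l b (subMP x)).
Definition ideal_ract (x : subM I) (b : B) : subM I := inM (id_r b (subMP x)).

Fact ideal_l_bilinear : bilinear_fun ideal_lact.
Proof.
by split=> [v k x y|u k x y]; apply: val_inj; [exact: kmul_linl|exact: kmul_linr].
Qed.
Fact ideal_r_bilinear : bilinear_fun ideal_ract.
Proof.
by split=> [v k x y|u k x y]; apply: val_inj; [exact: kmul_linl|exact: kmul_linr].
Qed.
Fact ideal_l_mul x y m : ideal_lact (x ** y) m = ideal_lact x (ideal_lact y m).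
Proof. by apply: val_inj; rewrite /= kmulA. Qed.
Fact ideal_l_one m : ideal_lact (kone B) m = m.
Proof. by apply: val_inj; rewrite /= kmul1x. Qed.
Fact ideal_r_mul m x y : ideal_ract m (x ** y) = ideal_ract (ideal_ract m x) y.
Proof. by apply: val_inj; rewrite /= kmulA. Qed.
Fact ideal_r_one m : ideal_ract m (kone B) = m.
Proof. by apply: val_inj; rewrite /= kmulx1. Qed.
Fact ideal_lract x m y :
  ideal_ract (ideal_lact x m) y = ideal_lact x (ideal_ract m y).
Proof. by apply: val_inj; rewrite /= kmulA. Qed.

Definition ideal_bimod : bimod B B :=
  Bimod ideal_l_bilinear ideal_r_bilinear ideal_l_mul ideal_l_one ideal_r_mul
    ideal_r_one ideal_lract.
End Ideal.

End BasicBimodules.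

Section Corner.
Variables (K : comPzRingType) (B : kalg K) (e : B) (ee : e ** e = e).

Fact corner_0 : e ** 0 ** e = 0.
Proof. by rewrite (lf0 (kmul_linr _)) (lf0 (kmul_linl _)). Qed.
Fact corner_lin (k : K) (u v : B) :
  e ** u ** e = u -> e ** v ** e = v -> e ** (k *: u + v) ** e = k *: u + v.
Proof. by move=> hu hv; rewrite kmul_linr kmul_linl hu hv. Qed.
Definition corner_sub := Submod corner_0 corner_lin.

Fact corner_inP (b : B) : e ** (e ** b ** e) ** e = e ** b ** e.
Proof. by rewrite -!kmulA ee !kmulA ee. Qed.
(* b |-> e b e *)
Definition to_corner (b : B) : subM corner_sub := inM (corner_inP b : corner_sub _).

Lemma cornerl (x : subM corner_sub) : e ** val x = val x.
Proof. by rewrite -{1}(subMP x) !kmulA ee; exact: (subMP x). Qed.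
Lemma cornerr (x : subM corner_sub) : val x ** e = val x.
Proof. by rewrite -{1}(subMP x) -!kmulA ee kmulA; exact: (subMP x). Qed.

Fact corner_mulP (x y : subM corner_sub) : e ** (val x ** val y) ** e = val x ** val y.
Proof. by rewrite !kmulA cornerl -kmulA cornerr. Qed.
Definition corner_mul x y : subM corner_sub := inM (corner_mulP x y : corner_sub _).
Fact corner_oneP : e ** e ** e = e. Proof. by rewrite !ee. Qed.
Definition corner_one : subM corner_sub := inM (corner_oneP : corner_sub _).

Fact corner_bilinear : bilinear_fun corner_mul.
Proof.
by split=> [v k x y|u k x y]; apply: val_inj; [exact: kmul_linl|exact: kmul_linr].
Qed.
Fact corner_mulA : associative corner_mul.
Proof. by move=> x y z; apply: val_inj; rewrite /= kmulA. Qed.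
Fact corner_mul1x : left_id corner_one corner_mul.
Proof. by move=> x; apply: val_inj; exact: cornerl. Qed.
Fact corner_mulx1 : right_id corner_one corner_mul.
Proof. by move=> x; apply: val_inj; exact: cornerr. Qed.

Definition corner : kalg K :=
  KAlg corner_bilinear corner_mulA corner_mul1x corner_mulx1.

Fact Be_0 : 0 ** e = 0. Proof. exact: (lf0 (kmul_linl _)). Qed.
Fact Be_lin (k : K) (u v : B) :
  u ** e = u -> v ** e = v -> (k *: u + v) ** e = k *: u + v.
Proof. by move=> hu hv; rewrite kmul_linl hu hv. Qed.
Definition Be_sub := Submod Be_0 Be_lin.

Fact eB_0 : e ** 0 = 0. Proof. exact: (lf0 (kmul_linr _)). Qed.
Fact eB_lin (k : K) (u v : B) :
  e ** u = u -> e ** v = v -> e ** (k *: u + v) = k *: u + v.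
Proof. by move=> hu hv; rewrite kmul_linr hu hv. Qed.
Definition eB_sub := Submod eB_0 eB_lin.

Fact Be_lP b (x : subM Be_sub) : b ** val x ** e = b ** val x.
Proof. by rewrite -kmulA (subMP x). Qed.
Definition Be_lact (b : B) (x : subM Be_sub) : subM Be_sub :=
  inM (Be_lP b x : Be_sub _).
Fact Be_rP (x : subM Be_sub) (c : corner) : val x ** val c ** e = val x ** val c.
Proof. by rewrite -kmulA cornerr. Qed.
Definition Be_ract (x : subM Be_sub) (c : corner) : subM Be_sub :=
  inM (Be_rP x c : Be_sub _).

Fact eB_lP (c : corner) (x : subM eB_sub) : e ** (val c ** val x) = val c ** val x.
Proof. by rewrite kmulA cornerl. Qed.
Definition eB_lact (c : corner) (x : subM eB_sub) : subM eB_sub :=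
  inM (eB_lP c x : eB_sub _).
Fact eB_rP (x : subM eB_sub) b : e ** (val x ** b) = val x ** b.
Proof. by rewrite kmulA (subMP x). Qed.
Definition eB_ract (x : subM eB_sub) (b : B) : subM eB_sub :=
  inM (eB_rP x b : eB_sub _).

Fact Be_l_bilinear : bilinear_fun Be_lact.
Proof.
by split=> [v k x y|u k x y]; apply: val_inj; [exact: kmul_linl|exact: kmul_linr].
Qed.
Fact Be_r_bilinear : bilinear_fun Be_ract.
Proof.
by split=> [v k x y|u k x y]; apply: val_inj; [exact: kmul_linl|exact: kmul_linr].
Qed.
Fact Be_l_mul x y m : Be_lact (x ** y) m = Be_lact x (Be_lact y m).
Proof. by apply: val_inj; rewrite /= kmulA. Qed.
Fact Be_l_one m : Be_lact (kone B) m = m.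
Proof. by apply: val_inj; rewrite /= kmul1x. Qed.
Fact Be_r_mul m x y : Be_ract m (x ** y) = Be_ract (Be_ract m x) y.
Proof. by apply: val_inj; rewrite /= kmulA. Qed.
Fact Be_r_one m : Be_ract m (kone corner) = m.
Proof. by apply: val_inj; exact: (subMP m). Qed.
Fact Be_lract x m y : Be_ract (Be_lact x m) y = Be_lact x (Be_ract m y).
Proof. by apply: val_inj; rewrite /= kmulA. Qed.

Definition Be : bimod B corner :=
  Bimod Be_l_bilinear Be_r_bilinear Be_l_mul Be_l_one Be_r_mul Be_r_one Be_lract.

Fact eB_l_bilinear : bilinear_fun eB_lact.
Proof.
by split=> [v k x y|u k x y]; apply: val_inj; [exact: kmul_linl|exact: kmul_linr].
Qed.
Fact eB_r_bilinear : bilinear_fun eB_ract.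
Proof.
by split=> [v k x y|u k x y]; apply: val_inj; [exact: kmul_linl|exact: kmul_linr].
Qed.
Fact eB_l_mul x y m : eB_lact (x ** y) m = eB_lact x (eB_lact y m).
Proof. by apply: val_inj; rewrite /= kmulA. Qed.
Fact eB_l_one m : eB_lact (kone corner) m = m.
Proof. by apply: val_inj; exact: (subMP m). Qed.
Fact eB_r_mul m x y : eB_ract m (x ** y) = eB_ract (eB_ract m x) y.
Proof. by apply: val_inj; rewrite /= kmulA. Qed.
Fact eB_r_one m : eB_ract m (kone B) = m.
Proof. by apply: val_inj; rewrite /= kmulx1. Qed.
Fact eB_lract x m y : eB_ract (eB_lact x m) y = eB_lact x (eB_ract m y).
Proof. by apply: val_inj; rewrite /= kmulA. Qed.

Definition eB : bimod corner B :=
  Bimod eB_l_bilinear eB_r_bilinear eB_l_mul eB_l_one eB_r_mul eB_r_one eB_lract.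

Definition Be_e : Be := inM (ee : Be_sub e).
Definition eB_e : eB := inM (ee : eB_sub e).

Definition BeB_mem (x : B) : Prop :=
  exists s : seq (B * B), x = \sum_(p <- s) p.1 ** e ** p.2.

Fact BeB_0 : BeB_mem 0.
Proof. by exists [::]; rewrite big_nil. Qed.
Fact BeB_lin (k : K) (u v : B) : BeB_mem u -> BeB_mem v -> BeB_mem (k *: u + v).
Proof.
move=> [s ->] [t ->]; exists ([seq (k *: p.1, p.2) | p <- s] ++ t).
rewrite big_cat big_map scaler_sumr; congr (_ + _); apply: eq_bigr => p _ /=.
by rewrite !(lfZ (kmul_linl _)).
Qed.
Definition BeB_sub := Submod BeB_0 BeB_lin.
Fact BeB_l b x : BeB_sub x -> BeB_sub (b ** x).
Proof.
move=> [s ->]; exists [seq (b ** p.1, p.2) | p <- s].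
by rewrite big_map (lf_sum (kmul_linr _)); apply: eq_bigr => p _ /=; rewrite !kmulA.
Qed.
Fact BeB_r x b : BeB_sub x -> BeB_sub (x ** b).
Proof.
move=> [s ->]; exists [seq (p.1, p.2 ** b) | p <- s].
by rewrite big_map (lf_sum (kmul_linl _)); apply: eq_bigr => p _ /=; rewrite !kmulA.
Qed.
Definition BeB : ideal B := Ideal BeB_l BeB_r.

End Corner.

Section Tensor.
Variables (K : comPzRingType) (R S T : kalg K) (M : bimod R S) (N : bimod S T).

(* [:: (m1, n1); ..; (mk, nk)] stands for the sum of the mi (x) ni. *)
Inductive teq : seq (M * N) -> seq (M * N) -> Prop :=
| teq_refl s : teq s s
| teq_sym s t : teq s t -> teq t s
| teq_trans s t u : teq s t -> teq t u -> teq s u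
| teq_cat s s' t t' : teq s s' -> teq t t' -> teq (s ++ t) (s' ++ t')
| teq_swap s t : teq (s ++ t) (t ++ s)
| teq_0 n : teq [:: (0, n)] [::]
| teq_addl m m' n : teq [:: (m + m', n)] [:: (m, n); (m', n)]
| teq_addr m n n' : teq [:: (m, n + n')] [:: (m, n); (m, n')]
| teq_bal m x n : teq [:: (ract m x, n)] [:: (m, lact x n)].

Definition teqb : rel (seq (M * N)) := fun s t => `[< teq s t >].

Fact teqb_equiv : equiv_class_of teqb.
Proof.
split=> [s|s t|t s u].
- by apply/asboolP; exact: teq_refl.
- by apply/asboolP/asboolP; exact: teq_sym.
by move=> /asboolP h1 /asboolP h2; apply/asboolP; exact: teq_trans h1 h2.
Qed.
Canonical teqb_equivRel := EquivRelPack teqb_equiv.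
Canonical teqb_encModRel := defaultEncModRel teqb.

Definition tens_car := {eq_quot teqb}.
HB.instance Definition _ := EqQuotient.on tens_car.
HB.instance Definition _ := Choice.on tens_car.

Definition tcl (s : seq (M * N)) : tens_car := \pi_tens_car s.
Definition tpure (m : M) (n : N) : tens_car := tcl [:: (m, n)].

Lemma tclP s t : tcl s = tcl t <-> teq s t.
Proof.
by split=> [/eqmodP /= | h]; [move/asboolP | apply/eqmodP/asboolP].
Qed.

Lemma tclW (x : tens_car) : exists s, x = tcl s.
Proof. by exists (repr x); rewrite /tcl reprK. Qed.

Lemma tcl_repr (x : tens_car) : tcl (repr x) = x.
Proof. exact: reprK. Qed.
End Tensor.

Lemma teq_map (K : comPzRingType) (R S T R' S' T' : kalg K)
    (M : bimod R S) (N : bimod S T) (M' : bimod R' S') (N' : bimod S' T')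
    (f : M -> M') (g : N -> N') :
  linear_fun f -> linear_fun g ->
  (forall m x n, teq [:: (f (ract m x), g n)] [:: (f m, g (lact x n))]) ->
  forall s t, teq s t ->
    teq [seq (f p.1, g p.2) | p <- s] [seq (f p.1, g p.2) | p <- t].
Proof.
move=> fl gl fg s t; elim=> {s t} /=.
- by move=> s; exact: teq_refl.
- by move=> s t _; exact: teq_sym.
- by move=> s t u _ h1 _; exact: teq_trans.
- by move=> s s' t t' _ h1 _ h2; rewrite !map_cat; exact: teq_cat.
- by move=> s t; rewrite !map_cat; exact: teq_swap.
- by move=> n; rewrite (lf0 fl); exact: teq_0.
- by move=> m m' n; rewrite (lfD fl); exact: teq_addl.
- by move=> m n n'; rewrite (lfD gl); exact: teq_addr.
exact: fg.
Qed.

Section TensorOps.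
Variables (K : comPzRingType) (R S T R' S' T' : kalg K).
Variables (M : bimod R S) (N : bimod S T) (M' : bimod R' S') (N' : bimod S' T').

Definition tmap_fun (f : M -> M') (g : N -> N') (x : tens_car M N) :
    tens_car M' N' :=
  tcl [seq (f p.1, g p.2) | p <- repr x].

Lemma tmap_tcl (f : M -> M') (g : N -> N') : linear_fun f -> linear_fun g ->
  (forall m x n, teq [:: (f (ract m x), g n)] [:: (f m, g (lact x n))]) ->
  forall s, tmap_fun f g (tcl s) = tcl [seq (f p.1, g p.2) | p <- s].
Proof.
move=> fl gl fg s; apply/tclP/teq_map => //.
by apply/tclP; exact: tcl_repr.
Qed.
End TensorOps.

Section TensorModule.
Variables (K : comPzRingType) (R S T : kalg K) (M : bimod R S) (N : bimod S T).
Local Notation MN := (tens_car M N).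

Fact id_lin (V : lmodType K) : linear_fun (@id V). Proof. by []. Qed.
Fact opp_lin (V : lmodType K) : linear_fun (@GRing.opp V).
Proof. by move=> k u v; rewrite opprD scalerN. Qed.
Fact scale_lin (V : lmodType K) (k : K) : linear_fun (fun v : V => k *: v).
Proof. by move=> a u v; rewrite scalerDr !scalerA mulrC. Qed.

Definition tadd (x y : MN) : MN := tcl (repr x ++ repr y).
Definition topp : MN -> MN := tmap_fun (@GRing.opp M) id.
Definition tscale (k : K) : MN -> MN := tmap_fun (fun m : M => k *: m) id.
Definition tlact (x : R) : MN -> MN := tmap_fun (lact x) id.
Definition tract (z : MN) (y : T) : MN := tmap_fun id ((@ract K S T N)^~ y) z.

Lemma tadd_tcl s t : tadd (tcl s) (tcl t) = tcl (s ++ t) :> MN.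
Proof.
by apply/tclP/teq_cat; apply/tclP; exact: tcl_repr.
Qed.

Lemma topp_tcl s : topp (tcl s) = tcl [seq (- p.1, p.2) | p <- s].
Proof.
apply: tmap_tcl; [exact: opp_lin|exact: id_lin|move=> m x n].
by rewrite -(lfN (ract_lin _)); exact: teq_bal.
Qed.
Lemma tscale_tcl k s : tscale k (tcl s) = tcl [seq (k *: p.1, p.2) | p <- s].
Proof.
apply: tmap_tcl; [exact: scale_lin|exact: id_lin|move=> m x n].
by rewrite -(lfZ (ract_lin _)); exact: teq_bal.
Qed.
Lemma tlact_tcl x s : tlact x (tcl s) = tcl [seq (lact x p.1, p.2) | p <- s].
Proof.
apply: tmap_tcl; [exact: lact_lin|exact: id_lin|move=> m y n].
by rewrite -lract; exact: teq_bal.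
Qed.
Lemma tract_tcl s y : tract (tcl s) y = tcl [seq (p.1, ract p.2 y) | p <- s].
Proof.
apply: (tmap_tcl (f := id)); [exact: id_lin|exact: ract_lin|move=> m x n].
by rewrite lract; exact: teq_bal.
Qed.

Fact taddA : associative tadd.
Proof.
move=> x y z; have [s ->] := tclW x; have [t ->] := tclW y; have [u ->] := tclW z.
by rewrite !tadd_tcl catA.
Qed.
Fact taddC : commutative tadd.
Proof.
move=> x y; have [s ->] := tclW x; have [t ->] := tclW y.
by rewrite !tadd_tcl; apply/tclP; exact: teq_swap.
Qed.
Fact tadd0 : left_id (tcl [::]) tadd.
Proof. by move=> x; have [s ->] := tclW x; rewrite tadd_tcl. Qed.

Lemma teq_flatten (I : Type) (F G : I -> seq (M * N)) s :
  (forall p, teq (F p) (G p)) ->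
  teq (flatten [seq F p | p <- s]) (flatten [seq G p | p <- s]).
Proof.
by move=> h; elim: s => [|p s IH] /=; [exact: teq_refl|exact: teq_cat].
Qed.

Lemma teq_pairs (I : Type) (f g : I -> M * N) s :
  teq ([seq f p | p <- s] ++ [seq g p | p <- s])
      (flatten [seq [:: f p; g p] | p <- s]).
Proof.
elim: s => [|p s IH] /=; first exact: teq_refl.
rewrite -cat1s -[X in teq _ X]/([:: f p] ++ ([:: g p] ++ _)).
apply: teq_cat; first exact: teq_refl.
rewrite -cat1s; apply: teq_trans (_ : teq (([:: g p] ++ [seq f i | i <- s])
  ++ [seq g i | i <- s]) _).
  rewrite catA; apply: teq_cat; last exact: teq_refl.
  exact: teq_swap.
by rewrite -catA; apply: teq_cat; first exact: teq_refl.
Qed.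

Lemma map_flatten1 (I : Type) (f : I -> M * N) s :
  [seq f p | p <- s] = flatten [seq [:: f p] | p <- s].
Proof. by elim: s => //= p s ->. Qed.

Fact taddN : left_inverse (tcl [::]) topp tadd.
Proof.
move=> x; have [s ->] := tclW x; rewrite topp_tcl tadd_tcl; apply/tclP.
rewrite -{2}[s]map_id; apply: (teq_trans (teq_pairs _ _ _)).
rewrite -[X in teq _ X](_ : flatten [seq [::] | p <- s] = [::]); last by elim: s.
apply: teq_flatten => -[m n] /=.
by apply: teq_trans (teq_0 _ n); rewrite -(addNr m); apply/teq_sym/teq_addl.
Qed.

HB.instance Definition _ := GRing.isZmodule.Build MN taddA taddC tadd0 taddN.

Fact tscaleA a b x : tscale a (tscale b x) = tscale (a * b) x.
Proof.
have [s ->] := tclW x; rewrite !tscale_tcl -map_comp.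
by congr tcl; apply: eq_map => p /=; rewrite scalerA.
Qed.
Fact tscale1 : left_id 1 tscale.
Proof.
move=> x; have [s ->] := tclW x; rewrite tscale_tcl.
by congr tcl; rewrite -[RHS]map_id; apply: eq_map => -[m n] /=; rewrite scale1r.
Qed.
Fact tscaleDr : right_distributive tscale +%R.
Proof.
move=> a x y; have [s ->] := tclW x; have [t ->] := tclW y.
by rewrite -[tcl s + _]/(tadd _ _) -[RHS]/(tadd _ _) tadd_tcl !tscale_tcl
  tadd_tcl map_cat.
Qed.
Fact tscaleDl x : {morph tscale^~ x : a b / a + b}.
Proof.
move=> a b; have [s ->] := tclW x; rewrite -[RHS]/(tadd _ _) !tscale_tcl tadd_tcl.
apply/tclP/teq_sym; apply: (teq_trans (teq_pairs _ _ _)).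
rewrite map_flatten1; apply: teq_flatten => -[m n] /=.
by rewrite scalerDl; apply/teq_sym/teq_addl.
Qed.

HB.instance Definition _ :=
  GRing.Zmodule_isLmodule.Build K MN tscaleA tscale1 tscaleDr tscaleDl.

Lemma tclD s t : tcl s + tcl t = tcl (s ++ t) :> MN.
Proof. exact: tadd_tcl. Qed.
Lemma tclZ k s : k *: tcl s = tcl [seq (k *: p.1, p.2) | p <- s] :> MN.
Proof. exact: tscale_tcl. Qed.

Lemma tcl_sum s : tcl s = \sum_(p <- s) tpure p.1 p.2 :> MN.
Proof.
elim: s => [|[m n] s IH]; first by rewrite big_nil.
by rewrite big_cons -IH tclD.
Qed.

Fact tlact_bilinear : bilinear_fun tlact.
Proof.
split=> [z k x y|x k u v].
  have [s ->] := tclW z; rewrite !tlact_tcl tclZ tclD -map_comp.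
  apply/tclP/teq_sym; apply: (teq_trans (teq_pairs _ _ _)).
  rewrite map_flatten1; apply: teq_flatten => -[m n] /=.
  have [-> _] := lact_bilinear M; exact/teq_sym/teq_addl.
have [s ->] := tclW u; have [t ->] := tclW v.
rewrite tclZ tclD !tlact_tcl tclZ tclD map_cat -!map_comp.
by congr (tcl (_ ++ _)); apply: eq_map => p /=; rewrite (lfZ (lact_lin _)).
Qed.
Fact tract_bilinear : bilinear_fun tract.
Proof.
split=> [y k u v|z k x y].
  have [s ->] := tclW u; have [t ->] := tclW v.
  by rewrite tclZ tclD !tract_tcl tclZ tclD map_cat -!map_comp.
have [s ->] := tclW z; rewrite !tract_tcl tclZ tclD -map_comp.
apply/tclP/teq_sym; apply: (teq_trans (teq_pairs _ _ _)).
rewrite map_flatten1; apply: teq_flatten => -[m n] /=.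
have [_ ->] := ract_bilinear N; apply: teq_trans (teq_sym (teq_addr _ _ _)).
rewrite -cat1s -[X in teq _ X]cat1s.
apply: teq_cat; last exact: teq_refl.
have hM : k *: m = ract m (k *: kone S).
  by have [_ h] := ract_bilinear M; rewrite (lfZ (h m)) ract_one.
have hN : k *: ract n x = lact (k *: kone S) (ract n x).
  by have [h _] := lact_bilinear N; rewrite (lfZ (h _)) lact_one.
by rewrite hM hN; exact: teq_bal.
Qed.
Fact tlact_mul x y z : tlact (x ** y) z = tlact x (tlact y z).
Proof.
have [s ->] := tclW z; rewrite !tlact_tcl -map_comp.
by congr tcl; apply: eq_map => p /=; rewrite lact_mul.
Qed.
Fact tlact_one z : tlact (kone R) z = z.
Proof.
have [s ->] := tclW z; rewrite tlact_tcl; congr tcl.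
by rewrite -[RHS]map_id; apply: eq_map => -[m n] /=; rewrite lact_one.
Qed.
Fact tract_mul z x y : tract z (x ** y) = tract (tract z x) y.
Proof.
have [s ->] := tclW z; rewrite !tract_tcl -map_comp.
by congr tcl; apply: eq_map => p /=; rewrite ract_mul.
Qed.
Fact tract_one z : tract z (kone T) = z.
Proof.
have [s ->] := tclW z; rewrite tract_tcl; congr tcl.
by rewrite -[RHS]map_id; apply: eq_map => -[m n] /=; rewrite ract_one.
Qed.
Fact tlract x z y : tract (tlact x z) y = tlact x (tract z y).
Proof.
by have [s ->] := tclW z; rewrite !(tract_tcl, tlact_tcl) -!map_comp.
Qed.

Definition tens : bimod R T :=
  Bimod tlact_bilinear tract_bilinear tlact_mul tlact_one tract_mul tract_one
    tlract.

Lemma tens_ind (P : tens -> Prop) :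
  P 0 -> (forall m n z, P z -> P (tpure m n + z)) -> forall z, P z.
Proof.
move=> P0 PD z; have [s ->] := tclW z; rewrite tcl_sum.
elim: s => [|[m n] s IH]; first by rewrite big_nil.
by rewrite big_cons; exact: PD.
Qed.

End TensorModule.

Section TensorHom.
Variables (K : comPzRingType) (R S T : kalg K).

Record tbalanced (M : bimod R S) (N : bimod S T) (V : bimod R T) := TBalanced {
  tb :> M -> N -> V;
  tb_bilinear : bilinear_fun tb;
  tb_bal : forall m x n, tb (ract m x) n = tb m (lact x n);
  tb_l : forall x m n, tb (lact x m) n = lact x (tb m n);
  tb_r : forall m n y, tb m (ract n y) = ract (tb m n) y
}.

Section Lift.
Variables (M : bimod R S) (N : bimod S T) (V : bimod R T) (f : tbalanced M N V).

Definition tlift_fun (z : tens M N) : V := \sum_(p <- repr z) f p.1 p.2.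

Lemma tlift_tcl s : tlift_fun (tcl s) = \sum_(p <- s) f p.1 p.2.
Proof.
have [fl fr] := tb_bilinear f.
have h t u : teq t u -> \sum_(p <- t) f p.1 p.2 = \sum_(p <- u) f p.1 p.2.
  elim=> {t u} //.
  - by move=> t u v _ -> _ ->.
  - by move=> t t' u u' _ h1 _ h2; rewrite !big_cat /= h1 h2.
  - by move=> t u; rewrite !big_cat /= addrC.
  - by move=> n; rewrite big_seq1 big_nil /= (lf0 (fl n)).
  - by move=> m m' n; rewrite !big_cons !big_nil /= !addr0 (lfD (fl n)).
  - by move=> m n n'; rewrite !big_cons !big_nil /= !addr0 (lfD (fr m)).
  by move=> m x n; rewrite !big_seq1 /= tb_bal.
by apply: h; apply/tclP; exact: tcl_repr.
Qed.

Lemma tlift_pure m n : tlift_fun (tpure m n) = f m n.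
Proof. by rewrite tlift_tcl big_seq1. Qed.

Fact tlift_is_bihom : is_bihom tlift_fun.
Proof.
have [fl fr] := tb_bilinear f.
split=> [k u v|x z|z y].
- have [s ->] := tclW u; have [t ->] := tclW v.
  rewrite tclZ tclD !tlift_tcl big_cat big_map scaler_sumr; congr (_ + _).
  by apply: eq_bigr => p _ /=; rewrite (lfZ (fl _)).
- have [s ->] := tclW z; rewrite [lact x _]tlact_tcl !tlift_tcl big_map.
  by rewrite (lf_sum (lact_lin _)); apply: eq_bigr => p _; rewrite tb_l.
have [s ->] := tclW z; rewrite [ract _ y]tract_tcl !tlift_tcl big_map.
by rewrite (lf_sum (ract_lin _)); apply: eq_bigr => p _; rewrite tb_r.
Qed.

Definition tlift : bihom (tens M N) V := Bihom tlift_is_bihom.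
End Lift.

Section Map.
Variables (M M' : bimod R S) (N N' : bimod S T) (f : bihom M M') (g : bihom N N').

Lemma tpure_bilinear : bilinear_fun (fun (m : M') (n : N') => tpure m n : tens M' N').
Proof.
split=> [n k m m'|m k n n'].
  by rewrite tclZ tclD; apply/tclP; exact: teq_addl.
rewrite tclZ tclD /=; apply/tclP; apply: (teq_trans (teq_addr _ _ _)).
rewrite -cat1s -[X in teq _ X]cat1s; apply: teq_cat; last exact: teq_refl.
have hM : k *: m = ract m (k *: kone S).
  by have [_ h] := ract_bilinear M'; rewrite (lfZ (h m)) ract_one.
have hN : k *: n = lact (k *: kone S) n.
  by have [h _] := lact_bilinear N'; rewrite (lfZ (h _)) lact_one.
by rewrite hM hN; apply/teq_sym/teq_bal.
Qed.

Fact tmap_bilinear :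
  bilinear_fun (fun (m : M) (n : N) => tpure (f m) (g n) : tens M' N').
Proof.
have [hl hr] := tpure_bilinear.
by split=> [n k m m'|m k n n']; rewrite bh_lin; [exact: hl|exact: hr].
Qed.
Fact tmap_bal m x n : tpure (f (ract m x)) (g n) = tpure (f m) (g (lact x n)).
Proof. by rewrite bh_r bh_l; apply/tclP; exact: teq_bal. Qed.
Fact tmap_l x m n :
  tpure (f (lact x m)) (g n) = lact x (tpure (f m) (g n) : tens M' N').
Proof. by rewrite [RHS]tlact_tcl bh_l. Qed.
Fact tmap_r m n y :
  tpure (f m) (g (ract n y)) = ract (tpure (f m) (g n) : tens M' N') y.
Proof. by rewrite [RHS]tract_tcl bh_r. Qed.

Definition tmap : bihom (tens M N) (tens M' N') :=
  tlift (TBalanced tmap_bilinear tmap_bal tmap_l tmap_r).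

Lemma tmap_pure m n : tmap (tpure m n) = tpure (f m) (g n).
Proof. exact: tlift_pure. Qed.
End Map.

Lemma tens_ext (M : bimod R S) (N : bimod S T) (V : lmodType K)
    (f g : tens M N -> V) : linear_fun f -> linear_fun g ->
  (forall m n, f (tpure m n) = g (tpure m n)) -> forall z, f z = g z.
Proof.
move=> fl gl h; elim/tens_ind => [|m n z IH]; first by rewrite (lf0 fl) (lf0 gl).
by rewrite (lfD fl) (lfD gl) h IH.
Qed.

End TensorHom.

Record cplx (K : comPzRingType) (R S : kalg K) := Cplx {
  cob :> nat -> bimod R S;
  cd : forall n, bihom (cob n.+1) (cob n);
  cdd : forall n x, cd n (cd n.+1 x) = 0
}.

Record cmap (K : comPzRingType) (R S : kalg K) (P Q : cplx R S) := Cmap {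
  cm :> forall n, bihom (P n) (Q n);
  cm_d : forall n x, cm n (cd P n x) = cd Q n (cm n.+1 x)
}.

(* P is a projective resolution, with augmentation eps, of the
   subbimodule X of M. *)
Definition resolves (K : comPzRingType) (R S : kalg K) (P : cplx R S)
    (M : bimod R S) (eps : bihom (P 0%N) M) (X : M -> Prop) : Prop :=
  [/\ forall n, biprojective (P n),
      forall m, X m <-> exists x, eps x = m,
      forall x, eps x = 0 <-> exists y, cd P 0%N y = x
    & forall n x, cd P n x = 0 -> exists y, cd P n.+1 y = x].

Definition projective_resolution (K : comPzRingType) (R S : kalg K)
    (P : cplx R S) (M : bimod R S) (eps : bihom (P 0%N) M) : Prop :=
  resolves eps (fun _ => True).

Section Homology.
Variables (K : comPzRingType) (R S : kalg K) (C : cplx R S).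

Definition cyc_mem n : C n -> Prop :=
  match n with 0%N => fun _ => True | n'.+1 => fun x => cd C n' x = 0 end.
Fact cyc_0 n : cyc_mem (0 : C n).
Proof. by case: n => //= n; exact: (lf0 (bh_lin _)). Qed.
Fact cyc_lin n (k : K) (u v : C n) :
  cyc_mem u -> cyc_mem v -> cyc_mem (k *: u + v).
Proof. by case: n u v => //= n u v hu hv; rewrite bh_lin hu hv scaler0 addr0. Qed.
Definition cyc n := Submod (cyc_0 n) (@cyc_lin n).

Definition bnd_mem n (x : C n) : Prop := exists y, cd C n y = x.
Fact bnd_0 n : bnd_mem (0 : C n).
Proof. by exists 0; exact: (lf0 (bh_lin _)). Qed.
Fact bnd_lin n (k : K) (u v : C n) :
  bnd_mem u -> bnd_mem v -> bnd_mem (k *: u + v).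
Proof. by move=> [x <-] [y <-]; exists (k *: x + y); rewrite bh_lin. Qed.
Definition bnd n := Submod (bnd_0 n) (@bnd_lin n).

Definition homology n : lmodType K := subquo (cyc n) (bnd n).
End Homology.

Section TensorComplex.
Variables (K : comPzRingType) (R S T : kalg K).

Section Right.
Variables (P : cplx R S) (N : bimod S T).
Fact tensr_dd n (x : tens (P n.+2) N) :
  tmap (cd P n) (idbh N) (tmap (cd P n.+1) (idbh N) x) = 0.
Proof.
elim/tens_ind: x => [|m y z IH]; first by rewrite !(lf0 (bh_lin _)).
rewrite !(lfD (bh_lin _)) IH !tmap_pure cdd addr0.
by apply/tclP; exact: teq_0.
Qed.
Definition tensr : cplx R T := Cplx tensr_dd.
End Right.

Section Left.
Variables (M : bimod R S) (P : cplx S T).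
Fact tensl_dd n (x : tens M (P n.+2)) :
  tmap (idbh M) (cd P n) (tmap (idbh M) (cd P n.+1) x) = 0.
Proof.
elim/tens_ind: x => [|m y z IH]; first by rewrite !(lf0 (bh_lin _)).
rewrite !(lfD (bh_lin _)) IH !tmap_pure cdd addr0.
have [_ h] := tpure_bilinear M (P n); exact: (lf0 (h _)).
Qed.
Definition tensl : cplx R T := Cplx tensl_dd.
End Left.

End TensorComplex.

(* Tor_n^S(M, N) = 0, computed from a projective resolution of the right
   S-module M. *)
Definition Tor_eq0 (K : comPzRingType) (R S T : kalg K) (n : nat)
    (M : bimod R S) (N : bimod S T) : Prop :=
  exists (P : cplx (kbase K) S)
         (eps : bihom (P 0%N) (res (unit_hom R) (id_hom S) M)),
    projective_resolution eps /\ forall x : homology (tensr P N) n, x = 0.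

Section Ext.
Variables (K : comPzRingType) (R S : kalg K) (P : cplx R S) (M : bimod R S).

Definition ext_cocycle_mem n (f : P n -> M) : Prop :=
  is_bihom f /\ forall x, f (cd P n x) = 0.
Definition ext_coboundary_mem n : (P n -> M) -> Prop :=
  match n with
  | 0%N => fun f => f = 0
  | n'.+1 => fun f =>
      exists g : P n' -> M, is_bihom g /\ f = (fun x => g (cd P n' x))
  end.

Fact is_bihom_0 (N : bimod R S) : is_bihom (0 : N -> M).
Proof.
split=> [k u v|x m|m y]; rewrite ?scaler0 ?addr0 //.
  by rewrite (lf0 (lact_lin _)).
by rewrite (lf0 (ract_lin _)).
Qed.
Fact is_bihom_lin (N : bimod R S) (k : K) (f g : N -> M) :
  is_bihom f -> is_bihom g -> is_bihom (k *: f + g).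
Proof.
move=> [fl fx fy] [gl gx gy]; split=> [a u v|x m|m y].
- rewrite -![(k *: f + g) _]/(k *: f _ + g _) fl gl !scalerDr !scalerA.
  by rewrite mulrC addrACA.
- by rewrite -![(k *: f + g) _]/(k *: f _ + g _) fx gx lact_lin.
by rewrite -![(k *: f + g) _]/(k *: f _ + g _) fy gy ract_lin.
Qed.

Fact ext_cocycle_0 n : ext_cocycle_mem (0 : P n -> M).
Proof. by split=> //; exact: is_bihom_0. Qed.
Fact ext_cocycle_lin n (k : K) (f g : P n -> M) :
  ext_cocycle_mem f -> ext_cocycle_mem g -> ext_cocycle_mem (k *: f + g).
Proof.
move=> [fh fd] [gh gd]; split=> [|x]; first exact: is_bihom_lin.
by rewrite -[LHS]/(k *: f _ + g _) fd gd scaler0 addr0.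
Qed.
Definition ext_cocycle n := Submod (ext_cocycle_0 n) (@ext_cocycle_lin n).

Fact ext_coboundary_0 n : ext_coboundary_mem (0 : P n -> M).
Proof. by case: n => [|n] //=; exists 0; split=> //; exact: is_bihom_0. Qed.
Fact ext_coboundary_lin n (k : K) (f g : P n -> M) :
  ext_coboundary_mem f -> ext_coboundary_mem g -> ext_coboundary_mem (k *: f + g).
Proof.
case: n f g => [|n] f g /=; first by move=> -> ->; rewrite scaler0 addr0.
move=> [f' [f'h ->]] [g' [g'h ->]]; exists (k *: f' + g'); split=> //.
exact: is_bihom_lin.
Qed.
Definition ext_coboundary n :=
  Submod (ext_coboundary_0 n) (@ext_coboundary_lin n).

(* H^n of Hom(P, M): when P is a projective resolution of X, this is
   Ext^n(X, M). *)
Definition Ext n : lmodType K := subquo (ext_cocycle n) (ext_coboundary n).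
End Ext.

(* The map induced by composition with phi, which commutes with the
   differentials up to sign in all uses below. *)
Definition ext_pull (K : comPzRingType) (R S : kalg K) (P Q : cplx R S)
    (M : bimod R S) (m n : nat) (phi : P m -> Q n) (a : Ext Q M n) : Ext P M m :=
  hcl _ _ (fun x => hrep a (phi x)).

Section Bar.
Variables (K : comPzRingType) (L : kalg K).

(* L (x)_K X *)
Definition ltens (X : bimod L L) : bimod L L :=
  tens (res (id_hom L) (unit_hom L) (reg L)) (res (unit_hom L) (id_hom L) X).

Definition lpure (X : bimod L L) (a : L) (x : X) : ltens X :=
  tpure (a : res (id_hom L) (unit_hom L) (reg L))
        (x : res (unit_hom L) (id_hom L) X).

Fact lmult_bilinear (X : bimod L L) :
  bilinear_fun (fun (a : res (id_hom L) (unit_hom L) (reg L))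
                    (x : res (unit_hom L) (id_hom L) X) => lact (a : L) (x : X) : X).
Proof. exact: lact_bilinear. Qed.

Definition lmult (X : bimod L L) : bihom (ltens X) X :=
  @tlift K L (kbase K) L (res (id_hom L) (unit_hom L) (reg L))
    (res (unit_hom L) (id_hom L) X) X
    (TBalanced (lmult_bilinear X)
       (fun a k x => lact_mul (a : L) (unit_hom L k) (x : X))
       (fun b a x => lact_mul (b : L) (a : L) (x : X))
       (fun a x b => esym (lract (a : L) (x : X) b))).

Fact res_is_bihom (X Y : bimod L L) (f : bihom X Y) :
  is_bihom (f : res (unit_hom L) (id_hom L) X -> res (unit_hom L) (id_hom L) Y).
Proof. split=> [|x m|m x]; [exact: (bh_lin f)|exact: (bh_l f)|exact: (bh_r f)]. Qed.

Definition ltmap (X Y : bimod L L) (f : bihom X Y) : bihom (ltens X) (ltens Y) :=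
  tmap (idbh _) (Bihom (res_is_bihom f)).

Fact subbh_is_bihom (X Y : bimod L L) (f g : bihom X Y) :
  is_bihom (fun x => f x - g x).
Proof.
split=> [k u v|x m|m y].
- by rewrite !bh_lin scalerBr opprD addrACA.
- by rewrite !bh_l (lfB (lact_lin _)).
by rewrite !bh_r (lfB (ract_lin _)).
Qed.
Definition subbh (X Y : bimod L L) (f g : bihom X Y) := Bihom (subbh_is_bihom f g).

(* barX n is the (n+1)-fold tensor power of L over K, and
   bard n : barX n.+1 -> barX n is a (x) x |-> a x - a (x) bard x, i.e. the
   alternating sum of the multiplications of adjacent factors. *)
Fixpoint barX (n : nat) : bimod L L :=
  match n with 0%N => reg L | n'.+1 => ltens (barX n') end.

Fixpoint bard (n : nat) : bihom (barX n.+1) (barX n) :=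
  match n with
  | 0%N => lmult (reg L)
  | n'.+1 => subbh (lmult (barX n'.+1)) (ltmap (bard n'))
  end.

Lemma bard_pure n (a : L) (x : barX n.+1) :
  bard n.+1 (lpure a x) = lact a x - lpure a (bard n x).
Proof.
rewrite -[LHS]/(lmult _ (lpure a x) - ltmap (bard n) (lpure a x)).
by congr (_ - _); [exact: tlift_pure|exact: tmap_pure].
Qed.

Lemma bard0_pure (a x : L) : bard 0 (@lpure (reg L) a x) = a ** x.
Proof. exact: tlift_pure. Qed.

Fact bar_dd n x : bard n (bard n.+1 x) = 0.
Proof.
elim: n x => [|n IH] x.
  elim/tens_ind: x => [|a x z IHz]; first by rewrite !(lf0 (bh_lin _)).
  rewrite [bard 1 _](lfD (bh_lin _)) (lfD (bh_lin _)) IHz addr0.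
  by rewrite bard_pure (lfB (bh_lin _)) bh_l bard0_pure subrr.
elim/tens_ind: x => [|a x z IHz]; first by rewrite !(lf0 (bh_lin _)).
rewrite [bard n.+2 _](lfD (bh_lin _)) (lfD (bh_lin _)) IHz addr0.
rewrite bard_pure (lfB (bh_lin _)) bh_l bard_pure IH.
have [_ h] := tpure_bilinear (res (id_hom L) (unit_hom L) (reg L))
  (res (unit_hom L) (id_hom L) (barX n)).
by rewrite /lpure (lf0 (h _)) subr0 subrr.
Qed.

Definition bar : cplx L L := @Cplx K L L (fun n => barX n.+1) (fun n => bard n.+1)
  (fun n x => @bar_dd n.+1 x).

Definition bar_eps : bihom (bar 0%N) (reg L) := bard 0.

(* s0 (x) s1 (x) .. (x) s(n-1) (x) 1, for s of size n *)
Fixpoint bar_word (n : nat) (s : seq L) : barX n :=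
  match n with
  | 0%N => kone L
  | n'.+1 => lpure (head 0 s) (bar_word n' (behead s))
  end.

End Bar.

Section Hochschild.
Variables (K : comPzRingType) (L : kalg K).

(* A cochain of degree n, i.e. a K-multilinear map L^n -> M, is encoded as a
   function on sequences that vanishes outside sequences of size n. *)
Definition is_cochain (M : bimod L L) (n : nat) (f : seq L -> M) : Prop :=
  (forall s, size s != n -> f s = 0) /\
  (forall s1 s2 (k : K) (x y : L),
     f (s1 ++ (k *: x + y) :: s2) = k *: f (s1 ++ x :: s2) + f (s1 ++ y :: s2)).

(* On a sequence of size n.+1 this is the usual
   s0 f(s1, .., sn) + \sum_(i < n) (-1)^(i+1) f(.., si s(i+1), ..)
     + (-1)^(n+1) f(s0, .., s(n-1)) sn;
   on other sizes it vanishes if f is a cochain of degree n. *)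
Definition hdiff (M : bimod L L) (f : seq L -> M) : seq L -> M := fun s =>
  lact (head 0 s) (f (behead s))
  + \sum_(i < (size s).-1)
      (-1 : K) ^+ i.+1 *: f (take i s ++ (s`_i ** s`_i.+1) :: drop i.+2 s)
  + (-1 : K) ^+ size s *: ract (f (take (size s).-1 s)) (last 0 s).

Section Cohomology.
Variable M : bimod L L.

Definition hh_cocycle_mem n (f : seq L -> M) : Prop :=
  is_cochain n f /\ hdiff f = 0.
Definition hh_coboundary_mem n (f : seq L -> M) : Prop :=
  match n with
  | 0%N => f = 0
  | n'.+1 => exists g, is_cochain n' g /\ f = hdiff g
  end.

Fact is_cochain_0 n : is_cochain n (0 : seq L -> M).
Proof. by split=> // s1 s2 k x y; rewrite -[RHS]/(k *: 0 + 0) scaler0 addr0. Qed.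
Fact is_cochain_lin n (k : K) (f g : seq L -> M) :
  is_cochain n f -> is_cochain n g -> is_cochain n (k *: f + g).
Proof.
move=> [f0 fl] [g0 gl]; split=> [s hs|s1 s2 a x y].
  by rewrite -[LHS]/(k *: f s + g s) f0 // g0 // scaler0 addr0.
rewrite -![(k *: f + g) _]/(k *: f _ + g _) fl gl !scalerDr !scalerA.
by rewrite mulrC addrACA.
Qed.
Fact hdiff_lin (k : K) (f g : seq L -> M) :
  hdiff (k *: f + g) = k *: hdiff f + hdiff g.
Proof.
apply/funext => s; rewrite -[RHS]/(k *: hdiff f s + hdiff g s) /hdiff.
rewrite -![(k *: f + g) _]/(k *: f _ + g _) lact_lin ract_lin.
rewrite !scalerDr !scalerA [_ * k]mulrC -!scalerA.
rewrite (eq_bigr (fun i : 'I_(size s).-1 => k *: ((-1 : K) ^+ i.+1 *: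
    f (take i s ++ (s`_i ** s`_i.+1) :: drop i.+2 s)) + (-1 : K) ^+ i.+1 *:
    g (take i s ++ (s`_i ** s`_i.+1) :: drop i.+2 s))); last first.
  move=> i _; rewrite -[(k *: f + g) _]/(k *: f _ + g _).
  by rewrite scalerDr !scalerA [_ * k]mulrC.
rewrite big_split /= scaler_sumr.
have aux (a a' b b' c c' : M) :
    a + a' + (b + b') + (c + c') = (a + b + c) + (a' + b' + c').
  by rewrite (addrACA a) (addrACA (a + b)).
exact: aux.
Qed.
Fact hdiff_0 : hdiff (0 : seq L -> M) = 0.
Proof.
by have := hdiff_lin (-1) 0 0; rewrite scaler0 addr0 scaleN1r addNr.
Qed.

Fact hh_cocycle_0 n : hh_cocycle_mem n 0.
Proof. by split; [exact: is_cochain_0|exact: hdiff_0]. Qed.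
Fact hh_cocycle_lin n (k : K) f g :
  hh_cocycle_mem n f -> hh_cocycle_mem n g -> hh_cocycle_mem n (k *: f + g).
Proof.
move=> [fc fd] [gc gd]; split; first exact: is_cochain_lin.
by rewrite hdiff_lin fd gd scaler0 addr0.
Qed.
Definition hh_cocycle n := Submod (hh_cocycle_0 n) (@hh_cocycle_lin n).

Fact hh_coboundary_0 n : hh_coboundary_mem n 0.
Proof.
case: n => [|n] //=; exists 0; rewrite hdiff_0; split=> //.
exact: is_cochain_0.
Qed.
Fact hh_coboundary_lin n (k : K) f g :
  hh_coboundary_mem n f -> hh_coboundary_mem n g ->
  hh_coboundary_mem n (k *: f + g).
Proof.
case: n => [|n] /=; first by move=> -> ->; rewrite scaler0 addr0.
move=> [f' [f'c ->]] [g' [g'c ->]]; exists (k *: f' + g').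
by rewrite hdiff_lin; split=> //; exact: is_cochain_lin.
Qed.
Definition hh_coboundary n := Submod (hh_coboundary_0 n) (@hh_coboundary_lin n).

Definition HH n : lmodType K := subquo (hh_cocycle n) (hh_coboundary n).

(* The map Ext^n(L, M) -> HH^n(L, M) given on representatives by
   F |-> ((a1, .., an) |-> F (1 (x) a1 (x) .. (x) an (x) 1)). *)
Definition ext_to_HH n (a : Ext (bar L) M n) : HH n :=
  hcl _ _ (fun s => if size s == n then hrep a (bar_word n.+1 (kone L :: s))
                    else 0).
End Cohomology.

(* L^ev-projectivity and exactness of the bar complex, and the identification
   Ext^n_{L^ev}(L, M) = HH^n(L, M). *)
Definition bar_computes_HH : Prop :=
  projective_resolution (bar_eps L) /\
  forall (M : bimod L L) n, bijective (@ext_to_HH M n).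

Definition HH_map (M N : bimod L L) (u : M -> N) n (a : HH M n) : HH N n :=
  hcl _ _ (fun s => u (hrep a s)).

(* For cochains f, g of degrees m, n these formulas vanish on sequences of the
   wrong size.  Exponents of -1 only matter modulo 2, so n.+1 replaces n - 1. *)
Definition cup (m : nat) (f g : seq L -> L) : seq L -> L :=
  fun s => f (take m s) ** g (drop m s).
Definition circ (m n : nat) (f g : seq L -> L) : seq L -> L := fun s =>
  \sum_(i < m) (-1 : K) ^+ (i * n.+1) *:
     f (take i s ++ g (take n (drop i s)) :: drop (i + n) s).
Definition bracket (m n : nat) (f g : seq L -> L) : seq L -> L := fun s =>
  circ m n f g s - (-1 : K) ^+ (m.+1 * n.+1) *: circ n m g f s.

Definition HHone : HH (reg L) 0 :=
  hcl _ _ (fun s : seq L => if s is [::] then kone L else 0).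
Definition HHcup m n (a : HH (reg L) m) (b : HH (reg L) n) : HH (reg L) (m + n) :=
  hcl _ _ (cup m (hrep a) (hrep b)).
Definition HHbracket m n (a : HH (reg L) m) (b : HH (reg L) n) :
    HH (reg L) (m + n).-1 :=
  hcl _ _ (bracket m n (hrep a) (hrep b)).
Definition HHsq n (a : HH (reg L) (2 * n)) : HH (reg L) (4 * n).-1 :=
  hcl _ _ (circ (2 * n) (2 * n) (hrep a) (hrep a)).

End Hochschild.

Definition gerstenhaber_hom (K : comPzRingType) (L L' : kalg K)
    (k : forall n, HH (reg L) n -> HH (reg L') n) : Prop :=
  [/\ forall n, linear_fun (k n),
      k 0%N (HHone L) = HHone L' /\
      forall m n (a : HH (reg L) m) (b : HH (reg L) n),
        k _ (HHcup a b) = HHcup (k m a) (k n b),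
      forall m n (a : HH (reg L) m) (b : HH (reg L) n),
        k _ (HHbracket a b) = HHbracket (k m a) (k n b)
    & forall n (a : HH (reg L) (2 * n)), k _ (HHsq a) = HHsq (k (2 * n)%N a)].

(* 0 -> X^0 -> Y^0 -> Z^0 -> X^1 -> Y^1 -> .. is an exact sequence of
   K-modules *)
Definition long_exact (K : comPzRingType) (X Y Z : nat -> lmodType K)
    (f : forall n, X n -> Y n) (g : forall n, Y n -> Z n)
    (d : forall n, Z n -> X n.+1) : Prop :=
  [/\ forall n, [/\ linear_fun (f n), linear_fun (g n) & linear_fun (d n)],
      injective (f 0%N),
      forall n y, g n y = 0 <-> exists x, f n x = y,
      forall n z, d n z = 0 <-> exists y, g n y = z
    & forall n x, f n.+1 x = 0 <-> exists z, d n z = x].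

Section Augmentation.
Variable K : comPzRingType.

Fact comp_is_bihom (R S : kalg K) (M N P : bimod R S) (g : bihom N P)
  (f : bihom M N) : is_bihom (fun x => g (f x)).
Proof. by split=> [k u v|x m|m x]; rewrite ?bh_lin ?bh_l ?bh_r. Qed.
Definition compbh (R S : kalg K) (M N P : bimod R S) (g : bihom N P)
  (f : bihom M N) : bihom M P := Bihom (comp_is_bihom g f).

Definition rmult (R S : kalg K) (M : bimod R S) : bihom (tens M (reg S)) M :=
  tlift (@TBalanced K R S S M (reg S) M (@ract K R S M) (ract_bilinear M)
    (fun m x y => esym (ract_mul m x y))
    (fun x m y => lract x m y)
    (fun m y x => ract_mul m y x)).

(* M (x) P_0 (x) N -> M (x) N -> V, for an augmentation P_0 -> S *)
Definition aug3 (R S T : kalg K) (M : bimod R S) (P : cplx S S)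
    (eps : bihom (P 0%N) (reg S)) (N : bimod S T) (V : bimod R T)
    (mu : bihom (tens M N) V) : bihom (tensr (tensl M P) N 0%N) V :=
  compbh mu (tmap (compbh (rmult M) (tmap (idbh M) eps)) (idbh N)).
End Augmentation.

Section QuotientAlgebra.
Variables (K : comPzRingType) (B A : kalg K) (pi : alghom B A).

Definition AB : bimod A B := res (id_hom A) pi (reg A).
Definition BA : bimod B A := res pi (id_hom A) (reg A).
Definition BAB : bimod B B := res pi pi (reg A).

Definition mul_AB_BA : bihom (tens AB BA) (reg A) :=
  tlift (@TBalanced K A B A AB BA (reg A) (@kmul K A) (kmul_bilinear A)
    (fun m x n => esym (kmulA (m : A) (pi x) (n : A)))
    (fun x m n => esym (kmulA x (m : A) (n : A)))
    (fun m n y => kmulA (m : A) (n : A) y)).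

(* A (x)_B bar B (x)_B A *)
Definition bar_AA : cplx A A := tensr (tensl AB (bar B)) BA.
Definition bar_AA_eps : bihom (bar_AA 0%N) (reg A) :=
  aug3 (bar_eps B) mul_AB_BA.

Definition adj_AA n (a : Ext bar_AA (reg A) n) : Ext (bar B) BAB n :=
  hcl _ _ (fun x : bar B n =>
    hrep a (tpure (tpure (kone A : AB) x : tensl AB (bar B) n) (kone A : BA))).
End QuotientAlgebra.

Section Stratifying.
Variables (K : comPzRingType) (B : kalg K) (e : B) (ee : e ** e = e).

Fact mul_Be_bilinear :
  bilinear_fun (fun (x : Be ee) (y : eB ee) => val x ** val y : reg B).
Proof.
by split=> [y k u v|x k u v]; [exact: kmul_linl|exact: kmul_linr].
Qed.

Definition mul_Be_eB : bihom (tens (Be ee) (eB ee)) (reg B) :=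
  tlift (@TBalanced K B (corner ee) B (Be ee) (eB ee) (reg B) _ mul_Be_bilinear
    (fun m x n => esym (kmulA (val m) (val x) (val n)))
    (fun x m n => esym (kmulA x (val m) (val n)))
    (fun m n y => kmulA (val m) (val n) y)).

Definition stratifying : Prop :=
  [/\ forall i, (0 < i)%N -> Tor_eq0 i (Be ee) (eB ee),
      injective mul_Be_eB
    & forall x, BeB e x <-> exists z, mul_Be_eB z = x].

(* Be (x)_eBe bar (eBe) (x)_eBe eB *)
Definition bar_BeB : cplx B B := tensr (tensl (Be ee) (bar (corner ee))) (eB ee).
Definition bar_BeB_eps : bihom (bar_BeB 0%N) (reg B) :=
  aug3 (bar_eps (corner ee)) mul_Be_eB.

(* On Hom(Be (x) P (x) eB, B) = Hom(P, eBe) this is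
   G |-> (x |-> G (e (x) x (x) e)), whose values satisfy e v e = v. *)
Definition adj_BeB n (a : Ext bar_BeB (reg B) n) :
    Ext (bar (corner ee)) (reg (corner ee)) n :=
  hcl _ _ (fun x : bar (corner ee) n =>
    to_corner ee (hrep a
      (tpure (tpure (Be_e ee) x : tensl (Be ee) (bar (corner ee)) n) (eB_e ee)))).
End Stratifying.

(* Main.v *)
Require Import Defs.
From HB Require Import structures.
From mathcomp Require Import all_boot all_algebra.
From mathcomp Require Import boolp functions.
From mathcomp Require Import zify.

Set Implicit Arguments.
Unset Strict Implicit.
Unset Printing Implicit Defensive.

Import GRing.Theory.
Local Open Scope ring_scope.

(* A class in HH(B) maps to HH(A) by composing a cocycle with pi : B -> A and inverting the
   restriction map HH(A) -> HH(B, A), which is bijective because A (x)_B bar B (x)_B A resolves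
   A. A K-linear section of pi lifts coboundaries, so every class of HH(B) has a representative
   f with pi f = F o pi for a cocycle F of A, and products of such pairs are again such pairs.

   For a stratifying idempotent e the map is f |-> e f e, restricted to eBe, and comes from the
   chain map Be (x) bar(eBe) (x) eB -> bar B over BeB -> B. Its mapping cone resolves A, which
   gives the long exact sequence. The endomorphism of bar B that inserts the separability
   idempotent e (x) e + (1 - e) (x) (1 - e) into every tensor sign lifts the identity, hence is
   homotopic to it, so every class has a representative that is linear over K e + K (1 - e);
   on such representatives f |-> e f e respects cup and circle products on the nose. *)

(** Products of classes are defined in the statement through the representatives picked by [hrep],
    so nothing can be computed before independence of representatives is known; this rests on
    Gerstenhaber's formula for the differential of a circle product. The square is quadratic and 2
    need not be invertible, so for it a separate primitive of the circle product of a coboundary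
    with itself has to be found. Even then a comparison known only up to homotopy is of no direct
    use, since the circle product lives on cochains and a chain homotopy gives no control over it;
    hence the search for representatives on which the comparison is an equality. For the corner the
    obstacle is that [e f g e] differs from [e f e g e], and that a value of [g] inserted into [f]
    would have to be replaced by its compression. Both are repaired once [e] can be moved across the
    tensor signs, because arguments from [eBe] absorb it. *)

Section ZmoduleReflection.

Inductive zterm := ZVar of nat | ZZero | ZAdd of zterm & zterm | ZOpp of zterm.

Fixpoint zeval (V : zmodType) (env : seq V) (t : zterm) : V :=
  match t with
  | ZVar i => env`_i
  | ZZero => 0
  | ZAdd t u => zeval env t + zeval env u
  | ZOpp t => - zeval env t
  end.

Fixpoint zcoef (i : nat) (t : zterm) : int :=
  match t with
  | ZVar j => (i == j)%:Z
  | ZZero => 0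
  | ZAdd t u => zcoef i t + zcoef i u
  | ZOpp t => - zcoef i t
  end.

Lemma zevalE (V : zmodType) (env : seq V) t :
  zeval env t = \sum_(i < size env) env`_i *~ zcoef i t.
Proof.
elim: t => [j||t IHt u IHu|t IHt] /=.
- case: (ltnP j (size env)) => hj.
    rewrite (bigD1 (Ordinal hj)) //= eqxx mulr1z big1 ?addr0 // => i ij.
    by rewrite -val_eqE /= in ij; rewrite (negPf ij) mulr0z.
  rewrite nth_default // big1 // => i _.
  by rewrite (ltn_eqF (leq_trans (ltn_ord i) hj)) mulr0z.
- by rewrite big1 // => i _; rewrite mulr0z.
- by rewrite IHt IHu -big_split; apply: eq_bigr => i _; rewrite mulrzDr.
by rewrite IHt -sumrN; apply: eq_bigr => i _; rewrite mulrNz.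
Qed.

(** Indices beyond [size env] need no check: there [ZVar] evaluates to the default value 0. *)
Lemma zmod_reflect (V : zmodType) (env : seq V) (t u : zterm) :
  all (fun i => zcoef i t == zcoef i u) (iota 0 (size env)) ->
  zeval env t = zeval env u.
Proof.
move=> /allP h; rewrite !zevalE; apply: eq_bigr => i _; congr (_ *~ _).
by apply/eqP/h; rewrite mem_iota add0n /=.
Qed.

End ZmoduleReflection.

Ltac zmod_index x l :=
  match l with
  | cons ?y _ => let _ := match goal with _ => unify x y end in constr:(O)
  | cons _ ?l' => let n := zmod_index x l' in constr:(S n)
  end.

Ltac zmod_atoms t l :=
  lazymatch t with
  | @GRing.add _ ?a ?b => let l := zmod_atoms a l in zmod_atoms b l
  | @GRing.opp _ ?a => zmod_atoms a l
  | @GRing.zero _ => l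
  | _ => match l with
         | _ => let _ := zmod_index t l in l
         | _ => constr:(cons t l)
         end
  end.

Ltac zmod_reify t l :=
  lazymatch t with
  | @GRing.add _ ?a ?b =>
      let a := zmod_reify a l in let b := zmod_reify b l in constr:(ZAdd a b)
  | @GRing.opp _ ?a => let a := zmod_reify a l in constr:(ZOpp a)
  | @GRing.zero _ => constr:(ZZero)
  | _ => let i := zmod_index t l in constr:(ZVar i)
  end.

(* Decides equations that hold in every abelian group. *)
Ltac zmod :=
  lazymatch goal with
  | |- @eq ?T ?a ?b =>
      let l := zmod_atoms a (@nil T) in
      let l := zmod_atoms b l in
      let t := zmod_reify a l in
      let u := zmod_reify b l in
      exact (@zmod_reflect _ l t u isT)
  end.

(** * Classes in subquotients and the maps induced on them *)

Section SubquotientTheory.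
Variables (K : comPzRingType) (V : lmodType K) (Z D : submod V).

Lemma hcl_eq u v : Z u -> Z v -> (hcl Z D u = hcl Z D v <-> D (u - v)).
Proof.
move=> zu zv.
have su : u \in smem Z by apply/asboolP.
have sv : v \in smem Z by apply/asboolP.
rewrite quoM_eq /= !insubdK //.
Qed.

Lemma hrepP (x : subquo Z D) : Z (hrep x).
Proof. exact: subMP. Qed.

Lemma hrepK (x : subquo Z D) : hcl Z D (hrep x) = x.
Proof. by rewrite /hcl /hrep valKd reprK. Qed.

Lemma hcl_rep v : Z v -> D (v - hrep (hcl Z D v)).
Proof. by move=> zv; apply/hcl_eq => //; [exact: hrepP | rewrite hrepK]. Qed.

Lemma hcl_lin (k : K) u v : Z u -> Z v ->
  hcl Z D (k *: u + v) = k *: hcl Z D u + hcl Z D v.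
Proof.
move=> zu zv.
rewrite -[k *: hcl Z D u]pi_qscale -[RHS]pi_qadd; congr ((\pi_(quoM _) _)%qT).
have sP w : Z w -> w \in smem Z by move=> ?; apply/asboolP.
apply: val_inj; rewrite /= !insubdK ?sP //; exact: sm_lin.
Qed.

Lemma hcl0 : hcl Z D 0 = 0.
Proof.
by have := hcl_lin (-1) (sm_0 Z) (sm_0 Z); rewrite scaler0 addr0 scaleN1r addNr.
Qed.

Lemma hcl_eq0 u : Z u -> (hcl Z D u = 0 <-> D u).
Proof. by move=> zu; rewrite -hcl0 hcl_eq ?subr0 //; exact: sm_0. Qed.

Lemma hclW (x : subquo Z D) : exists2 v, Z v & x = hcl Z D v.
Proof. by exists (hrep x); [exact: hrepP | rewrite hrepK]. Qed.

Lemma smD (P : submod V) u v : P u -> P v -> P (u + v).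
Proof. by move=> pu pv; rewrite -[u]scale1r; exact: sm_lin. Qed.

Lemma smZ (P : submod V) k v : P v -> P (k *: v).
Proof. by move=> pv; rewrite -[_ *: _]addr0; apply: sm_lin => //; exact: sm_0. Qed.

Lemma smN (P : submod V) v : P v -> P (- v).
Proof. by rewrite -scaleN1r; exact: smZ. Qed.

Lemma smB (P : submod V) u v : P u -> P v -> P (u - v).
Proof. by move=> pu /smN; exact: smD. Qed.

End SubquotientTheory.

Lemma linear_fun_comp (K : comPzRingType) (U V W : lmodType K)
    (f : V -> W) (g : U -> V) :
  linear_fun f -> linear_fun g -> linear_fun (fun x => f (g x)).
Proof. by move=> fl gl k u v; rewrite gl fl. Qed.

Lemma inj_surj_bij (T U : choiceType) (f : T -> U) :
  injective f -> (forall y, exists x, f x = y) -> bijective f.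
Proof.
move=> fi fs; have {}fs y : exists x, f x == y by have [x <-] := fs y; exists x.
exists (fun y => xchoose (fs y)) => [x|y]; last exact/eqP/(xchooseP (fs y)).
by apply: fi; apply/eqP/(xchooseP (fs (f x))).
Qed.

Section InducedMap.
Variables (K : comPzRingType) (V W : lmodType K).
Variables (Z D : submod V) (Z' D' : submod W) (phi : V -> W).
Hypothesis phi_lin : linear_fun phi.
Hypothesis phi_Z : forall v, Z v -> Z' (phi v).
Hypothesis phi_D : forall v, D v -> D' (phi v).
Let ind (x : subquo Z D) : subquo Z' D' := hcl Z' D' (phi (hrep x)).

(** Two representatives differ by an element of [D], which [phi] sends into [D']. The maps
    [ext_pull], [ext_to_HH], [HH_map], [adj_AA] and [adj_BeB] all have the form of [ind], so this
    evaluates each of them on any representative. *)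
Lemma ind_hcl v : Z v -> ind (hcl Z D v) = hcl Z' D' (phi v).
Proof.
move=> zv; apply/esym/hcl_eq; [exact: phi_Z|exact/phi_Z/hrepP|].
by rewrite -lfB //; exact/phi_D/hcl_rep.
Qed.

Lemma ind_lin : linear_fun ind.
Proof.
move=> k x y; rewrite -[x in LHS]hrepK -[y in LHS]hrepK -hcl_lin; try exact: hrepP.
rewrite ind_hcl; last by apply: sm_lin; exact: hrepP.
by rewrite phi_lin hcl_lin; try exact/phi_Z/hrepP.
Qed.

Lemma ind_bij : (forall v, Z v -> D' (phi v) -> D v) ->
  (forall w, Z' w -> exists2 v, Z v & D' (phi v - w)) -> bijective ind.
Proof.
move=> hi hs; apply: inj_surj_bij => [x y|y].
  move=> /hcl_eq; rewrite -lfB // => h.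
  rewrite -[x]hrepK -[y]hrepK; apply/hcl_eq; try exact: hrepP.
  apply: hi; first by apply: smB; exact: hrepP.
  by apply: h; exact/phi_Z/hrepP.
have [v zv dv] := hs _ (hrepP y); exists (hcl Z D v); rewrite ind_hcl //.
by rewrite -[RHS]hrepK; apply/hcl_eq => //; [exact: phi_Z|exact: hrepP].
Qed.

End InducedMap.

(** * Hochschild cochains *)

Lemma signrS (K : comPzRingType) (V : lmodType K) n (v : V) :
  (-1 : K) ^+ n.+1 *: v = - ((-1 : K) ^+ n *: v).
Proof. by rewrite exprS mulN1r scaleNr. Qed.

Section Differential.
Variables (K : comPzRingType) (L : kalg K) (M : bimod L L).

(** The second clause of [is_cochain], freed from the degree: it passes to [fun s => f (a :: s)], on
    which the inductions on the first argument rely. *)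
Definition multilinear (V : lmodType K) (f : seq L -> V) :=
  forall s1 s2 (k : K) (x y : L),
    f (s1 ++ (k *: x + y) :: s2) = k *: f (s1 ++ x :: s2) + f (s1 ++ y :: s2).

Lemma multilinear_cons (V : lmodType K) (f : seq L -> V) a :
  multilinear f -> multilinear (fun s => f (a :: s)).
Proof. by move=> fl s1 s2 k x y; rewrite -!cat_cons fl. Qed.

(* The terms of [- hdiff f] without left multiplication. Unlike [hdiff], they obey a
   recursion on the first argument, so that formulas for them follow by induction. *)
Fixpoint rdiff (f : seq L -> M) (s : seq L) : M :=
  match s with
  | [::] => 0
  | a :: t => match t with
              | [::] => ract (f [::]) a
              | b :: t' => f (a ** b :: t') - rdiff (fun u => f (a :: u)) t
              end
  end.

Definition ldiff (f : seq L -> M) (s : seq L) : M :=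
  if s is a :: t then lact a (f t) else 0.

Lemma rdiff_cons2 f a b t :
  rdiff f (a :: b :: t) = f (a ** b :: t) - rdiff (fun u => f (a :: u)) (b :: t).
Proof. by []. Qed.

(** Splitting off the first product shifts the remaining indices and flips their signs, which is the
    recursion of [rdiff]. This links the recursion to the sum in [hdiff]. *)
Lemma rdiffE f a t : rdiff f (a :: t) =
  \sum_(i < size t) (-1 : K) ^+ i *:
     f (take i (a :: t) ++ ((a :: t)`_i ** (a :: t)`_i.+1) :: drop i.+2 (a :: t))
  + (-1 : K) ^+ size t *: ract (f (take (size t) (a :: t))) (last a t).
Proof.
elim: t a f => [|b t IH] a f; first by rewrite big_ord0 add0r scale1r.
rewrite rdiff_cons2 IH big_ord_recl /= scale1r drop0 -addrA; congr (_ + _).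
rewrite opprD -sumrN signrS; congr (_ + _).
by apply: eq_bigr => i _; rewrite /= signrS.
Qed.

Lemma hdiff_cons f a t : hdiff f (a :: t) = lact a (f t) - rdiff f (a :: t).
Proof.
rewrite rdiffE /hdiff /= -addrA opprD -sumrN signrS; congr (_ + (_ + _)).
by apply: eq_bigr => i _; rewrite signrS.
Qed.

Lemma hdiff_nil f : hdiff f [::] = 0 :> M.
Proof.
rewrite /hdiff /= big_ord0 addr0.
have [h _] := lact_bilinear M; have [_ h'] := ract_bilinear M.
by rewrite (lf0 (h _)) (lf0 (h' _)) scaler0 addr0.
Qed.

Lemma hdiffE f s : hdiff f s = ldiff f s - rdiff f s.
Proof. by case: s => [|a t]; [rewrite hdiff_nil subr0|rewrite hdiff_cons]. Qed.

(** Equations such as [rdiff_cons2] hold only on long enough sequences, so rewriting under [rdiff]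
    has to be restricted to the one length at which it evaluates its argument. *)
Lemma eq_rdiff n f g s : (forall u, size u = n -> f u = g u) ->
  size s = n.+1 -> rdiff f s = rdiff g s.
Proof.
elim: n f g s => [|n IH] f g [|a [|b t]] // fg st; first by rewrite /= fg.
have {}st : size t = n by case: st.
rewrite !rdiff_cons2; congr (_ - _); first by rewrite fg //= st.
by apply: IH => [u su|]; [rewrite fg //= su|rewrite /= st].
Qed.

Lemma rdiff_lin k f g s :
  rdiff (fun u => k *: f u + g u) s = k *: rdiff f s + rdiff g s.
Proof.
elim: s f g => [|a [|b t] IH] f g; first by rewrite scaler0 addr0.
  by rewrite /= ract_lin.
by rewrite !rdiff_cons2 IH scalerBr opprD addrACA.
Qed.

Lemma rdiffB f g s : rdiff (fun u => f u - g u) s = rdiff f s - rdiff g s.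
Proof.
rewrite addrC -scaleN1r -rdiff_lin; congr rdiff; apply/funext => u.
by rewrite scaleN1r addrC.
Qed.

Lemma rdiff_lact x f s : rdiff (fun u => lact x (f u)) s = lact x (rdiff f s).
Proof.
elim: s f => [|a [|b t] IH] f; first by rewrite (lf0 (lact_lin _)).
  by rewrite /= lract.
by rewrite !rdiff_cons2 IH (lfB (lact_lin _)).
Qed.

Lemma rdiff_multilinear f : multilinear f -> multilinear (rdiff f).
Proof.
move=> fl s1; elim: s1 f fl => [|a [|b s1] IH] f fl s2 k x y.
- case: s2 => [|b t]; rewrite !cat0s; first by have [_ h] := ract_bilinear M; exact: h.
  rewrite !rdiff_cons2 kmul_linl (fl [::]) scalerBr addrACA -opprD.
  congr (_ - _); rewrite -rdiff_lin; congr rdiff.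
  by apply/funext => u; exact: (fl [::]).
- rewrite !cat_cons !cat0s !rdiff_cons2 kmul_linr (fl [::]) scalerBr addrACA -opprD.
  congr (_ - _); exact: (IH _ (multilinear_cons a fl) s2).
rewrite !cat_cons !rdiff_cons2 -!cat_cons fl scalerBr addrACA -opprD; congr (_ - _).
exact: (IH _ (multilinear_cons a fl) s2).
Qed.

Lemma ldiff_multilinear f : multilinear f -> multilinear (ldiff f).
Proof.
move=> fl [|a s1] s2 k x y /=; first by have [h _] := lact_bilinear M; exact: h.
by rewrite fl lact_lin.
Qed.

Lemma hdiff_cochain n (f : seq L -> M) : is_cochain n f -> is_cochain n.+1 (hdiff f).
Proof.
move=> [f0 fl]; split=> [s ss|s1 s2 k x y]; last first.
  rewrite !hdiffE rdiff_multilinear // ldiff_multilinear //.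
  by rewrite scalerBr opprD addrACA.
case: s ss => [|a t] st; first exact: hdiff_nil.
rewrite hdiff_cons f0 // (lf0 (lact_lin _)).
rewrite (@eq_rdiff (size t) f (fun=> 0)) // => [|u su]; last by rewrite f0 // su.
rewrite rdiffE /= big1 => [|i _]; last by rewrite scaler0.
by rewrite (lf0 (ract_lin _)) scaler0 addr0 subr0.
Qed.

Lemma rdiff_rdiff f s : (1 < size s)%N -> rdiff (rdiff f) s = 0.
Proof.
elim: s f => [|a [|b t] IH] f // _.
rewrite rdiff_cons2; case: t IH => [|c t] IH.
  by rewrite /= ract_mul subrr.
(* [head] and [behead] turn [rdiff_cons2] into an equation between functions of [u], valid for
   nonempty [u]. The inner [rdiff] then meets the induction hypothesis, and the leftover terms agree
   by associativity. *)
rewrite (@eq_rdiff (size t).+1 (fun u => rdiff f (a :: u))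
    (fun u => f (a ** head 0 u :: behead u) - rdiff (fun v => f (a :: v)) u)) //;
  last by case.
by rewrite rdiffB IH // subr0 !rdiff_cons2 /= !kmulA subrr.
Qed.

(** Acting by [a ** b] is acting twice, so left multiplication by [a] comes out. With l = [ldiff], r
    = [rdiff] and d = l - r this reads r l = l d, and together with r r = 0 it gives d d = l d - r l
    + r r = 0. *)
Lemma rdiff_ldiff f a t : (0 < size t)%N ->
  rdiff (ldiff f) (a :: t) = lact a (hdiff f t).
Proof.
case: t => // b t _; rewrite rdiff_cons2 /= hdiff_cons (lfB (lact_lin _)).
rewrite lact_mul; congr (_ - _).
by rewrite -[LHS]/(rdiff (fun u => lact a (f u)) (b :: t)) rdiff_lact.
Qed.

Lemma hdiff_hdiff (f : seq L -> M) : hdiff (hdiff f) = 0.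
Proof.
apply/funext => -[|a [|b t]]; first exact: hdiff_nil.
  by rewrite hdiff_cons hdiff_nil /= hdiff_nil (lf0 (lact_lin _)) (lf0 (ract_lin _)) subr0.
rewrite hdiff_cons (_ : hdiff f = fun s => ldiff f s - rdiff f s); last first.
  by apply/funext => s; exact: hdiffE.
by rewrite rdiffB rdiff_rdiff // rdiff_ldiff // subr0 -hdiffE subrr.
Qed.

Lemma hdiff_lfun (k : K) (f g : seq L -> M) s :
  hdiff (k *: f + g) s = k *: hdiff f s + hdiff g s.
Proof. by rewrite hdiff_lin. Qed.

Lemma hdiffB (f g : seq L -> M) : hdiff (f - g) = hdiff f - hdiff g.
Proof. by rewrite addrC -scaleN1r hdiff_lin scaleN1r addrC. Qed.

Lemma coboundary_cocycle n (f : seq L -> M) : hh_coboundary M n f -> hh_cocycle M n f.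
Proof.
case: n => [|n] /= => [-> |[g [gc ->]]]; first exact: hh_cocycle_0.
by split; [exact: hdiff_cochain | exact: hdiff_hdiff].
Qed.

End Differential.

(** Covers both a change of coefficients ([beta] the identity) and restriction along an algebra map
    ([u] the identity). Compatibility with the actions is asked at the values of [f] along [beta]
    only, a condition that passes to [f (beta a :: _)] in the induction. *)
Lemma hdiff_map (K : comPzRingType) (L L' : kalg K) (M : bimod L L)
    (M' : bimod L' L') (beta : L' -> L) (u : M -> M') (f : seq L -> M) s :
  linear_fun beta -> linear_fun u ->
  (forall x y, beta (x ** y) = beta x ** beta y) ->
  (forall x t, u (lact (beta x) (f (map beta t))) = lact x (u (f (map beta t)))) ->
  (forall x t, u (ract (f (map beta t)) (beta x)) = ract (u (f (map beta t))) x) ->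
  u (hdiff f (map beta s)) = hdiff (fun t => u (f (map beta t))) s.
Proof.
move=> bl ul bm hl hr; case: s => [|a s].
  by rewrite !hdiff_nil (lf0 ul).
rewrite /= !hdiff_cons (lfB ul) hl; congr (_ - _).
elim: s a f hl hr => [|b s IH] a f hl hr; first by rewrite /= (hr a [::]).
rewrite [map _ _]/= !rdiff_cons2 (lfB ul) /= bm; congr (_ - _).
by apply: (IH b (fun v => f (beta a :: v))) => x t; [exact: (hl x (a :: t))|exact: (hr x (a :: t))].
Qed.

(** * Cup and circle products of cochains *)

Section CupCirc.
Variables (K : comPzRingType) (L : kalg K).
Implicit Types (f g h : seq L -> reg L) (s t : seq L).

Lemma circ0 n f g s : circ 0 n f g s = 0.
Proof. by rewrite /circ big_ord0. Qed.

(** The [i]-th summand carries the sign [(-1) ^ (i (n + 1))], so removing the first argument costs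
    one factor [(-1) ^ (n + 1)]. This recursion runs parallel to [rdiff_cons2]. *)
Lemma circS m n f g a t : circ m.+1 n f g (a :: t) =
  f (g (take n (a :: t)) :: drop n (a :: t))
  + (-1 : K) ^+ n.+1 *: circ m n (fun u => f (a :: u)) g t.
Proof.
rewrite /circ big_ord_recl mul0n scale1r take0 drop0; congr (_ + _).
rewrite scaler_sumr; apply: eq_bigr => i _.
by rewrite scalerA -exprD lift0 mulSn.
Qed.

Lemma eq_circl m n f f' g s :
  (forall a u, f (a :: u) = f' (a :: u)) -> (0 < m)%N ->
  circ m n f g s = circ m n f' g s.
Proof.
move=> ff _; apply: eq_bigr => i _; congr (_ *: _).
by case: (take i s) => [|b u]; rewrite ?cat0s ?cat_cons ff.
Qed.

Lemma circ_linl m n k f f' g s :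
  circ m n (fun u => k *: f u + f' u) g s = k *: circ m n f g s + circ m n f' g s.
Proof.
rewrite /circ scaler_sumr -big_split; apply: eq_bigr => i _.
by rewrite scalerDr !scalerA mulrC.
Qed.

Lemma circBl m n f f' g s :
  circ m n (fun u => f u - f' u) g s = circ m n f g s - circ m n f' g s.
Proof.
rewrite addrC -scaleN1r -circ_linl; congr circ; apply/funext => u.
by rewrite scaleN1r addrC.
Qed.

Lemma circ_linr m n f g g' s k : multilinear f ->
  circ m n f (fun u => k *: g u + g' u) s = k *: circ m n f g s + circ m n f g' s.
Proof.
move=> fl; rewrite /circ scaler_sumr -big_split; apply: eq_bigr => i _.
by rewrite fl scalerDr !scalerA mulrC.
Qed.

Lemma circBr m n f g g' s : multilinear f ->
  circ m n f (fun u => g u - g' u) s = circ m n f g s - circ m n f g' s.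
Proof.
move=> fl; rewrite addrC -scaleN1r -circ_linr //; congr circ; apply/funext => u.
by rewrite scaleN1r addrC.
Qed.

(** The partial composition at the first slot, i.e. the summand [i = 0] of [circ]. *)
Definition insert n g f : seq L -> reg L := fun s => f (g (take n s) :: drop n s).

(** The two terms on the right share, with opposite signs, the summand in which the value of [g] is
    multiplied by the next argument. Everything else occurs on the left as well. *)
Lemma rdiff_insert n f g s : multilinear f -> (n < size s)%N ->
  rdiff (insert n g f) s =
  insert n.+1 (rdiff g) f s + (-1 : K) ^+ n.+1 *: insert n g (rdiff f) s.
Proof.
elim: n g s => [|n IH] g [|a [|b t]] // fl hs.
- by rewrite /insert /= scaleN1r addrC; zmod.
- by rewrite /insert /= scaleN1r; zmod.
rewrite rdiff_cons2 [rdiff (fun u => _) _](IH (fun u => g (a :: u))) //.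
have fB x y u : f ((x - y) :: u) = f (x :: u) - f (y :: u).
  by rewrite addrC -scaleN1r (fl [::]) scaleN1r !cat0s; zmod.
by rewrite /insert [take n.+2 _]/= [drop n.+2 _]/= rdiff_cons2 fB /= [in RHS]signrS; zmod.
Qed.


Lemma signP n : (-1 : K) ^+ n = 1 \/ (-1 : K) ^+ n = -1.
Proof. by rewrite -signr_odd; case: odd; [right|left]; rewrite ?expr1 ?expr0. Qed.

Lemma rdiff0 (M : bimod L L) s : rdiff (fun=> 0 : M) s = 0.
Proof.
elim: s => [|a [|b t] IH] //; first by rewrite /= (lf0 (ract_lin _)).
by rewrite rdiff_cons2 IH subr0.
Qed.

Lemma circ1 n f g s : circ 1 n f g s = f (g (take n s) :: drop n s).
Proof. by rewrite /circ big_ord1 /= take0 drop0 scale1r. Qed.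

(* Gerstenhaber's formula for the differential of [circ], without the terms in which
   the first argument acts on the left. *)
Lemma rdiff_circ m n f g s : multilinear f -> size s = (m + n)%N ->
  rdiff (circ m n f g : seq L -> reg L) s =
    circ m n.+1 f (rdiff g) s - circ m n.+1 f (ldiff g) s
    + (-1 : K) ^+ n.+1 *: circ m.+1 n (rdiff f) g s
    - (-1 : K) ^+ (m * n + n.+1) *: cup m f g s.
Proof.
elim: m f s => [|m IH] f s fl ss.
  rewrite (_ : circ 0 n f g = fun=> 0); last by apply/funext => u; exact: circ0.
  rewrite rdiff0 !circ0 mul0n circ1 -[n]add0n -ss take_size drop_size /cup take0.
  by rewrite drop0 /=; zmod.
case: s ss => // a [|b t] ss.
  have [m0 n0] : m = 0%N /\ n = 0%N by move: ss; case: (m) => //; case: (n).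
  subst m n; rewrite -[LHS]/(circ 1 0 f g [::] ** a) [circ 2 0 _ _ _]circS !circ1 /cup /=.
  by rewrite !scaleN1r; zmod.
have {}ss : size (b :: t) = (m + n)%N by case: ss.
set t' := b :: t in ss *.
pose fa : seq L -> reg L := fun u => f (a :: u).
have fal : multilinear fa by exact: multilinear_cons.
(* Each argument of the outer [rdiff] starts with [a] or [a ** b], so [circS] separates the
   insertion at the first slot, which [rdiff_insert] handles, from a circle product with [m] slots,
   which the induction hypothesis handles. *)
have Elhs : rdiff (circ m.+1 n f g : seq L -> reg L) (a :: t') =
    rdiff (insert n g f) (a :: t') + (-1 : K) ^+ n.+1 *:
    (circ m n (fun u => f (a ** b :: u)) g t - rdiff (circ m n fa g : seq L -> reg L) t').
  rewrite /t' !rdiff_cons2 circS.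
  rewrite [X in _ - X](_ : _ = rdiff (fun u => (-1 : K) ^+ n.+1 *:
      (circ m n fa g u : reg L) + insert n g f (a :: u)) (b :: t)); last first.
    by congr rdiff; apply/funext => u; rewrite circS addrC.
  by rewrite rdiff_lin scalerBr /insert; zmod.
rewrite Elhs rdiff_insert //; last first.
  by rewrite /t' /= ltnS; move: ss; rewrite /t' /= => ->; exact: leq_addl.
rewrite (IH fa t') // [circ m.+2 _ _ _ _]circS ![circ m.+1 n.+1 f _ _]circS.
rewrite (@eq_circl _ _ (fun u => rdiff f (a :: u))
  (fun u => f (a ** head 0 u :: behead u) - rdiff fa u)) // circBl.
rewrite [circ m.+1 n (fun u => f (a ** _ :: _)) g t']circS.
rewrite -![f (_ (take n.+1 _) :: _)]/(insert n.+1 _ f (a :: t')).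
rewrite -[rdiff f (g (take n (a :: t')) :: _)]/(insert n g (rdiff f) (a :: t')).
rewrite -[cup m.+1 f g _]/(cup m fa g t').
rewrite -[fun u => f (a :: u)]/fa mulSn.
(* All signs are now products of [(-1) ^ n] and [(-1) ^ (m * n)]. Once these two are fixed, an
   identity in an abelian group remains. *)
rewrite !(exprS, exprD).
by case: (signP n) => ->; case: (signP (m * n)) => ->;
  rewrite !(mulr1, mul1r, mulrN1, opprK, scale1r, scaleN1r); zmod.
Qed.
End CupCirc.

(** * Degrees and differentials of the products *)

Section GerstenhaberStructure.
Variables (K : comPzRingType) (L : kalg K).
Implicit Types (f g h b : seq L -> reg L) (s t : seq L).

Lemma multilinear0 f s1 s2 : multilinear f -> f (s1 ++ 0 :: s2) = 0.
Proof. by move=> fl; have := fl s1 s2 (-1) 0 0; rewrite scaler0 addr0 scaleN1r addNr. Qed.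

Lemma insert_multilinear n g f :
  multilinear f -> multilinear g -> multilinear (insert n g f).
Proof.
move=> fl; elim: n g => [|n IH] g gl s1 s2 k x y.
  by rewrite /insert !take0 !drop0; exact: (multilinear_cons _ fl).
case: s1 => [|a s1]; last exact: (IH _ (multilinear_cons a gl)).
by rewrite /insert /= (gl [::]) (fl [::]).
Qed.

Lemma circ_multilinear m n f g :
  multilinear f -> multilinear g -> multilinear (circ m n f g).
Proof.
move=> fl gl; elim: m f fl => [|m IH] f fl s1 s2 k x y.
  by rewrite !circ0 scaler0 addr0.
have Pl := insert_multilinear n fl gl.
case: s1 => [|a s1].
  rewrite !cat0s !circS (_ : (fun u => f (k *: x + y :: u)) =
    fun u => k *: f (x :: u) + f (y :: u)); last by apply/funext => u; exact: (fl [::]).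
  rewrite circ_linl; have := Pl [::] s2 k x y; rewrite /insert !cat0s => ->.
  rewrite !scalerDr !scalerA [_ * k]mulrC; zmod.
rewrite !cat_cons !circS (IH _ (multilinear_cons a fl)).
have := Pl (a :: s1) s2 k x y; rewrite /insert !cat_cons => ->.
rewrite !scalerDr !scalerA [_ * k]mulrC; zmod.
Qed.

(** On a sequence of the wrong size a summand vanishes because either [g] sees a wrong number of
    arguments, which puts a zero entry into [f], or [f] does. For [m = 0] there are no summands, so
    the truncation in [(m + n).-1] is harmless. *)
Lemma circ_cochain m n f g : is_cochain m f -> is_cochain n g ->
  is_cochain (m + n).-1 (circ m n f g : seq L -> reg L).
Proof.
move=> [f0 fl] [g0 gl]; split; last exact: circ_multilinear.
move=> s ss; apply: big1 => i _; have im := ltn_ord i.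
case: (eqVneq (size (take n (drop i s))) n) => sn; last first.
  by rewrite g0 // multilinear0 // scaler0.
rewrite f0 ?scaler0 //; move: ss sn.
by rewrite size_cat !size_take_min /= !size_drop; lia.
Qed.

Lemma cup_cochain m n f g : is_cochain m f -> is_cochain n g ->
  is_cochain (m + n) (cup m f g : seq L -> reg L).
Proof.
move=> [f0 fl] [g0 gl]; split=> [s ss|].
  rewrite /cup; case: (eqVneq (size (take m s)) m) => sm; last first.
    by rewrite f0 // (lf0 (kmul_linl _)).
  rewrite g0 ?(lf0 (kmul_linr _)) //; move: ss sm; rewrite size_drop size_take_min; lia.
elim: m f {f0} fl => [|m IH] f fl s1 s2 k x y.
  by rewrite /cup !take0 !drop0 gl kmul_linr.
case: s1 => [|a s1]; last exact: (IH _ (multilinear_cons a fl)).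
by rewrite /cup /= (fl [::]) kmul_linl.
Qed.

(** The argument between the two blocks acts on the right of [f] in [rdiff f] and on the left of [g]
    in [ldiff g]. These two summands are equal up to opposite signs and cancel. *)
Lemma rdiff_cup m f g s : (m < size s)%N ->
  rdiff (cup m f g : seq L -> reg L) s =
  cup m.+1 (rdiff f) g s
  + (-1 : K) ^+ m *: (cup m f (rdiff g) s - cup m f (ldiff g) s).
Proof.
elim: m f s => [|m IH] f [|a t] // st.
  rewrite (_ : cup 0 f g = fun u => lact (f [::]) (g u)); last first.
    by apply/funext => u; rewrite /cup take0 drop0.
  rewrite rdiff_lact scale1r /cup !take0 !drop0 [take 1 _]/= take0 [drop 1 _]/= drop0.
  by rewrite [rdiff f _]/= [ldiff _ _]/= kmulA [lact _ _]/=; zmod.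
case: t st => // b t st; rewrite rdiff_cons2.
rewrite [rdiff (fun u => _) _](IH (fun u => f (a :: u))) // signrS.
rewrite /cup [take m.+2 _]/= rdiff_cons2 /= (lfB (kmul_linl _)); zmod.
Qed.

Lemma hdiff_cup m f g s : (m < size s)%N ->
  hdiff (cup m f g : seq L -> reg L) s =
  cup m.+1 (hdiff f) g s + (-1 : K) ^+ m *: cup m f (hdiff g) s.
Proof.
case: s => // a t st; rewrite hdiff_cons rdiff_cup //.
rewrite [cup m.+1 (hdiff f) _ _]/cup [cup m f (hdiff g) _]/cup.
rewrite !hdiffE (lfB (kmul_linl _)) (lfB (kmul_linr _)).
by rewrite /cup /= kmulA !scalerBr; zmod.
Qed.

(** Gerstenhaber's formula: up to sign the circle product is a homotopy between the two cup
    products. The term [cup n g f] arises when [g] is inserted into the argument of [ldiff f] that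
    acts on the left. *)
Lemma hdiff_circ m n f g s : multilinear f -> size s = (m + n)%N ->
  hdiff (circ m n f g : seq L -> reg L) s =
  circ m n.+1 f (hdiff g) s + (-1 : K) ^+ n.+1 *: circ m.+1 n (hdiff f) g s
  + (-1 : K) ^+ n *: cup n g f s + (-1 : K) ^+ (m * n + n.+1) *: cup m f g s.
Proof.
move=> fl ss; rewrite hdiffE rdiff_circ //.
rewrite (_ : hdiff f = fun u => ldiff f u - rdiff f u); last first.
  by apply/funext => u; rewrite hdiffE.
rewrite (_ : hdiff g = fun u => ldiff g u - rdiff g u); last first.
  by apply/funext => u; rewrite hdiffE.
rewrite circBl circBr // scalerBr.
case: s ss => [|a t] ss.
  have [m0 n0] : m = 0%N /\ n = 0%N by move: ss; case: (m) => //; case: (n).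
  by subst m n; rewrite !circ0 !circ1 /cup /= !scaleN1r scale1r; zmod.
rewrite [circ m.+1 n (ldiff f) g _]circS /=.
rewrite (_ : circ m n (fun u => a ** f u) g t = a ** circ m n f g t); last first.
  rewrite /circ (lf_sum (kmul_linr _)); apply: eq_bigr => i _.
  by rewrite (lfZ (kmul_linr _)).
rewrite /cup !scalerDr !scalerA !exprS !exprD.
by case: (signP K n) => ->; case: (signP K (m * n)) => ->;
  rewrite !(mulr1, mul1r, mulrN1, opprK, scale1r, scaleN1r, exprS); zmod.
Qed.

Lemma cochain_eq n (f g : seq L -> reg L) : is_cochain n f -> is_cochain n g ->
  (forall s, size s = n -> f s = g s) -> f = g.
Proof.
move=> [f0 _] [g0 _] fg; apply/funext => s.
by case: (eqVneq (size s) n) => [/fg //|h]; rewrite f0 // g0.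
Qed.

End GerstenhaberStructure.

(** * Products of cohomology classes *)

Section GerstenhaberClasses.
Variables (K : comPzRingType) (L : kalg K).
Implicit Types (f g h b : seq L -> reg L) (s t : seq L).
Local Notation Z := (hh_cocycle (reg L)).
Local Notation D := (hh_coboundary (reg L)).

Lemma cup0l m g : cup m (0 : seq L -> reg L) g = 0.
Proof. by apply/funext => s; exact: (lf0 (kmul_linl _)). Qed.

Lemma cup0r m f : cup m f (0 : seq L -> reg L) = 0.
Proof. by apply/funext => s; exact: (lf0 (kmul_linr _)). Qed.

Lemma cupBl m f f' g : cup m (f - f') g = (cup m f g : seq L -> reg L) - cup m f' g.
Proof. by apply/funext => s; exact: (lfB (kmul_linl _)). Qed.

Lemma cupBr m f g g' : cup m f (g - g') = (cup m f g : seq L -> reg L) - cup m f g'.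
Proof. by apply/funext => s; exact: (lfB (kmul_linr _)). Qed.

Lemma circ0l m n g : circ m n (0 : seq L -> reg L) g = 0.
Proof. by apply/funext => s; apply: big1 => i _; rewrite scaler0. Qed.

Lemma circ0r m n f : multilinear f -> circ m n f (0 : seq L -> reg L) = 0.
Proof.
by move=> fl; apply/funext => s; apply: big1 => i _; rewrite multilinear0 ?scaler0.
Qed.

Lemma cochain0_nil m f : is_cochain m f -> m = 0%N -> hdiff f = 0 ->
  forall a, f [::] ** a = a ** f [::].
Proof.
move=> fc m0 df a; have := congr1 (fun F => F [:: a]) df.
by rewrite hdiff_cons /= => /eqP; rewrite subr_eq0 => /eqP.
Qed.

Lemma cup_cocycle m n f g : Z m f -> Z n g -> Z (m + n) (cup m f g : seq L -> reg L).
Proof.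
move=> [fc fd] [gc gd]; have c := cup_cochain fc gc; split=> //.
apply: (cochain_eq (hdiff_cochain c) (is_cochain_0 _ _)) => s ss.
rewrite hdiff_cup ?ss ?ltnS ?leq_addr // fd gd cup0l cup0r.
by rewrite scaler0 addr0.
Qed.

Lemma cup_coboundaryl m n f g : D m f -> Z n g ->
  D (m + n) (cup m f g : seq L -> reg L).
Proof.
case: m => [|m] /= => [-> _|[h [hc ->]] [gc gd]].
  by rewrite cup0l; exact: hh_coboundary_0.
exists (cup m h g); split; first exact: cup_cochain.
apply: (cochain_eq (cup_cochain (hdiff_cochain hc) gc)) => [|s ss].
  exact/hdiff_cochain/cup_cochain.
by rewrite hdiff_cup ?ss ?addSn ?ltnS ?leq_addr // gd cup0r scaler0 addr0.
Qed.

Lemma cup_coboundaryr m n f g : Z m f -> D n g ->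
  D (m + n) (cup m f g : seq L -> reg L).
Proof.
case: n => [|n] /= => [_ ->|[fc fd] [h [hc ->]]].
  by rewrite cup0r; exact: hh_coboundary_0.
rewrite addnS; exists ((-1 : K) ^+ m *: (cup m f h : seq L -> reg L) + 0); split.
  by apply: is_cochain_lin; [exact: cup_cochain|exact: is_cochain_0].
rewrite hdiff_lin hdiff_0 addr0.
have c := cup_cochain fc (hdiff_cochain hc); rewrite addnS in c.
apply: (cochain_eq c) => [|s ss].
  rewrite -[_ *: _]addr0; apply: is_cochain_lin; last exact: is_cochain_0.
  exact/hdiff_cochain/cup_cochain.
rewrite -[RHS]/(_ *: hdiff _ s) hdiff_cup ?ss ?ltnS ?leq_addr // fd cup0l.
by rewrite add0r scalerA -exprD addnn -signr_odd odd_double scale1r.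
Qed.

Lemma HHcup_hcl m n f g : Z m f -> Z n g ->
  HHcup (hcl (Z m) (D m) f) (hcl (Z n) (D n) g) = hcl _ _ (cup m f g).
Proof.
move=> zf zg; have zf' := hrepP (hcl (Z m) (D m) f).
apply/esym/hcl_eq; [exact: cup_cocycle|exact/cup_cocycle/hrepP|].
set f' := hrep (hcl _ _ f); set g' := hrep (hcl _ _ g).
have -> : (cup m f g : seq L -> reg L) - cup m f' g' = cup m (f - f') g + cup m f' (g - g').
  by rewrite cupBl cupBr addrA subrK.
by apply: smD; [apply: cup_coboundaryl|apply: cup_coboundaryr] => //; exact: hcl_rep.
Qed.

Lemma bracket_cochain m n f g : is_cochain m f -> is_cochain n g ->
  is_cochain (m + n).-1 (bracket m n f g : seq L -> reg L).
Proof.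
move=> fc gc; rewrite (_ : bracket m n f g =
  - (-1 : K) ^+ (m.+1 * n.+1) *: (circ n m g f : seq L -> reg L) + circ m n f g).
  by apply: is_cochain_lin; [rewrite addnC|]; exact: circ_cochain.
by apply/funext => s; rewrite scaleNr addrC.
Qed.

Lemma circ00 m n f g : (m + n = 0)%N -> circ m n f g = 0.
Proof.
move=> /eqP; rewrite addn_eq0 => /andP[/eqP -> _].
by apply/funext => s; exact: circ0.
Qed.

Lemma hdiff_circ_cocycle m n f g s : Z m f -> Z n g -> size s = (m + n)%N ->
  hdiff (circ m n f g : seq L -> reg L) s =
  (-1 : K) ^+ n *: cup n g f s + (-1 : K) ^+ (m * n + n.+1) *: cup m f g s.
Proof.
move=> [[_ fl] fd] [_ gd] ss; rewrite hdiff_circ // fd gd circ0l circ0r //.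
by rewrite scaler0 !add0r.
Qed.

Lemma hdiff_bracket_cocycle m n f g : Z m f -> Z n g ->
  hdiff (bracket m n f g : seq L -> reg L) = 0.
Proof.
(* For [m = n = 0] the degree [(m + n).-1] is 0 instead of -1, and [prednK] fails; there the bracket
   itself is zero. In the other degrees the cup terms of the two circle products cancel. *)
move=> zf zg; case: (posnP (m + n)) => mn.
  rewrite (_ : bracket m n f g = 0) ?hdiff_0 //; apply/funext => s.
  by rewrite /bracket !circ00 ?scaler0 ?subr0 // addnC.
have c := hdiff_cochain (bracket_cochain zf.1 zg.1).
apply: (cochain_eq c (is_cochain_0 _ _)) => s; rewrite prednK // => ss.
rewrite (_ : bracket m n f g =
  - (-1 : K) ^+ (m.+1 * n.+1) *: (circ n m g f : seq L -> reg L) + circ m n f g);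
  last by apply/funext => u; rewrite scaleNr addrC.
rewrite -[RHS]/(0 : reg L) hdiff_lfun !hdiff_circ_cocycle // 1?addnC // scaleNr scalerDr !scalerA.
rewrite [(n * m)%N]mulnC !(mulSn, mulnS, exprS, exprD).
by case: (signP K n) => ->; case: (signP K m) => ->; case: (signP K (m * n)) => ->;
  rewrite ?(mulr1, mul1r, mulrN1, opprK, scale1r, scaleN1r, exprS); zmod.
Qed.

Lemma bracket_cocycle m n f g : Z m f -> Z n g ->
  Z (m + n).-1 (bracket m n f g : seq L -> reg L).
Proof.
move=> zf zg; split; last exact: hdiff_bracket_cocycle.
exact: bracket_cochain zf.1 zg.1.
Qed.

Lemma bracketC m n f g : bracket n m g f =
  - (-1 : K) ^+ (m.+1 * n.+1) *: (bracket m n f g : seq L -> reg L).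
Proof.
apply/funext => s; rewrite -[RHS]/(_ *: (_ - _)) /bracket [(n.+1 * m.+1)%N]mulnC.
by case: (signP K (m.+1 * n.+1)) => ->;
  rewrite ?(opprK, scale1r, scaleN1r); zmod.
Qed.

Lemma bracketBl m n f f' g : multilinear g ->
  bracket m n (f - f') g = (bracket m n f g : seq L -> reg L) - bracket m n f' g.
Proof.
move=> gl; apply/funext => s; rewrite -[RHS]/(_ s - _ s) /bracket.
by rewrite circBl circBr // scalerBr; zmod.
Qed.

Lemma bracket_coboundaryl m n f g : D m f -> Z n g ->
  D (m + n).-1 (bracket m n f g : seq L -> reg L).
Proof.
case: m => [|m] /= => [-> [[_ gl] _]|[h [hc ->]] [gc gd]].
  rewrite (_ : bracket _ _ _ _ = 0); first exact: hh_coboundary_0.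
  by apply/funext => s; rewrite /bracket circ0l circ0r // scaler0 subr0.
(* Up to the sign [(-1) ^ (n + 1)] this is the bracket of [h] and [g], spelled out so that
   [hdiff_circ] applies to each circle product. *)
pose w : seq L -> reg L := (-1 : K) ^+ n.+1 *: (circ m n h g : seq L -> reg L) +
  (- (-1 : K) ^+ (m * n + m)%N *: (circ n m g h : seq L -> reg L) + 0).
have wc : is_cochain (m + n).-1 w.
  apply: is_cochain_lin; first exact: circ_cochain.
  apply: is_cochain_lin; last exact: is_cochain_0.
  by rewrite addnC; exact: circ_cochain.
have E : bracket m.+1 n (hdiff (h : seq L -> reg L)) g = hdiff w.
  (* For [m = n = 0] there is no primitive: the bracket is the inner derivation of [h] evaluated at
     the central element [g [::]], hence zero. *)
  case: (posnP (m + n)) => mn.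
    have {wc} -> : w = 0 by rewrite /w !circ00 ?scaler0 ?addr0 // addnC.
    rewrite hdiff_0; move/eqP: mn; rewrite addn_eq0 => /andP[/eqP ? /eqP ?]; subst m n.
    apply/funext => s; rewrite /bracket circ0 scaler0 subr0 circ1 take0 drop0.
    case: s => [|a s]; last first.
      by have [h0 _] := hdiff_cochain hc; rewrite h0.
    rewrite hdiff_cons /=; apply/eqP; rewrite subr_eq0; apply/eqP.
    exact: (cochain0_nil gc).
  have c := bracket_cochain (hdiff_cochain hc) gc.
  have c' := hdiff_cochain wc; rewrite prednK // in c'; apply: (cochain_eq c c') => s ss.
  rewrite !hdiff_lfun hdiff_0 (hdiff_circ _ hc.2) // (hdiff_circ _ gc.2) 1?addnC // gd.
  rewrite (circ0r _ _ hc.2) circ0l scaler0 /bracket.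
  rewrite -[(0 : seq L -> reg L) s]/(0 : reg L) addr0 !add0r !scalerDr !scalerA [(n * m)%N]mulnC.
  rewrite !(mulSn, mulnS, mulNr, exprS, exprD, scaleNr).
  by case: (signP K n) => ->; case: (signP K m) => ->; case: (signP K (m * n)) => ->;
    rewrite ?(mulr1, mul1r, mulrN1, opprK, scale1r, scaleN1r, exprS); zmod.
rewrite E; change (D (m + n) (hdiff w)); case: (posnP (m + n)) => mn; last first.
  by rewrite -(prednK mn); exists w.
have -> : w = 0 by rewrite /w !circ00 ?scaler0 ?addr0 // addnC.
by rewrite hdiff_0; exact: hh_coboundary_0.
Qed.

Lemma bracket_coboundaryr m n f g : Z m f -> D n g ->
  D (m + n).-1 (bracket m n f g : seq L -> reg L).
Proof.
by move=> zf dg; rewrite bracketC addnC; exact/smZ/bracket_coboundaryl.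
Qed.

Lemma HHbracket_hcl m n f g : Z m f -> Z n g ->
  HHbracket (hcl (Z m) (D m) f) (hcl (Z n) (D n) g) = hcl _ _ (bracket m n f g).
Proof.
move=> zf zg; apply/esym/hcl_eq; try by apply: bracket_cocycle => //; exact: hrepP.
set f' := hrep (hcl _ _ f); set g' := hrep (hcl _ _ g).
have zf' : Z m f' by exact: hrepP.
have zg' : Z n g' by exact: hrepP.
have -> : (bracket m n f g : seq L -> reg L) - bracket m n f' g' =
    bracket m n (f - f') g + bracket m n f' (g - g').
  rewrite [bracket m n f' (g - g')]bracketC (bracketBl _ _ _ _ zg.1.2).
  by rewrite (bracketBl _ _ _ _ zf'.1.2) scalerBr -!bracketC; zmod.
by apply: smD; [apply: bracket_coboundaryl|apply: bracket_coboundaryr] => //; exact: hcl_rep.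
Qed.

(** In even degree both cup terms of Gerstenhaber's formula are [cup m f f], with opposite signs.
    Thus the square is a cocycle in every characteristic, without being half of a bracket. *)
Lemma circ_self_cocycle m f : ~~ odd m -> Z m f ->
  Z (m + m).-1 (circ m m f f : seq L -> reg L).
Proof.
move=> mE zf; split; first exact: (circ_cochain zf.1 zf.1).
have c := hdiff_cochain (circ_cochain zf.1 zf.1); case: (posnP (m + m)) => mm.
  by rewrite circ00 // hdiff_0.
rewrite prednK // in c; apply: (cochain_eq c (is_cochain_0 _ _)) => s ss.
have sm : (-1 : K) ^+ m = 1 by rewrite -signr_odd (negPf mE).
rewrite hdiff_circ_cocycle // exprD exprS exprM sm expr1n mulr1 mul1r.
by rewrite scale1r scaleN1r subrr.
Qed.

Lemma circ_self_coboundary m f b : ~~ odd m -> Z m f -> D m b ->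
  D (m + m).-1 ((circ m m (f + b) (f + b) : seq L -> reg L) - circ m m f f).
Proof.
move=> mE zf db; have zb := coboundary_cocycle db.
have [[_ fl] _] := zf; have [[_ bl] _] := zb.
(* In even degree the two circle products enter the bracket with the same sign, so the mixed terms
   are the bracket of [f] and [b]. *)
have -> : (circ m m (f + b) (f + b) : seq L -> reg L) - circ m m f f =
    bracket m m f b + circ m m b b.
  apply/funext => s; rewrite -[LHS]/(_ s - _ s) -[RHS]/(_ s + _ s) /bracket.
  have -> : (f + b : seq L -> reg L) = fun u => 1 *: f u + b u.
    by apply/funext => u; rewrite scale1r.
  rewrite circ_linl !circ_linr // !scale1r -signr_odd oddM /= mE expr1 scaleN1r.
  by zmod.
apply: smD; first exact: bracket_coboundaryr.
case: m mE {zf} db zb => [|m] mE /=; first by move=> *; rewrite circ00 //; exact: hh_coboundary_0.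
move=> [h [hc ->]] zb; rewrite addnS /=; have mO : odd m by rewrite /= negbK in mE.
have zb1 := zb.1; have hb := circ_cochain hc (hdiff_cochain hc); rewrite addnS /= in hb.
(* For odd [m] the differential of [circ m m.+1 h (hdiff h)] is the negative of the wanted square
   plus [cup _ (hdiff h) h - cup _ h (hdiff h)], and that difference is the differential of
   [cup m h h]. *)
exists (- 1 *: (circ m m.+1 h (hdiff (h : seq L -> reg L)) : seq L -> reg L) + cup m h h); split.
  by apply: is_cochain_lin => //; exact: cup_cochain.
have c := circ_cochain (hdiff_cochain hc) (hdiff_cochain hc); rewrite addnS /= in c.
apply: (cochain_eq c) => [|s ss].
  apply/hdiff_cochain/is_cochain_lin => //; exact: cup_cochain.
have ss' : size s = (m + m.+1)%N by rewrite ss addnS.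
rewrite hdiff_lfun (hdiff_circ _ hc.2) // hdiff_cup; last by rewrite ss ltnS leq_addr.
rewrite hdiff_hdiff (circ0r _ _ hc.2) scaleN1r !(mulnS, exprS, exprD) -!(signr_odd _ (m * m)).
rewrite oddM -!(signr_odd _ m) mO /= expr1 !(mulN1r, opprK, mulrN1, scale1r, scaleN1r, mulr1).
by rewrite -[(0 : seq L -> reg L) s]/(0 : reg L); zmod.
Qed.

Lemma HHsq_hcl n f : Z (2 * n) f ->
  HHsq (hcl (Z (2 * n)) (D (2 * n)) f) = hcl _ _ (circ (2 * n) (2 * n) f f).
Proof.
move=> zf; have mE : ~~ odd (2 * n) by rewrite oddM.
have E : (4 * n = 2 * n + 2 * n)%N by lia.
pose f' := hrep (hcl (Z (2 * n)) (D (2 * n)) f); have zf' : Z (2 * n) f' by exact: hrepP.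
rewrite /HHsq -/f' E; apply/hcl_eq; try exact: circ_self_cocycle.
rewrite (_ : f' = f + - (f - f')); last by rewrite opprB addrC subrK.
apply: circ_self_coboundary => //; exact/smN/hcl_rep.
Qed.

End GerstenhaberClasses.

(* The cup, circle and bracket products of cochains that are related on the nose are
   again related, so no homotopies are needed once every class has a representative
   with a [strong]ly related partner. *)
Section GerstenhaberOfRelation.
Variables (K : comPzRingType) (L L' : kalg K).
Variable k : forall n, HH (reg L) n -> HH (reg L') n.
Variables strong weak : nat -> (seq L -> reg L) -> (seq L' -> reg L') -> Prop.
Hypothesis k_lin : forall n, linear_fun (@k n).
Hypothesis k_weak : forall n f f', hh_cocycle (reg L) n f ->
  hh_cocycle (reg L') n f' -> weak n f f' -> k (hcl _ _ f : HH (reg L) n) = hcl _ _ f'.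
Hypothesis strong_weak : forall n f f', strong n f f' -> weak n f f'.
Hypothesis strong_ex : forall n (a : HH (reg L) n), exists f f',
  [/\ hh_cocycle (reg L) n f, hh_cocycle (reg L') n f', strong n f f' & a = hcl _ _ f].
Hypothesis weak_one : weak 0 (fun s => if s is [::] then kone L else 0)
  (fun s => if s is [::] then kone L' else 0).
Hypothesis weak_lin : forall n (c : K) f g f' g', weak n f f' -> weak n g g' ->
  weak n (c *: f + g) (c *: f' + g').
Hypothesis weak_cup : forall m n f g f' g', strong m f f' -> strong n g g' ->
  weak (m + n) (cup m f g) (cup m f' g').
Hypothesis weak_circ : forall m n f g f' g', strong m f f' -> strong n g g' ->
  weak (m + n).-1 (circ m n f g) (circ m n f' g').

Lemma one_cocycle (A : kalg K) :
  hh_cocycle (reg A) 0 (fun s => if s is [::] then kone A else 0).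
Proof.
split; first by split=> [[]|[|a s1] s2 c x y] //=; rewrite scaler0 addr0.
apply/funext => -[|a [|b s]]; first exact: hdiff_nil.
  by rewrite hdiff_cons /= kmul1x kmulx1 subrr.
rewrite hdiff_cons (@eq_rdiff _ _ _ (size s).+1 _ (fun=> 0)) //; last by case.
by rewrite rdiff0 /= (lf0 (kmul_linr _)) subr0.
Qed.

(** Products are formed on strongly related pairs, and the result only has to be weakly related for
    [k] to be evaluated on it. For the corner, the extra conditions in [strong] are not claimed for
    products. *)
Lemma gerstenhaber_of_relation : gerstenhaber_hom (@k).
Proof.
split=> //.
- split; first by apply: k_weak => //; exact: one_cocycle.
  move=> m n a b; have [f [f' [zf zf' ff ->]]] := strong_ex a.
  have [g [g' [zg zg' gg ->]]] := strong_ex b.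
  rewrite HHcup_hcl // (k_weak _ _ (strong_weak ff)) // (k_weak _ _ (strong_weak gg)) //.
  by rewrite HHcup_hcl //; apply: k_weak; [exact: cup_cocycle..|exact: weak_cup].
- move=> m n a b; have [f [f' [zf zf' ff ->]]] := strong_ex a.
  have [g [g' [zg zg' gg ->]]] := strong_ex b.
  rewrite HHbracket_hcl // (k_weak _ _ (strong_weak ff)) // (k_weak _ _ (strong_weak gg)) //.
  rewrite HHbracket_hcl //; apply: k_weak; [exact: bracket_cocycle..|].
  have bE (A : kalg K) (u v : seq A -> reg A) : bracket m n u v =
      - (-1 : K) ^+ (m.+1 * n.+1) *: (circ n m v u : seq A -> reg A) + circ m n u v.
    by apply/funext => s; rewrite scaleNr addrC.
  by rewrite !bE; apply: weak_lin; [rewrite addnC|]; exact: weak_circ.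
move=> n a; have [f [f' [zf zf' ff ->]]] := strong_ex a.
rewrite HHsq_hcl // (k_weak _ _ (strong_weak ff)) // HHsq_hcl //.
have E : (4 * n = 2 * n + 2 * n)%N by lia.
rewrite E; apply: k_weak; [apply: circ_self_cocycle; rewrite ?oddM //..|].
exact: weak_circ.
Qed.

End GerstenhaberOfRelation.

(** * Comparison of resolutions *)

Section SubBimodule.
Variables (K : comPzRingType) (R S : kalg K) (N : bimod R S) (X : submod N).
Hypothesis Xl : forall x n, X n -> X (lact x n).
Hypothesis Xr : forall n x, X n -> X (ract n x).

Definition sub_lact (x : R) (n : subM X) : subM X := inM (Xl x (subMP n)).
Definition sub_ract (n : subM X) (x : S) : subM X := inM (Xr x (subMP n)).

Fact sub_l_bilinear : bilinear_fun sub_lact.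
Proof.
have [h1 h2] := lact_bilinear N.
by split=> [v k x y|u k x y]; apply: val_inj; [exact: h1|exact: h2].
Qed.
Fact sub_r_bilinear : bilinear_fun sub_ract.
Proof.
have [h1 h2] := ract_bilinear N.
by split=> [v k x y|u k x y]; apply: val_inj; [exact: h1|exact: h2].
Qed.
Fact sub_lact_mul x y n : sub_lact (x ** y) n = sub_lact x (sub_lact y n).
Proof. by apply: val_inj; rewrite /= lact_mul. Qed.
Fact sub_lact_one n : sub_lact (kone R) n = n.
Proof. by apply: val_inj; rewrite /= lact_one. Qed.
Fact sub_ract_mul n x y : sub_ract n (x ** y) = sub_ract (sub_ract n x) y.
Proof. by apply: val_inj; rewrite /= ract_mul. Qed.
Fact sub_ract_one n : sub_ract n (kone S) = n.
Proof. by apply: val_inj; rewrite /= ract_one. Qed.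
Fact sub_lract x n y : sub_ract (sub_lact x n) y = sub_lact x (sub_ract n y).
Proof. by apply: val_inj; rewrite /= lract. Qed.

Definition sub_bimod : bimod R S :=
  Bimod sub_l_bilinear sub_r_bilinear sub_lact_mul sub_lact_one sub_ract_mul
    sub_ract_one sub_lract.

End SubBimodule.

Section Lifting.
Variables (K : comPzRingType) (R S : kalg K).

Fact diffbh_is_bihom (X Y : bimod R S) (f g : bihom X Y) :
  is_bihom (fun x => f x - g x).
Proof.
split=> [k u v|x m|m y].
- by rewrite !bh_lin scalerBr opprD addrACA.
- by rewrite !bh_l (lfB (lact_lin _)).
by rewrite !bh_r (lfB (ract_lin _)).
Qed.
Definition diffbh (X Y : bimod R S) (f g : bihom X Y) := Bihom (diffbh_is_bihom f g).

Section Image.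
Variables (M N : bimod R S) (g : bihom M N).
Definition im_mem (n : N) : Prop := exists m, g m = n.
Fact im_0 : im_mem 0. Proof. by exists 0; exact: (lf0 (bh_lin _)). Qed.
Fact im_lin (k : K) u v : im_mem u -> im_mem v -> im_mem (k *: u + v).
Proof. by move=> [x <-] [y <-]; exists (k *: x + y); rewrite bh_lin. Qed.
Definition im_sub := Submod im_0 im_lin.
Fact im_l x n : im_sub n -> im_sub (lact x n).
Proof. by move=> [m <-]; exists (lact x m); rewrite bh_l. Qed.
Fact im_r n x : im_sub n -> im_sub (ract n x).
Proof. by move=> [m <-]; exists (ract m x); rewrite bh_r. Qed.
Definition im_bimod := sub_bimod im_l im_r.
End Image.

(** [biprojective] lifts along surjections only, so the target is replaced by the image of [g]. *)
Lemma biprojective_lift (P M N : bimod R S) (g : bihom M N) (f : bihom P N) :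
  biprojective P -> (forall p, exists m, g m = f p) ->
  exists h : bihom P M, forall p, g (h p) = f p.
Proof.
move=> Pp fg.
have gP (m : M) : im_sub g (g m) by exists m.
have fP (p : P) : im_sub g (f p) by exact: fg.
have gi : is_bihom (fun m => inM (gP m) : im_bimod g).
  by split=> [k u v|x m|m x]; apply: val_inj; rewrite /= ?bh_lin ?bh_l ?bh_r.
have fi : is_bihom (fun p => inM (fP p) : im_bimod g).
  by split=> [k u v|x m|m x]; apply: val_inj; rewrite /= ?bh_lin ?bh_l ?bh_r.
have [|h hP] := Pp _ _ (Bihom gi) (Bihom fi).
  by move=> y; have [m mP] := subMP y; exists m; apply: val_inj.
by exists h => p; exact: (congr1 val (hP p)).
Qed.

Lemma biprojective_retract (P Q : bimod R S) (i : bihom P Q) (r : bihom Q P) :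
  (forall p, r (i p) = p) -> biprojective Q -> biprojective P.
Proof.
move=> ri Qp M N g f gs; have [h hP] := Qp M N g (compbh f r) gs.
by exists (compbh h i) => p; rewrite /= hP /= ri.
Qed.

End Lifting.

(** Chain maps and homotopies are built degree by degree. [good] is the condition under which a
    component can be continued, and [R] is the equation that links consecutive components. *)
Lemma dependent_choice (T : nat -> Type) (good : forall n, T n -> Prop)
    (R : forall n, T n -> T n.+1 -> Prop) (t0 : T 0%N) :
  good 0%N t0 ->
  (forall n t, good n t -> exists t', R n t t' /\ good n.+1 t') ->
  exists f : forall n, T n, f 0%N = t0 /\ forall n, R n (f n) (f n.+1).
Proof.
move=> g0 step.
pose next n (t : {t : T n | good n t}) : {t' : T n.+1 | good n.+1 t'} :=
  let w := cid (step n (sval t) (svalP t)) in exist _ (sval w) (svalP w).2.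
pose F := nat_rect (fun n => {t : T n | good n t}) (exist _ t0 g0) next.
exists (fun n => sval (F n)); split=> // n /=.
exact: (svalP (cid (step n (sval (F n)) (svalP (F n))))).1.
Qed.

Section Comparison.
Variables (K : comPzRingType) (R S : kalg K).
Implicit Types P Q : cplx R S.

Definition exact_pos Q := forall n x, cd Q n x = 0 -> exists y, cd Q n.+1 y = x.

(** The condition carried along is that [f (cd P n x)] is a boundary of [Q]. A lift exists by
    projectivity, and it inherits the condition because its value on a boundary is a cycle. *)
Lemma cmap_exists P Q (f0 : bihom (P 0%N) (Q 0%N)) :
  (forall n, biprojective (P n)) -> exact_pos Q ->
  (forall x, exists y, cd Q 0%N y = f0 (cd P 0%N x)) ->
  exists f : cmap P Q, f 0%N = f0.
Proof.
move=> Pp Qe h0.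
have [||f [ff0 fd]] := @dependent_choice (fun n => bihom (P n) (Q n))
  (fun n f => forall x, exists y, cd Q n y = f (cd P n x))
  (fun n f f' => forall x, f (cd P n x) = cd Q n (f' x)) f0.
- exact: h0.
- move=> n f fx; have [h hP] := biprojective_lift (f := compbh f (cd P n)) (Pp n.+1) fx.
  exists h; split=> [x|x]; first by rewrite hP.
  by apply: Qe; rewrite hP /= cdd (lf0 (bh_lin _)).
by exists (Cmap fd).
Qed.

Definition homotopic P Q (f g : cmap P Q) : Prop :=
  exists h : forall n, bihom (P n) (Q n.+1),
    (forall x, f 0%N x - g 0%N x = cd Q 0%N (h 0%N x)) /\
    (forall n x, f n.+1 x - g n.+1 x = cd Q n.+1 (h n.+1 x) + h n (cd P n x)).

(** The condition carried along, d h d = d (f - g), says that f - g - h d has values in cycles. By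
    exactness these are boundaries, and the next component of the homotopy is a lift. *)
Lemma homotopic_unique P Q (f g : cmap P Q) :
  (forall n, biprojective (P n)) -> exact_pos Q ->
  (forall x, exists y, cd Q 0%N y = f 0%N x - g 0%N x) -> homotopic f g.
Proof.
move=> Pp Qe h0.
have [h00 h00P] := biprojective_lift (f := diffbh (f 0%N) (g 0%N)) (Pp 0%N) h0.
have dB n x : cd Q n (f n.+1 x - g n.+1 x) = f n (cd P n x) - g n (cd P n x).
  by rewrite (lfB (bh_lin _)) !cm_d.
have [||h [hh0 hd]] := @dependent_choice (fun n => bihom (P n) (Q n.+1))
  (fun n h => forall x, cd Q n (h (cd P n x)) = cd Q n (f n.+1 x - g n.+1 x))
  (fun n h h' => forall x, f n.+1 x - g n.+1 x = cd Q n.+1 (h' x) + h (cd P n x)) h00.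
- by move=> x; rewrite h00P dB.
- move=> n h hx.
  have [|h' h'P] := biprojective_lift (g := cd Q n.+1)
      (f := diffbh (diffbh (f n.+1) (g n.+1)) (compbh h (cd P n))) (Pp n.+1).
    by move=> p; apply: Qe; rewrite (lfB (bh_lin _)) /= hx subrr.
  exists h'; split=> x; first by rewrite h'P /= subrK.
  by rewrite h'P /= cdd (lf0 (bh_lin _)) subr0 dB.
by exists h; split=> [x|//]; rewrite hh0 h00P.
Qed.

Fact idcm_d P n x : idbh (P n) (cd P n x) = cd P n (idbh (P n.+1) x).
Proof. by []. Qed.
Definition idcm P : cmap P P := Cmap (@idcm_d P).

Fact compcm_d P Q (Q' : cplx R S) (g : cmap Q Q') (f : cmap P Q) n x :
  compbh (g n) (f n) (cd P n x) = cd Q' n (compbh (g n.+1) (f n.+1) x).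
Proof. by rewrite /= !cm_d. Qed.
Definition compcm P Q (Q' : cplx R S) (g : cmap Q Q') (f : cmap P Q) : cmap P Q' :=
  Cmap (compcm_d g f).

Lemma resolution_cmap P Q (M : bimod R S) (epsP : bihom (P 0%N) M)
    (epsQ : bihom (Q 0%N) M) (X Y : M -> Prop) :
  resolves epsP X -> resolves epsQ Y -> (forall m, X m -> Y m) ->
  exists f : cmap P Q, forall x, epsQ (f 0%N x) = epsP x.
Proof.
move=> [Pp Pe P0 _] [_ Qe Q0 Qx] XY.
have [|f0 f0P] := biprojective_lift (g := epsQ) (f := epsP) (Pp 0%N).
  by move=> p; apply/Qe/XY/Pe; exists p.
have [|f ff0] := cmap_exists (f0 := f0) Pp Qx; last by exists f => x; rewrite ff0.
by move=> x; apply/Q0; rewrite f0P; apply/P0; exists x.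
Qed.

Lemma resolution_homotopic P Q (M : bimod R S) (epsQ : bihom (Q 0%N) M)
    (Y : M -> Prop) (f g : cmap P Q) :
  (forall n, biprojective (P n)) -> resolves epsQ Y ->
  (forall x, epsQ (f 0%N x) = epsQ (g 0%N x)) -> homotopic f g.
Proof.
move=> Pp [_ _ Q0 Qx] fg; apply: homotopic_unique => // x.
by apply/Q0; rewrite (lfB (bh_lin _)) fg subrr.
Qed.

End Comparison.

Section ExtFunctoriality.
Variables (K : comPzRingType) (R S : kalg K) (M : bimod R S).
Implicit Types P Q : cplx R S.

Lemma is_bihom_comp (X Y : bimod R S) (f : Y -> M) (g : bihom X Y) :
  is_bihom f -> is_bihom (fun x => f (g x)).
Proof.
move=> [fl fx fr]; split=> [k u v|x m|m x].
- by rewrite bh_lin fl.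
- by rewrite bh_l fx.
by rewrite bh_r fr.
Qed.

(* [phi] is a component of a chain map, up to sign and shift; this is what makes
   [F |-> F o phi] preserve cocycles and coboundaries. *)
Definition ext_compatible P Q m n (phi : bihom (P m) (Q n)) : Prop :=
  (forall x, exists y, phi (cd P m x) = cd Q n y) /\
  (match m, n return bihom (P m) (Q n) -> Prop with
   | m'.+1, n'.+1 => fun phi => exists psi : bihom (P m') (Q n'),
       forall x, cd Q n' (phi x) = psi (cd P m' x)
   | _, 0%N => fun _ => True
   | 0%N, n'.+1 => fun phi => forall x, cd Q n' (phi x) = 0
   end) phi.

Lemma pull_cocycle P Q m n (phi : bihom (P m) (Q n)) F :
  ext_compatible phi -> ext_cocycle Q M n F ->
  ext_cocycle P M m (fun x => F (phi x)).
Proof.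
move=> [h _] [Fh Fd]; split; first exact: is_bihom_comp.
by move=> x; have [y ->] := h x; exact: Fd.
Qed.

Lemma pull_coboundary P Q m n (phi : bihom (P m) (Q n)) F :
  ext_compatible phi -> ext_coboundary Q M n F ->
  ext_coboundary P M m (fun x => F (phi x)).
Proof.
case: n phi F => [|n] phi F [_ h] /= => [-> |[G [Gh ->]]].
  exact: (@ext_coboundary_0 K R S P M m).
case: m phi h => [|m] phi h /=.
  by apply/funext => x; rewrite h; case: Gh => Gl _ _; rewrite (lf0 Gl).
have [psi psiP] := h; exists (fun x => G (psi x)); split.
  exact: is_bihom_comp.
by apply/funext => x; rewrite psiP.
Qed.

Lemma precomp_lin P Q m n (phi : P m -> Q n) :
  linear_fun (fun F : Q n -> M => (fun x => F (phi x)) : P m -> M).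
Proof. by []. Qed.

Lemma ext_pull_hcl P Q m n (phi : bihom (P m) (Q n)) F :
  ext_compatible phi -> ext_cocycle Q M n F ->
  ext_pull phi (hcl (ext_cocycle Q M n) (ext_coboundary Q M n) F) =
  hcl _ _ (fun x => F (phi x)).
Proof.
move=> c; apply: (ind_hcl (precomp_lin phi)) => ?.
  exact: pull_cocycle.
exact: pull_coboundary.
Qed.

Lemma ext_pull_lin P Q m n (phi : bihom (P m) (Q n)) :
  ext_compatible phi -> linear_fun (@ext_pull K R S P Q M m n phi).
Proof.
move=> c; apply: (ind_lin (precomp_lin phi)) => ?.
  exact: pull_cocycle.
exact: pull_coboundary.
Qed.

Lemma cmap_compatible P Q (phi : cmap P Q) n : ext_compatible (phi n).
Proof.
split=> [x|]; first by exists (phi n.+1 x); rewrite cm_d.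
by case: n => //= n; exists (phi n) => x; rewrite cm_d.
Qed.

Lemma ext_pull_homotopic P Q (f g : cmap P Q) n (a : Ext Q M n) :
  homotopic f g -> ext_pull (f n) a = ext_pull (g n) a.
Proof.
move=> [h [h0 hS]]; have [F ZF ->] := hclW a.
rewrite !ext_pull_hcl //; try exact: cmap_compatible.
have Zf := pull_cocycle (cmap_compatible f n) ZF.
have Zg := pull_cocycle (cmap_compatible g n) ZF.
apply/hcl_eq => //; have [[Fl Fx Fr] Fd] := ZF.
case: n a F ZF Zf Zg Fl Fx Fr Fd => [|n] a F ZF Zf Zg Fl Fx Fr Fd /=.
  apply/funext => x; rewrite -[LHS]/(F _ - F _) -lfB // h0 Fd //.
exists (fun x => F (h n x)); split; first exact: is_bihom_comp.
apply/funext => x; rewrite -[LHS]/(F _ - F _) -lfB // hS lfD // Fd add0r //.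
Qed.

Lemma ext_pull_comp P Q (Q' : cplx R S) m n k (g : bihom (Q n) (Q' k))
    (f : bihom (P m) (Q n)) (a : Ext Q' M k) :
  ext_compatible f -> ext_compatible g ->
  ext_pull f (ext_pull g a) = ext_pull (compbh g f) a.
Proof. by move=> fc gc; rewrite ext_pull_hcl //; exact/pull_cocycle/hrepP. Qed.

Lemma ext_pull_id P n (a : Ext P M n) : ext_pull (idcm P n) a = a.
Proof. exact: hrepK. Qed.

Lemma ext_pull_can P Q (N : bimod R S) (epsP : bihom (P 0%N) N)
    (epsQ : bihom (Q 0%N) N) (X : N -> Prop) (f : cmap P Q) (g : cmap Q P) n :
  resolves epsP X -> resolves epsQ X ->
  (forall x, epsQ (f 0%N x) = epsP x) -> (forall x, epsP (g 0%N x) = epsQ x) ->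
  cancel (fun a : Ext Q M n => ext_pull (f n) a) (fun a => ext_pull (g n) a).
Proof.
move=> rP rQ fe ge a; rewrite ext_pull_comp; try exact: cmap_compatible.
rewrite -[RHS]ext_pull_id.
apply: (ext_pull_homotopic (f := compcm f g) (g := idcm Q)).
by apply: (resolution_homotopic _ rQ) => [|x /=]; [case: rQ|rewrite fe ge].
Qed.

Lemma ext_pull_bij P Q (N : bimod R S) (epsP : bihom (P 0%N) N)
    (epsQ : bihom (Q 0%N) N) (X : N -> Prop) (f : cmap P Q) n :
  resolves epsP X -> resolves epsQ X ->
  (forall x, epsQ (f 0%N x) = epsP x) ->
  bijective (fun a : Ext Q M n => ext_pull (f n) a).
Proof.
move=> rP rQ fe; have [g ge] := resolution_cmap rQ rP (fun _ => id).
exists (fun a => ext_pull (g n) a).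
  exact: (ext_pull_can (epsP := epsP) (epsQ := epsQ) (X := X)).
exact: (ext_pull_can (epsP := epsQ) (epsQ := epsP) (X := X)).
Qed.

End ExtFunctoriality.

(** * Projectivity of tensor products *)

Section BalancedMaps.
Variables (K : comPzRingType) (R S T : kalg K) (M : bimod R S) (N : bimod S T).

Lemma ract_unit (m : M) k : ract m (unit_hom S k) = (k : K) *: m.
Proof. by have [_ h] := ract_bilinear M; rewrite (lfZ (h m)) ract_one. Qed.

Lemma lact_unit (m : M) k : lact (unit_hom R k) m = (k : K) *: m.
Proof. by have [h _] := lact_bilinear M; rewrite (lfZ (h m)) lact_one. Qed.

Lemma tpure_linl (n : N) : linear_fun (fun m => tpure m n : tens M N).
Proof. by have [h _] := tpure_bilinear M N; exact: h. Qed.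

Lemma tpure_linr (m : M) : linear_fun (fun n => tpure m n : tens M N).
Proof. by have [_ h] := tpure_bilinear M N; exact: h. Qed.

Lemma tpure_bal m x n : tpure (ract m x) n = tpure m (lact x n) :> tens M N.
Proof. by apply/tclP; exact: teq_bal. Qed.

Lemma lact_tpure x m n : lact x (tpure m n : tens M N) = tpure (lact x m) n.
Proof. exact: tlact_tcl. Qed.

Lemma ract_tpure m n x : ract (tpure m n : tens M N) x = tpure m (ract n x).
Proof. exact: tract_tcl. Qed.

Lemma ract_base (X : bimod R (kbase K)) (m : X) (k : kbase K) : ract m k = (k : K) *: m.
Proof.
have [_ h] := ract_bilinear X; rewrite -{1}[k]mulr1 -[k * 1]/((k : K) *: kone (kbase K)).
by rewrite (lfZ (h m)) ract_one.
Qed.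

Lemma lact_base (X : bimod (kbase K) S) (m : X) (k : kbase K) : lact k m = (k : K) *: m.
Proof.
have [h _] := lact_bilinear X; rewrite -{1}[k]mulr1 -[k * 1]/((k : K) *: kone (kbase K)).
by rewrite (lfZ (h m)) lact_one.
Qed.

Definition balanced (V : lmodType K) (f : M -> N -> V) :=
  bilinear_fun f /\ forall m x n, f (ract m x) n = f m (lact x n).

(* Unlike [tlift], this makes sense for targets without any action. *)
Definition tlin (V : lmodType K) (f : M -> N -> V) (z : tens M N) : V :=
  \sum_(p <- repr z) f p.1 p.2.

Lemma tlin_tcl (V : lmodType K) (f : M -> N -> V) s :
  balanced f -> tlin f (tcl s) = \sum_(p <- s) f p.1 p.2.
Proof.
move=> [[fl fr] fb].
have h t u : teq t u -> \sum_(p <- t) f p.1 p.2 = \sum_(p <- u) f p.1 p.2.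
  elim=> {t u} //.
  - by move=> t u v _ -> _ ->.
  - by move=> t t' u u' _ h1 _ h2; rewrite !big_cat /= h1 h2.
  - by move=> t u; rewrite !big_cat /= addrC.
  - by move=> n; rewrite big_seq1 big_nil /= (lf0 (fl n)).
  - by move=> m m' n; rewrite !big_cons !big_nil /= !addr0 (lfD (fl n)).
  - by move=> m n n'; rewrite !big_cons !big_nil /= !addr0 (lfD (fr m)).
  by move=> m x n; rewrite !big_seq1 /= fb.
by apply: h; apply/tclP; exact: tcl_repr.
Qed.

Lemma tlin_pure (V : lmodType K) (f : M -> N -> V) m n :
  balanced f -> tlin f (tpure m n) = f m n.
Proof. by move=> fb; rewrite tlin_tcl // big_seq1. Qed.

Lemma tlin_lin (V : lmodType K) (f : M -> N -> V) :
  balanced f -> linear_fun (tlin f).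
Proof.
move=> fb k u v; have [[fl fr] _] := fb.
have [s ->] := tclW u; have [t ->] := tclW v.
rewrite tclZ tclD !tlin_tcl // big_cat big_map scaler_sumr; congr (_ + _).
by apply: eq_bigr => p _ /=; rewrite (lfZ (fl _)).
Qed.

Lemma tlin_ext (V : lmodType K) (f g : M -> N -> V) z :
  (forall m n, f m n = g m n) -> tlin f z = tlin g z.
Proof. by move=> fg; apply: eq_bigr => p _. Qed.

End BalancedMaps.

(** * Bimodules of one-sided linear maps *)

Section HomBimodules.
Variables (K : comPzRingType) (R S T : kalg K).

Section LeftHom.
Variables (M : bimod R S) (N : bimod R T).

Definition homl_mem (f : M -> N) :=
  linear_fun f /\ forall x m, f (lact x m) = lact x (f m).
Fact homl_0 : homl_mem 0.
Proof.
by split=> [k u v|x m]; [rewrite scaler0 addr0|rewrite (lf0 (lact_lin _))].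
Qed.
Fact homl_lin (k : K) (f g : M -> N) :
  homl_mem f -> homl_mem g -> homl_mem (k *: f + g).
Proof.
move=> [fl fx] [gl gx]; split=> [a u v|x m].
  rewrite -![(k *: f + g) _]/(k *: f _ + g _) fl gl !scalerDr !scalerA.
  by rewrite mulrC; zmod.
by rewrite -![(k *: f + g) _]/(k *: f _ + g _) fx gx lact_lin.
Qed.
Definition homl_sub := Submod homl_0 homl_lin.

Fact homl_lP (s : S) (f : subM homl_sub) : homl_sub (fun m => val f (ract m s)).
Proof.
have [fl fx] := subMP f; split=> [k u v|x m]; first by rewrite ract_lin fl.
by rewrite lract fx.
Qed.
Fact homl_rP (f : subM homl_sub) (t : T) : homl_sub (fun m => ract (val f m) t).
Proof.
have [fl fx] := subMP f; split=> [k u v|x m]; first by rewrite fl ract_lin.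
by rewrite fx lract.
Qed.
Definition homl_lact s f : subM homl_sub := inM (homl_lP s f).
Definition homl_ract f t : subM homl_sub := inM (homl_rP f t).

Lemma homl_eq (f g : subM homl_sub) : (forall m, val f m = val g m) -> f = g.
Proof. by move=> fg; apply: val_inj; apply/funext. Qed.

Fact homl_l_bilinear : bilinear_fun homl_lact.
Proof.
split=> [f k x y|x k f g]; apply: homl_eq => m //=.
have [fl _] := subMP f; have [_ h] := ract_bilinear M.
by rewrite (h m) fl.
Qed.
Fact homl_r_bilinear : bilinear_fun homl_ract.
Proof.
have [h1 h2] := ract_bilinear N.
by split=> [f k x y|x k f g]; apply: homl_eq => m; [exact: h1|exact: h2].
Qed.
Fact homl_lact_mul x y f : homl_lact (x ** y) f = homl_lact x (homl_lact y f).
Proof. by apply: homl_eq => m /=; rewrite ract_mul. Qed.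
Fact homl_lact_one f : homl_lact (kone S) f = f.
Proof. by apply: homl_eq => m /=; rewrite ract_one. Qed.
Fact homl_ract_mul f x y : homl_ract f (x ** y) = homl_ract (homl_ract f x) y.
Proof. by apply: homl_eq => m /=; rewrite ract_mul. Qed.
Fact homl_ract_one f : homl_ract f (kone T) = f.
Proof. by apply: homl_eq => m /=; rewrite ract_one. Qed.
Fact homl_lract x f y : homl_ract (homl_lact x f) y = homl_lact x (homl_ract f y).
Proof. exact: homl_eq. Qed.

Definition homl : bimod S T :=
  Bimod homl_l_bilinear homl_r_bilinear homl_lact_mul homl_lact_one homl_ract_mul
    homl_ract_one homl_lract.
End LeftHom.

Section RightHom.
Variables (M : bimod S R) (N : bimod T R).

Definition homr_mem (f : M -> N) :=
  linear_fun f /\ forall m x, f (ract m x) = ract (f m) x.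
Fact homr_0 : homr_mem 0.
Proof.
by split=> [k u v|x m]; [rewrite scaler0 addr0|rewrite (lf0 (ract_lin _))].
Qed.
Fact homr_lin (k : K) (f g : M -> N) :
  homr_mem f -> homr_mem g -> homr_mem (k *: f + g).
Proof.
move=> [fl fx] [gl gx]; split=> [a u v|x m].
  rewrite -![(k *: f + g) _]/(k *: f _ + g _) fl gl !scalerDr !scalerA.
  by rewrite mulrC; zmod.
by rewrite -![(k *: f + g) _]/(k *: f _ + g _) fx gx ract_lin.
Qed.
Definition homr_sub := Submod homr_0 homr_lin.

Fact homr_rP (f : subM homr_sub) (s : S) : homr_sub (fun m => val f (lact s m)).
Proof.
have [fl fx] := subMP f; split=> [k u v|m x]; first by rewrite lact_lin fl.
by rewrite -lract fx.
Qed.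
Fact homr_lP (t : T) (f : subM homr_sub) : homr_sub (fun m => lact t (val f m)).
Proof.
have [fl fx] := subMP f; split=> [k u v|m x]; first by rewrite fl lact_lin.
by rewrite fx lract.
Qed.
Definition homr_lact t f : subM homr_sub := inM (homr_lP t f).
Definition homr_ract f s : subM homr_sub := inM (homr_rP f s).

Lemma homr_eq (f g : subM homr_sub) : (forall m, val f m = val g m) -> f = g.
Proof. by move=> fg; apply: val_inj; apply/funext. Qed.

Fact homr_r_bilinear : bilinear_fun homr_ract.
Proof.
split=> [x k f g|f k x y]; apply: homr_eq => m //=.
have [fl _] := subMP f; have [h _] := lact_bilinear M.
by rewrite (h m) fl.
Qed.
Fact homr_l_bilinear : bilinear_fun homr_lact.
Proof.
have [h1 h2] := lact_bilinear N.
by split=> [f k x y|x k f g]; apply: homr_eq => m; [exact: h1|exact: h2].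
Qed.
Fact homr_lact_mul x y f : homr_lact (x ** y) f = homr_lact x (homr_lact y f).
Proof. by apply: homr_eq => m /=; rewrite lact_mul. Qed.
Fact homr_lact_one f : homr_lact (kone T) f = f.
Proof. by apply: homr_eq => m /=; rewrite lact_one. Qed.
Fact homr_ract_mul f x y : homr_ract f (x ** y) = homr_ract (homr_ract f x) y.
Proof. by apply: homr_eq => m /=; rewrite lact_mul. Qed.
Fact homr_ract_one f : homr_ract f (kone S) = f.
Proof. by apply: homr_eq => m /=; rewrite lact_one. Qed.
Fact homr_lract x f y : homr_ract (homr_lact x f) y = homr_lact x (homr_ract f y).
Proof. exact: homr_eq. Qed.

Definition homr : bimod T S :=
  Bimod homr_l_bilinear homr_r_bilinear homr_lact_mul homr_lact_one homr_ract_mul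
    homr_ract_one homr_lract.
End RightHom.

End HomBimodules.

Section Projectivity.
Variables (K : comPzRingType).

(** By the adjunction of tensor product and [homl], a lifting problem for the tensor product along
    [g] is one for [P] along composition with [g]. The map [rho] allows the left action to be
    restricted, for instance to [K]. *)
Lemma tens_projl (R R' S T : kalg K) (rho : alghom R' R) (M : bimod R S)
    (P : bimod S T) :
  biprojective (res rho (unit_hom S) M) -> biprojective P ->
  biprojective (res rho (id_hom T) (tens M P)).
Proof.
move=> Mp Pp N N' g f gs; pose M' := res rho (id_hom S) M.
have GP (u : homl M' N) : homl_sub M' N' (fun m => g (val u m)).
  by have [ul ux] := subMP u; split=> [k x y|x m]; rewrite ?ul ?ux ?bh_lin ?bh_l.
have Gi : is_bihom (fun u => inM (GP u) : homl M' N').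
  split=> [k u v|x u|u x]; apply: homl_eq => m //=; last by rewrite bh_r.
  by rewrite -[RHS]/(k *: g _ + g _) -bh_lin.
have FP (p : P) : homl_sub M' N' (fun m => f (tpure (m : M) p)).
  split=> [k u v|x m]; first by rewrite (@tpure_linl _ _ _ _ M P) bh_lin.
  by rewrite -bh_l /= -lact_tpure.
have Fi : is_bihom (fun p => inM (FP p) : homl M' N').
  split=> [k u v|x p|p x]; apply: homl_eq => m /=.
  - by rewrite (@tpure_linr _ _ _ _ M P) bh_lin.
  - by rewrite -(@tpure_bal _ _ _ _ M P).
  by rewrite -(@ract_tpure _ _ _ _ M P) -bh_r.
have [|h hP] := Pp _ _ (Bihom Gi) (Bihom Fi).
  (* Composition with [g] is surjective on left linear maps out of [M'] because [M] is projective
     over [R']. *)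
  move=> u; have [ul ux] := subMP u.
  have ui : is_bihom (val u : res rho (unit_hom S) M -> res (id_hom R') (unit_hom T) N').
    by split=> // m k; rewrite /= !ract_unit (lfZ ul).
  have gi : is_bihom (g : res (id_hom R') (unit_hom T) N -> res (id_hom R') (unit_hom T) N').
    by split=> [|x n|n x]; [exact: (bh_lin g)|exact: (bh_l g)|exact: (bh_r g)].
  have [|w wP] := Mp _ _ (Bihom gi) (Bihom ui) => //.
  have ww : homl_sub M' N (w : M' -> N).
    by split; [exact: (bh_lin w)|exact: (bh_l w)].
  by exists (inM ww); apply: homl_eq => m; exact: wP.
pose F (m : M) (p : P) : N := val (h p) m.
have hb : balanced F.
  split; first split=> [p|m] k u v; first by have [l _] := subMP (h p); exact: l.
    by rewrite /F bh_lin.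
  by move=> m x p; rewrite /F bh_l.
have hi : is_bihom (tlin F : res rho (id_hom T) (tens M P) -> N).
  split; first exact: (tlin_lin hb).
  - move=> x z /=; apply: (tens_ext (f := fun z => tlin F (lact (rho x) z))
      (g := fun z => lact x (tlin F z))) z => [||m p].
    + by apply: (linear_fun_comp (tlin_lin hb)); exact: lact_lin.
    + by apply: (linear_fun_comp (lact_lin x)); exact: tlin_lin.
    rewrite (@lact_tpure _ _ _ _ M P) !tlin_pure //; have [_ l] := subMP (h p); exact: l.
  move=> z y /=; apply: (tens_ext (f := fun z => tlin F (ract z y))
    (g := fun z => ract (tlin F z) y)) z => [||m p].
  + by apply: (linear_fun_comp (tlin_lin hb)); exact: ract_lin.
  + by apply: (linear_fun_comp (ract_lin y)); exact: tlin_lin.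
  by rewrite (@ract_tpure _ _ _ _ M P) !tlin_pure // /F bh_r.
exists (Bihom hi) => z /=; apply: (tens_ext (f := fun z => g (tlin F z)) (g := f)) z.
- by apply: (linear_fun_comp (bh_lin g)); exact: tlin_lin.
- exact: (bh_lin f).
move=> m p; rewrite tlin_pure //; exact: (congr1 (fun u => val u m) (hP p)).
Qed.

Lemma tens_projr (R S T T' : kalg K) (tau : alghom T' T) (P : bimod R S)
    (M : bimod S T) :
  biprojective P -> biprojective (res (unit_hom S) tau M) ->
  biprojective (res (id_hom R) tau (tens P M)).
Proof.
move=> Pp Mp N N' g f gs; pose M' := res (id_hom S) tau M.
have GP (u : homr M' N) : homr_sub M' N' (fun m => g (val u m)).
  by have [ul ux] := subMP u; split=> [k x y|m x]; rewrite ?ul ?ux ?bh_lin ?bh_r.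
have Gi : is_bihom (fun u => inM (GP u) : homr M' N').
  split=> [k u v|x u|u x]; apply: homr_eq => m //=; last by rewrite bh_l.
  by rewrite -[RHS]/(k *: g _ + g _) -bh_lin.
have FP (p : P) : homr_sub M' N' (fun m => f (tpure p (m : M))).
  split=> [k u v|m x]; first by rewrite (@tpure_linr _ _ _ _ P M) bh_lin.
  by rewrite -bh_r /= -ract_tpure.
have Fi : is_bihom (fun p => inM (FP p) : homr M' N').
  split=> [k u v|x p|p x]; apply: homr_eq => m /=.
  - by rewrite (@tpure_linl _ _ _ _ P M) bh_lin.
  - by rewrite -(@lact_tpure _ _ _ _ P M) -bh_l.
  by rewrite (@tpure_bal _ _ _ _ P M).
have [|h hP] := Pp _ _ (Bihom Gi) (Bihom Fi).
  move=> u; have [ul ux] := subMP u.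
  have ui : is_bihom (val u : res (unit_hom S) tau M -> res (unit_hom R) (id_hom T') N').
    by split=> // k m; rewrite /= !lact_unit (lfZ ul).
  have gi : is_bihom (g : res (unit_hom R) (id_hom T') N -> res (unit_hom R) (id_hom T') N').
    by split=> [|x n|n x]; [exact: (bh_lin g)|exact: (bh_l g)|exact: (bh_r g)].
  have [|w wP] := Mp _ _ (Bihom gi) (Bihom ui) => //.
  have ww : homr_sub M' N (w : M' -> N).
    by split; [exact: (bh_lin w)|exact: (bh_r w)].
  by exists (inM ww); apply: homr_eq => m; exact: wP.
pose F (p : P) (m : M) : N := val (h p) m.
have hb : balanced F.
  split; first split=> [m|p] k u v; first by rewrite /F bh_lin.
    by have [l _] := subMP (h p); exact: l.
  by move=> p x m; rewrite /F bh_r.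
have hi : is_bihom (tlin F : res (id_hom R) tau (tens P M) -> N).
  split; first exact: (tlin_lin hb).
  - move=> x z /=; apply: (tens_ext (f := fun z => tlin F (lact x z))
      (g := fun z => lact x (tlin F z))) z => [||p m].
    + by apply: (linear_fun_comp (tlin_lin hb)); exact: lact_lin.
    + by apply: (linear_fun_comp (lact_lin x)); exact: tlin_lin.
    by rewrite (@lact_tpure _ _ _ _ P M) !tlin_pure // /F bh_l.
  move=> z y /=; apply: (tens_ext (f := fun z => tlin F (ract z (tau y)))
    (g := fun z => ract (tlin F z) y)) z => [||p m].
  + by apply: (linear_fun_comp (tlin_lin hb)); exact: ract_lin.
  + by apply: (linear_fun_comp (ract_lin y)); exact: tlin_lin.
  rewrite (@ract_tpure _ _ _ _ P M) !tlin_pure //; have [_ l] := subMP (h p); exact: l.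
exists (Bihom hi) => z /=; apply: (tens_ext (f := fun z => g (tlin F z)) (g := f)) z.
- by apply: (linear_fun_comp (bh_lin g)); exact: tlin_lin.
- exact: (bh_lin f).
move=> p m; rewrite tlin_pure //; exact: (congr1 (fun u => val u m) (hP p)).
Qed.

Lemma biprojective_res_id (R S : kalg K) (P : bimod R S) :
  biprojective (res (id_hom R) (id_hom S) P) -> biprojective P.
Proof.
have i : is_bihom (id : P -> res (id_hom R) (id_hom S) P) by [].
have r : is_bihom (id : res (id_hom R) (id_hom S) P -> P) by [].
exact: (biprojective_retract (i := Bihom i) (r := Bihom r)).
Qed.

(** [kap] splits the surjection x |-> x u, so [M] is a direct summand of the left module [R]. The
    instances are algebras acting on themselves and [Be], with [u = e] and the inclusion as
    [kap]. *)
Lemma cyclic_projl (R S : kalg K) (M : bimod R S) (u : M) (kap : M -> R) :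
  linear_fun kap -> (forall x m, kap (lact x m) = x ** kap m) ->
  (forall m, lact (kap m) u = m) -> biprojective (res (id_hom R) (unit_hom S) M).
Proof.
move=> kl kx ku N N' g f gs; have [y gy] := gs (f u).
have hi : is_bihom (fun m : res (id_hom R) (unit_hom S) M => lact (kap m) y : N).
  have [h1 h2] := lact_bilinear N.
  split=> [k m m'|x m|m k]; first by rewrite kl h1.
    by rewrite /= kx lact_mul.
  by rewrite /= ract_unit ract_base (lfZ kl) (lfZ (h1 y)).
exists (Bihom hi) => m /=.
by rewrite bh_l gy -[in RHS](ku m); exact/esym/(bh_l f).
Qed.

Lemma cyclic_projr (R S : kalg K) (M : bimod R S) (u : M) (kap : M -> S) :
  linear_fun kap -> (forall m x, kap (ract m x) = kap m ** x) ->
  (forall m, ract u (kap m) = m) -> biprojective (res (unit_hom R) (id_hom S) M).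
Proof.
move=> kl kx ku N N' g f gs; have [y gy] := gs (f u).
have hi : is_bihom (fun m : res (unit_hom R) (id_hom S) M => ract y (kap m) : N).
  have [h1 h2] := ract_bilinear N.
  split=> [k m m'|k m|m x]; first by rewrite kl h2.
    by rewrite /= lact_unit lact_base (lfZ kl) (lfZ (h2 y)).
  by rewrite /= kx ract_mul.
exists (Bihom hi) => m /=.
by rewrite bh_r gy -[in RHS](ku m); exact/esym/(bh_r f).
Qed.

(** Passes from the library's linear maps to bimodules over [kbase], on which both actions are
    forced to be multiplication by scalars. *)
Lemma projective_module_res (R S : kalg K) (M : bimod R S) :
  projective_module M -> biprojective (res (unit_hom R) (unit_hom S) M).
Proof.
move=> Mp N N' g f gs.
pose gL := GRing.isLinear.Build K N N' *:%R g (bh_lin g).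
pose fL := GRing.isLinear.Build K M N' *:%R f (bh_lin f).
pose g' : {linear N -> N'} := HB.pack (bh g) gL.
pose f' : {linear M -> N'} := HB.pack (bh f) fL.
have [h hP] := Mp N N' g' f' gs.
have hl : linear_fun h by move=> k u v; rewrite linearP.
have hi : is_bihom (h : res (unit_hom R) (unit_hom S) M -> N).
  split=> [//|k m|m k] /=.
    by rewrite lact_unit lact_base (lfZ hl).
  by rewrite ract_unit ract_base (lfZ hl).
by exists (Bihom hi) => m; exact: hP.
Qed.

Lemma projective_retract (U V : lmodType K) (i : U -> V) (r : V -> U) :
  linear_fun i -> linear_fun r -> (forall u, r (i u) = u) ->
  projective_module V -> projective_module U.
Proof.
move=> il rl ri Vp M N g f gs.
pose rL := GRing.isLinear.Build K V U *:%R r rl.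
pose iL := GRing.isLinear.Build K U V *:%R i il.
pose r' : {linear V -> U} := HB.pack r rL.
pose i' : {linear U -> V} := HB.pack i iL.
have [h hP] := Vp M N g (f \o r') gs.
by exists (h \o i') => u; rewrite /= hP /= ri.
Qed.

End Projectivity.

(** * The bar resolution *)

Section LeftTensor.
Variables (K : comPzRingType) (L : kalg K) (X : bimod L L).

Definition ltlin (V : lmodType K) (f : L -> X -> V) : ltens X -> V :=
  tlin (f : res (id_hom L) (unit_hom L) (reg L) -> res (unit_hom L) (id_hom L) X -> V).

Lemma ltlin_balanced (V : lmodType K) (f : L -> X -> V) : bilinear_fun f ->
  balanced (f : res (id_hom L) (unit_hom L) (reg L) -> res (unit_hom L) (id_hom L) X -> V).
Proof.
move=> [fl fr]; split=> // a k x.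
by rewrite ract_base lact_base (lfZ (fl x)) (lfZ (fr a)).
Qed.

Lemma ltlin_pure (V : lmodType K) (f : L -> X -> V) a x :
  bilinear_fun f -> ltlin f (lpure a x) = f a x.
Proof. by move=> fb; apply: (tlin_pure _ _ (ltlin_balanced fb)). Qed.

Lemma ltlin_lin (V : lmodType K) (f : L -> X -> V) :
  bilinear_fun f -> linear_fun (ltlin f).
Proof. by move=> fb; apply: (tlin_lin (ltlin_balanced fb)). Qed.

Lemma ltens_ext (V : lmodType K) (f g : ltens X -> V) :
  linear_fun f -> linear_fun g -> (forall a x, f (lpure a x) = g (lpure a x)) ->
  forall z, f z = g z.
Proof. exact: tens_ext. Qed.

Lemma lpure_linl (x : X) : linear_fun (fun a : L => lpure a x).
Proof. exact: (@tpure_linl _ _ _ _ (res (id_hom L) (unit_hom L) (reg L))). Qed.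

Lemma lpure_linr (a : L) : linear_fun (fun x : X => lpure a x).
Proof.
exact: (@tpure_linr _ _ _ _ (res (id_hom L) (unit_hom L) (reg L))
  (res (unit_hom L) (id_hom L) X)).
Qed.

Lemma lact_lpure b a (x : X) : lact b (lpure a x) = lpure (b ** a) x.
Proof. exact: lact_tpure. Qed.

Lemma ract_lpure a (x : X) b : ract (lpure a x) b = lpure a (ract x b).
Proof. exact: ract_tpure. Qed.

End LeftTensor.

Section BarResolution.
Variables (K : comPzRingType) (L : kalg K).

Section Projective.
Hypothesis L_proj : projective_module L.

Lemma barX_projr n : biprojective (res (unit_hom L) (id_hom L) (barX L n)).
Proof.
elim: n => [|n IH].
  by apply: (cyclic_projr (u := kone L : reg L) (kap := id)) => //; exact: kmul1x.
apply: tens_projl => //.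
exact: (@projective_module_res K L (kbase K) (res (id_hom L) (unit_hom L) (reg L))).
Qed.

Lemma barX_proj n : biprojective (barX L n.+1).
Proof.
apply/biprojective_res_id/tens_projl; last exact: barX_projr.
apply: (cyclic_projl (u := kone L : res (id_hom L) (unit_hom L) (reg L)) (kap := id)) => //.
exact: kmulx1.
Qed.
End Projective.

Lemma bard_exact n (x : barX L n.+1) : bard L n x = 0 -> exists y, bard L n.+1 y = x.
Proof.
move=> x0; exists (lpure (kone L) x).
by rewrite bard_pure x0 lact_one (lf0 (@lpure_linr _ _ _ _)) subr0.
Qed.

Lemma bar_resolution : projective_module L -> projective_resolution (bar_eps L).
Proof.
move=> Lp; split=> [n|m|x|n x].
- exact: barX_proj.
- by split=> // _; exists (@lpure _ _ (reg L) (kone L) m); rewrite bard0_pure kmul1x.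
- split=> [|[y <-]]; last exact: (@bar_dd _ _ 0).
  exact: (@bard_exact 0).
exact: (@bard_exact n.+1).
Qed.

Section CochainMap.
Variable M : bimod L L.

(* The right [L]-linear map [x1 (x) .. (x) xn (x) x |-> f [:: x1; ..; xn] x] *)
Fixpoint cochmap (n : nat) (f : seq L -> M) : barX L n -> M :=
  match n return barX L n -> M with
  | 0%N => fun x => ract (f [::]) (x : L)
  | n'.+1 => ltlin (fun a x => @cochmap n' (fun s => f (a :: s)) x)
  end.

Lemma eq_cochmap n f g x : (forall s, size s = n -> f s = g s) ->
  @cochmap n f x = cochmap g x.
Proof.
elim: n f g x => [|n IH] f g x fg; first by rewrite /= fg.
by apply: tlin_ext => a y; apply: IH => s sn; rewrite fg //= sn.
Qed.

Lemma cochmap_linf n k f g x :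
  @cochmap n (fun s => k *: f s + g s) x = k *: cochmap f x + cochmap g x.
Proof.
elim: n f g x => [|n IH] f g x; first by rewrite /= ract_lin.
by rewrite /= /ltlin /tlin scaler_sumr -big_split; apply: eq_bigr => p _; rewrite IH.
Qed.

Lemma cochmap_lact n b f x :
  @cochmap n (fun s => lact b (f s)) x = lact b (cochmap f x).
Proof.
elim: n f x => [|n IH] f x; first by rewrite /= lract.
by rewrite /= /ltlin /tlin (lf_sum (lact_lin _)); apply: eq_bigr => p _; rewrite IH.
Qed.

Lemma cochmap_lin n f : multilinear f -> linear_fun (@cochmap n f).
Proof.
elim: n f => [|n IH] f fl.
  by move=> k u v; have [_ h] := ract_bilinear M; exact: h.
apply: ltlin_lin; split=> [x k a b|a]; last exact/IH/multilinear_cons.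
by rewrite -cochmap_linf; congr cochmap; apply/funext => s; exact: (fl [::]).
Qed.

Lemma cochmap_bilinear n f : multilinear f ->
  bilinear_fun (fun a x => @cochmap n (fun s => f (a :: s)) x).
Proof.
move=> fl; split=> [x k a b|a]; last exact/cochmap_lin/multilinear_cons.
by rewrite -cochmap_linf; congr cochmap; apply/funext => s; exact: (fl [::]).
Qed.

Lemma cochmap_pure n f a x : multilinear f ->
  @cochmap n.+1 f (lpure a x) = cochmap (fun s => f (a :: s)) x.
Proof. by move=> fl; apply: (ltlin_pure _ _ (cochmap_bilinear n fl)). Qed.

Lemma cochmap_ract n f x y : multilinear f ->
  @cochmap n f (ract x y) = ract (cochmap f x) y.
Proof.
elim: n f x => [|n IH] f x fl; first exact: ract_mul.
apply: (ltens_ext (f := fun x => @cochmap n.+1 f (ract x y))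
  (g := fun x => ract (@cochmap n.+1 f x) y)) x => [||a x].
- by apply: (linear_fun_comp (@cochmap_lin n.+1 _ fl)); exact: ract_lin.
- by apply: (linear_fun_comp (ract_lin y)); exact: (@cochmap_lin n.+1).
by rewrite ract_lpure !cochmap_pure // IH //; exact: multilinear_cons.
Qed.

Lemma cochmap_word n f s : multilinear f -> size s = n ->
  @cochmap n f (bar_word n s) = f s.
Proof.
elim: n f s => [|n IH] f [|a s] fl //= ss; first by rewrite ract_one.
by rewrite [LHS](cochmap_pure _ _ fl) IH //; [exact: multilinear_cons|case: ss].
Qed.

Lemma cochmap_lact_head n f a x : multilinear f ->
  @cochmap n.+1 f (lact a x) = cochmap (fun s => f (a ** head 0 s :: behead s)) x.
Proof.
move=> fl; apply: (ltens_ext (f := fun x => @cochmap n.+1 f (lact a x))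
  (g := @cochmap n.+1 _)) x => [||b x].
- by apply: (linear_fun_comp (@cochmap_lin n.+1 _ fl)); exact: lact_lin.
- apply: ltlin_lin; split=> [x k b c|b]; last first.
    exact: (cochmap_lin (multilinear_cons (a ** b) fl)).
  rewrite -cochmap_linf; congr cochmap; apply/funext => s /=.
  by rewrite kmul_linr; exact: (fl [::]).
rewrite lact_lpure cochmap_pure //; apply/esym.
apply: (ltlin_pure (f := fun b y => @cochmap n (fun s => f (a ** b :: s)) y)).
split=> [y k c d|c]; last exact: (cochmap_lin (multilinear_cons (a ** c) fl)).
by rewrite -cochmap_linf; congr cochmap; apply/funext => s; rewrite kmul_linr; exact: (fl [::]).
Qed.

(** [bard] sends a (x) x to a x - a (x) [bard] x, and [rdiff_cons2] has the same shape: acting by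
    [a] corresponds to merging the first two arguments, the other term to fixing the first one. *)
Lemma cochmap_bard n f x : multilinear f ->
  @cochmap n f (bard L n x) = cochmap (rdiff f) x.
Proof.
elim: n f x => [|n IH] f x fl; have rl := rdiff_multilinear fl.
  apply: (ltens_ext (f := fun x => @cochmap 0 f (bard L 0 x))) x => [||a x].
  - by apply: (linear_fun_comp (@cochmap_lin 0 _ fl)); exact: bh_lin.
  - exact: (@cochmap_lin 1).
  by rewrite bard0_pure cochmap_pure //= ract_mul.
apply: (ltens_ext (f := fun x => @cochmap n.+1 f (bard L n.+1 x))) x => [||a x].
- by apply: (linear_fun_comp (@cochmap_lin n.+1 _ fl)); exact: bh_lin.
- exact: (@cochmap_lin n.+2).
have fal := multilinear_cons a fl.
rewrite bard_pure (lfB (@cochmap_lin n.+1 _ fl)) cochmap_lact_head //.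
rewrite [cochmap f _](cochmap_pure _ _ fl) (IH _ _ fal) [RHS](cochmap_pure _ _ rl).
rewrite [RHS](@eq_cochmap n.+1 _ (fun s => -1 *: rdiff (fun s => f (a :: s)) s +
  f (a ** head 0 s :: behead s))); last first.
  by case=> // b s _; rewrite rdiff_cons2 scaleN1r addrC.
by rewrite cochmap_linf scaleN1r addrC.
Qed.

(* The bimodule map [x0 (x) .. (x) x(n+1) |-> x0 f [:: x1; ..; xn] x(n+1)] *)
Definition cochbi n (f : seq L -> M) : bar L n -> M := @cochmap n.+1 (ldiff f).

Lemma cochbi_pure n f a (x : barX L n) : multilinear f ->
  @cochbi n f (lpure a x) = lact a (cochmap f x).
Proof. by move=> fl; rewrite /cochbi cochmap_pure ?cochmap_lact //; exact: ldiff_multilinear. Qed.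

Lemma cochbi_bihom n f : multilinear f -> is_bihom (@cochbi n f).
Proof.
move=> fl; have ll := ldiff_multilinear fl; split=> [|b x|x b].
- exact: cochmap_lin.
- apply: (ltens_ext (f := fun x => @cochbi n f (lact b x))
    (g := fun x => lact b (@cochbi n f x))) x => [||a x].
  + by apply: (linear_fun_comp (@cochmap_lin n.+1 _ ll)); exact: lact_lin.
  + by apply: (linear_fun_comp (lact_lin b)); exact: (@cochmap_lin n.+1).
  by rewrite lact_lpure !cochbi_pure // lact_mul.
exact: cochmap_ract.
Qed.

Lemma cochbi_d n f x : multilinear f ->
  @cochbi n f (cd (bar L) n x) = cochbi (hdiff f) x.
Proof.
move=> fl; rewrite /cochbi [LHS](cochmap_bard _ (ldiff_multilinear fl)).
by apply: eq_cochmap => -[|a [|b s]] // _; rewrite rdiff_ldiff.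
Qed.

Lemma cochbi_word n f a s : multilinear f -> size s = n ->
  @cochbi n f (bar_word n.+1 (a :: s)) = lact a (f s).
Proof. by move=> fl ss; rewrite [LHS]cochbi_pure //= cochmap_word. Qed.

Lemma barX_ext n (g h : barX L n -> M) :
  linear_fun g -> linear_fun h ->
  (forall x y, g (ract x y) = ract (g x) y) ->
  (forall x y, h (ract x y) = ract (h x) y) ->
  (forall s, size s = n -> g (bar_word n s) = h (bar_word n s)) ->
  forall x, g x = h x.
Proof.
elim: n g h => [|n IH] g h gl hl gr hr gh x.
  by rewrite -[x]kmul1x -[kone L ** x]/(ract (kone L : reg L) x) gr hr (gh [::]).
apply: (ltens_ext gl hl) => a {}x.
apply: (IH (fun x => g (lpure a x)) (fun x => h (lpure a x))).
- exact: (linear_fun_comp gl (@lpure_linr _ _ _ a)).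
- exact: (linear_fun_comp hl (@lpure_linr _ _ _ a)).
- by move=> y z; rewrite -gr ract_lpure.
- by move=> y z; rewrite -hr ract_lpure.
by move=> s ss; apply: (gh (a :: s)); rewrite /= ss.
Qed.

Lemma bar_ext n (g h : bar L n -> M) : is_bihom g -> is_bihom h ->
  (forall s, size s = n ->
     g (bar_word n.+1 (kone L :: s)) = h (bar_word n.+1 (kone L :: s))) ->
  forall x, g x = h x.
Proof.
move=> [gl gL gr] [hl hL hr] gh; apply: (ltens_ext gl hl) => a x.
have E : lpure a x = lact a (lpure (kone L) x) by rewrite lact_lpure kmulx1.
rewrite E gL hL; congr lact.
apply: (barX_ext (g := fun x => g (lpure _ x)) (h := fun x => h (lpure _ x))).
- exact: (linear_fun_comp gl (@lpure_linr _ _ _ _)).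
- exact: (linear_fun_comp hl (@lpure_linr _ _ _ _)).
- by move=> y z; rewrite -gr ract_lpure.
- by move=> y z; rewrite -hr ract_lpure.
by move=> s ss; apply: gh.
Qed.

Lemma bar_word_lin n s1 s2 k x y : (size s1 < n)%N ->
  bar_word n (s1 ++ (k *: x + y) :: s2) =
  k *: bar_word n (s1 ++ x :: s2) + bar_word n (s1 ++ y :: s2) :> barX L n.
Proof.
elim: n s1 => // n IH [|a s1] /= h; first exact: lpure_linl.
by rewrite IH //; exact: lpure_linr.
Qed.

(** The cochain used in [ext_to_HH]. It is inverse to [cochbi], between bimodule maps and cochains
    of degree [n]. *)
Definition bar_ev n (F : bar L n -> M) : seq L -> M :=
  fun s => if size s == n then F (bar_word n.+1 (kone L :: s)) else 0.

Lemma bar_ev_cochain n (F : bar L n -> M) : is_bihom F -> is_cochain n (bar_ev F).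
Proof.
move=> [Fl _ _]; split=> [s /negPf|s1 s2 k x y]; rewrite /bar_ev; first by move->.
have E z : (size (s1 ++ z :: s2) == n) = (size s1 + (size s2).+1 == n)%N.
  by rewrite size_cat.
rewrite !E; case: eqP => [ss|_]; last by rewrite scaler0 addr0.
by rewrite -Fl -!cat_cons bar_word_lin // -ss /= addnS ltnS ltnS leq_addr.
Qed.

Lemma bar_ev_size n (F : bar L n -> M) s : size s = n ->
  bar_ev F s = F (bar_word n.+1 (kone L :: s)).
Proof. by move=> ss; rewrite /bar_ev ss eqxx. Qed.

Lemma cochbi_ev n (F : bar L n -> M) x : is_bihom F -> cochbi (bar_ev F) x = F x.
Proof.
move=> Fh; have [_ el] := bar_ev_cochain Fh.
apply: bar_ext => // [|s ss]; first exact: cochbi_bihom.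
by rewrite cochbi_word // lact_one bar_ev_size.
Qed.

Lemma bar_ev_cochbi n f : is_cochain n f -> bar_ev (@cochbi n f) = f.
Proof.
move=> [f0 fl]; apply/funext => s; rewrite /bar_ev; case: eqP => [ss|/eqP/f0 -> //].
by rewrite cochbi_word // lact_one.
Qed.

Lemma bar_ev_d n (F : bar L n -> M) : is_bihom F ->
  bar_ev (fun x => F (cd (bar L) n x)) = hdiff (bar_ev F).
Proof.
move=> Fh; have [c el] := bar_ev_cochain Fh.
rewrite -[RHS](@bar_ev_cochbi n.+1); last exact: hdiff_cochain.
by congr bar_ev; apply/funext => x; rewrite -cochbi_d // cochbi_ev.
Qed.

Lemma bar_ev_lin n : linear_fun (@bar_ev n : _ -> seq L -> M).
Proof.
move=> k F G; apply/funext => s; rewrite -[RHS]/(k *: bar_ev F s + bar_ev G s).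
by rewrite /bar_ev; case: ifP; rewrite ?scaler0 ?addr0.
Qed.

Lemma bar_ev_cocycle n F : ext_cocycle (bar L) M n F -> hh_cocycle M n (bar_ev F).
Proof.
move=> [Fh Fd]; split; first exact: bar_ev_cochain.
rewrite -bar_ev_d // (_ : (fun _ => _) = 0); last by apply/funext.
by apply/funext => s; rewrite /bar_ev; case: ifP.
Qed.

Lemma bar_ev_coboundary n F :
  ext_coboundary (bar L) M n F -> hh_coboundary M n (bar_ev F).
Proof.
case: n F => [|n] F /= => [->|[G [Gh ->]]].
  by apply/funext => s; rewrite /bar_ev; case: ifP.
by exists (bar_ev G); split; [exact: bar_ev_cochain|exact: bar_ev_d].
Qed.

Lemma cochbi_cocycle n f : hh_cocycle M n f -> ext_cocycle (bar L) M n (cochbi f).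
Proof.
move=> [[f0 fl] fd]; split=> [|x]; first exact: cochbi_bihom.
rewrite cochbi_d // fd.
have -> : (0 : seq L -> M) = bar_ev (0 : bar L n.+1 -> M).
  by apply/funext => s; rewrite /bar_ev; case: ifP.
rewrite cochbi_ev //; exact: is_bihom_0.
Qed.

Lemma ext_to_HH_hcl n F : ext_cocycle (bar L) M n F ->
  ext_to_HH (hcl _ _ F : Ext (bar L) M n) = hcl _ _ (bar_ev F).
Proof.
apply: (ind_hcl (@bar_ev_lin n)); [exact: bar_ev_cocycle|exact: bar_ev_coboundary].
Qed.

Lemma ext_to_HH_lin n : linear_fun (@ext_to_HH K L M n).
Proof.
apply: (ind_lin (@bar_ev_lin n)); [exact: bar_ev_cocycle|exact: bar_ev_coboundary].
Qed.

Lemma ext_to_HH_bij n : bijective (@ext_to_HH K L M n).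
Proof.
apply: (ind_bij (@bar_ev_lin n)).
- exact: bar_ev_cocycle.
- exact: bar_ev_coboundary.
- case: n => [|n] F [Fh Fd] /= => [F0|[g [gc Fg]]].
    apply/funext => x; apply: (bar_ext Fh (is_bihom_0 _ _)) => s ss.
    by rewrite -bar_ev_size // F0.
  exists (cochbi g); split; first by case: gc => _; exact: cochbi_bihom.
  apply/funext => x; rewrite cochbi_d; last by case: gc.
  by rewrite -Fg cochbi_ev.
move=> f fZ; exists (cochbi f); first exact: cochbi_cocycle.
rewrite bar_ev_cochbi; last by case: fZ.
by rewrite subrr; exact: sm_0.
Qed.

End CochainMap.

Lemma bar_computes : projective_module L -> bar_computes_HH L.
Proof. by move=> Lp; split=> [|M n]; [exact: bar_resolution|exact: ext_to_HH_bij]. Qed.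

End BarResolution.

(** * Functoriality and right contraction of the bar complex *)

Section BarFunctoriality.
Variables (K : comPzRingType) (L L' : kalg K) (beta : L -> L').
Hypothesis beta_lin : linear_fun beta.
Hypothesis beta_mul : forall x y, beta (x ** y) = beta x ** beta y.

Fixpoint barmap (n : nat) : barX L n -> barX L' n :=
  match n return barX L n -> barX L' n with
  | 0%N => beta
  | n'.+1 => ltlin (fun a x => lpure (beta a) (@barmap n' x))
  end.

Lemma barmap_lin n : linear_fun (@barmap n).
Proof.
elim: n => // n IH; apply: ltlin_lin; split=> [x|a].
  exact: (linear_fun_comp (@lpure_linl _ _ _ _)).
exact: (linear_fun_comp (@lpure_linr _ _ _ _)).
Qed.

Lemma barmap_pure n a x : @barmap n.+1 (lpure a x) = lpure (beta a) (barmap x).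
Proof.
apply: (ltlin_pure (f := fun a x => lpure (beta a) (@barmap n x))); split=> [{}x|{}a].
  exact: (linear_fun_comp (@lpure_linl _ _ _ _)).
exact: (linear_fun_comp (@lpure_linr _ _ _ _) (@barmap_lin n)).
Qed.

Lemma barmap_lact n a x : @barmap n (lact a x) = lact (beta a) (barmap x).
Proof.
case: n x => [|n] x; first exact: beta_mul.
apply: (ltens_ext (f := fun x => @barmap n.+1 (lact a x))
  (g := fun x => lact (beta a) (@barmap n.+1 x))) x => [||b x].
- by apply: (linear_fun_comp (@barmap_lin n.+1)); exact: lact_lin.
- by apply: (linear_fun_comp (lact_lin _)); exact: (@barmap_lin n.+1).
by rewrite lact_lpure !barmap_pure lact_lpure beta_mul.
Qed.

Lemma barmap_ract n x a : @barmap n (ract x a) = ract (barmap x) (beta a).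
Proof.
elim: n x => [|n IH] x; first exact: beta_mul.
apply: (ltens_ext (f := fun x => @barmap n.+1 (ract x a))
  (g := fun x => ract (@barmap n.+1 x) (beta a))) x => [||b x].
- by apply: (linear_fun_comp (@barmap_lin n.+1)); exact: ract_lin.
- by apply: (linear_fun_comp (ract_lin _)); exact: (@barmap_lin n.+1).
by rewrite ract_lpure !barmap_pure ract_lpure IH.
Qed.

Lemma barmap_bard n x : barmap (bard L n x) = bard L' n (barmap x).
Proof.
elim: n x => [|n IH] x.
  apply: (ltens_ext (f := fun x => @barmap 0 (bard L 0 x))
    (g := fun x => bard L' 0 (@barmap 1 x))) x => [||a x].
  - by apply: (linear_fun_comp (@barmap_lin 0)); exact: bh_lin.
  - by apply: (linear_fun_comp (bh_lin _)); exact: (@barmap_lin 1).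
  by rewrite barmap_pure !bard0_pure; exact: beta_mul.
apply: (ltens_ext (f := fun x => @barmap n.+1 (bard L n.+1 x))
  (g := fun x => bard L' n.+1 (@barmap n.+2 x))) x => [||a x].
- by apply: (linear_fun_comp (@barmap_lin n.+1)); exact: bh_lin.
- by apply: (linear_fun_comp (bh_lin _)); exact: (@barmap_lin n.+2).
by rewrite barmap_pure !bard_pure (lfB (@barmap_lin n.+1)) barmap_lact barmap_pure IH.
Qed.

(** The trailing 1 of a word goes to [beta (kone L)]. For the inclusion of [eBe] into [B] this is
    [e] and not 1. *)
Lemma barmap_word n s : size s = n ->
  barmap (bar_word n s) = ract (bar_word n (map beta s)) (beta (kone L)).
Proof.
elim: n s => [|n IH] [|a s] //= ss; first by rewrite kmul1x.
rewrite [LHS]barmap_pure IH; last by case: ss.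
by rewrite [RHS]ract_lpure.
Qed.

End BarFunctoriality.

Section RightContraction.
Variables (K : comPzRingType) (L : kalg K).

(* [x |-> x (x) 1] *)
Fixpoint bar_contr (n : nat) : barX L n -> barX L n.+1 :=
  match n return barX L n -> barX L n.+1 with
  | 0%N => fun x => @lpure _ _ (reg L) x (kone L)
  | n'.+1 => ltlin (fun a x => lpure a (@bar_contr n' x))
  end.

Lemma bar_contr_lin n : linear_fun (@bar_contr n).
Proof.
elim: n => [|n IH]; first exact: (@lpure_linl _ _ (reg L)).
apply: ltlin_lin; split=> [x|a]; first exact: (@lpure_linl _ _ _ _).
exact: (linear_fun_comp (@lpure_linr _ _ _ _)).
Qed.

Lemma bar_contr_pure n a x : @bar_contr n.+1 (lpure a x) = lpure a (bar_contr x).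
Proof.
apply: (ltlin_pure (f := fun a x => lpure a (@bar_contr n x))); split=> [{}x|{}a].
  exact: (@lpure_linl _ _ _ _).
exact: (linear_fun_comp (@lpure_linr _ _ _ _) (@bar_contr_lin n)).
Qed.

Lemma bar_contr_lact n a x : @bar_contr n (lact a x) = lact a (bar_contr x).
Proof.
case: n x => [|n] x; first by rewrite [RHS]lact_lpure.
apply: (ltens_ext (f := fun x => @bar_contr n.+1 (lact a x))
  (g := fun x => lact a (@bar_contr n.+1 x))) x => [||b x].
- by apply: (linear_fun_comp (@bar_contr_lin n.+1)); exact: lact_lin.
- by apply: (linear_fun_comp (lact_lin _)); exact: (@bar_contr_lin n.+1).
by rewrite lact_lpure !bar_contr_pure lact_lpure.
Qed.

(** In contrast to x |-> 1 (x) x, this contraction is left linear, so it survives tensoring with a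
    module on the left. *)
Lemma bard_contr n x : bard L n.+1 (bar_contr x) =
  bar_contr (bard L n x) + (-1 : K) ^+ n.+1 *: x.
Proof.
have lin m : linear_fun (fun x : barX L m.+1 => bard L m.+1 (bar_contr x)).
  by apply: (linear_fun_comp (bh_lin _)); exact: bar_contr_lin.
have lin' m : linear_fun (fun x : barX L m.+1 =>
    bar_contr (bard L m x) + (-1 : K) ^+ m.+1 *: x).
  move=> k u v; rewrite bh_lin bar_contr_lin !scalerDr !scalerA [_ * k]mulrC; zmod.
elim: n x => [|n IH] x; apply: (ltens_ext (lin _) (lin' _)) => a {}x.
  rewrite bar_contr_pure bard_pure.
  rewrite -![@bar_contr 0 _]/(@lpure _ _ (reg L) _ (kone L)) [lact a _]lact_lpure.
  by rewrite !bard0_pure kmulx1 scaleN1r.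
rewrite bar_contr_pure bard_pure IH (lfD (@lpure_linr _ _ _ a)).
rewrite (lfZ (@lpure_linr _ _ _ a)) bard_pure (lfB (@bar_contr_lin n.+1)).
by rewrite bar_contr_lact bar_contr_pure [in RHS]signrS; zmod.
Qed.

End RightContraction.

(** * Tensoring the bar resolution from both sides *)

Section TensorFunctions.
Variables (K : comPzRingType).

Section Left.
Variables (R S T T' : kalg K) (M : bimod R S) (P : bimod S T) (P' : bimod S T').
Variable h : P -> P'.
Hypotheses (h_lin : linear_fun h) (h_l : forall x p, h (lact x p) = lact x (h p)).

(** [tmap] wants bimodule maps, but the contraction of the bar complex is linear on the left only.
    Likewise [tfunr] serves comparison maps that are linear on the right only. *)
Definition tfunl : tens M P -> tens M P' := tlin (fun m p => tpure m (h p) : tens M P').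

Lemma tfunl_balanced : balanced (fun m p => tpure m (h p) : tens M P').
Proof.
split; first split=> [p|m].
- exact: (@tpure_linl _ _ _ _ M P').
- exact: (linear_fun_comp (@tpure_linr _ _ _ _ M P' m)).
by move=> m x p; rewrite h_l tpure_bal.
Qed.
Lemma tfunl_lin : linear_fun tfunl.
Proof. exact: tlin_lin tfunl_balanced. Qed.
End Left.

Section Right.
Variables (R R' S T : kalg K) (P : bimod R S) (P' : bimod R' S) (N : bimod S T).
Variable h : P -> P'.
Hypotheses (h_lin : linear_fun h) (h_r : forall p x, h (ract p x) = ract (h p) x).

Definition tfunr : tens P N -> tens P' N := tlin (fun p n => tpure (h p) n : tens P' N).

Lemma tfunr_balanced : balanced (fun p n => tpure (h p) n : tens P' N).
Proof.
split; first split=> [n|p].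
- exact: (linear_fun_comp (@tpure_linl _ _ _ _ P' N n)).
- exact: (@tpure_linr _ _ _ _ P' N).
by move=> p x n; rewrite h_r tpure_bal.
Qed.
Lemma tfunr_lin : linear_fun tfunr.
Proof. exact: tlin_lin tfunr_balanced. Qed.
Lemma tfunr_pure p n : tfunr (tpure p n) = tpure (h p) n.
Proof. exact: tlin_pure tfunr_balanced. Qed.
End Right.

Section RestrictedComplex.
Variables (R R' S S' : kalg K) (rho : alghom R' R) (sigma : alghom S' S).

Fact resbh_is_bihom (M N : bimod R S) (f : bihom M N) :
  is_bihom (f : res rho sigma M -> res rho sigma N).
Proof. by split=> [|x m|m x]; [exact: (bh_lin f)|exact: (bh_l f)|exact: (bh_r f)]. Qed.
Definition resbh (M N : bimod R S) (f : bihom M N) := Bihom (resbh_is_bihom f).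

Definition resC (C : cplx R S) : cplx R' S' :=
  @Cplx K R' S' (fun n => res rho sigma (C n)) (fun n => resbh (cd C n)) (@cdd _ _ _ C).
End RestrictedComplex.

End TensorFunctions.

Section TensoredBar.
Variables (K : comPzRingType) (R S T : kalg K) (M : bimod R S) (N : bimod S T).
Local Notation X := (tensl M (bar S)).
Local Notation C := (tensr X N).

Definition tensl_bar_eps : bihom (X 0%N) M :=
  compbh (rmult M) (tmap (idbh M) (bar_eps S)).

Lemma rmult_pure m s : rmult M (tpure m (s : reg S)) = ract m s.
Proof. exact: tlift_pure. Qed.

Lemma tensl_bar_epsE m q : tensl_bar_eps (tpure m q) = ract m (bard S 0 q : S).
Proof.
rewrite -[LHS]/(rmult M (tmap (idbh M) (bar_eps S) (tpure m q))).
by rewrite tmap_pure rmult_pure.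
Qed.

Lemma tensl_bar_eps_d y : tensl_bar_eps (cd X 0%N y) = 0.
Proof.
apply: (tens_ext (f := fun y => tensl_bar_eps (cd X 0%N y)) (g := fun=> 0)) y => [|k u v|m y].
- exact: (linear_fun_comp (bh_lin _) (bh_lin _)).
- by rewrite scaler0 addr0.
rewrite [cd X 0%N _]tmap_pure [LHS]tensl_bar_epsE [bard S 0 _](@bar_dd _ S 0).
by have [_ h] := ract_bilinear M; rewrite (lf0 (h _)).
Qed.

Lemma tensl_bar_eps_pure m s s' :
  tensl_bar_eps (tpure m (@lpure _ _ (reg S) s s')) = ract m (s ** s').
Proof.
rewrite -[LHS]/(rmult M (tmap (idbh M) (bar_eps S) (tpure m (@lpure _ _ (reg S) s s')))).
by rewrite tmap_pure rmult_pure [bar_eps S _]bard0_pure.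
Qed.

Lemma rmult_inj (z : tens M (reg S)) : rmult M z = 0 -> z = 0.
Proof.
move=> z0; suff -> : z = tpure (rmult M z) (kone S : reg S).
  by rewrite z0 (lf0 (@tpure_linl _ _ _ _ M (reg S) _)).
apply: (tens_ext (f := id) (g := fun z => tpure (rmult M z) (kone S : reg S))) => //.
  exact: (linear_fun_comp (@tpure_linl _ _ _ _ M (reg S) _) (bh_lin _)).
by move=> m s; rewrite rmult_pure tpure_bal /= kmulx1.
Qed.

Lemma tensl_bar_contr n (z : tens M (barX S n.+1)) :
  tmap (idbh M) (bard S n.+1) (tfunl (@bar_contr K S n.+1) z) =
  tfunl (@bar_contr K S n) (tmap (idbh M) (bard S n) z) + (-1 : K) ^+ n.+1 *: z.
Proof.
have cb m := tfunl_balanced M (@bar_contr_lin K S m) (@bar_contr_lact K S m).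
have cl m := tfunl_lin (M := M) (@bar_contr_lin K S m) (@bar_contr_lact K S m).
apply: (tens_ext (f := fun z => tmap (idbh M) (bard S n.+1) (tfunl (@bar_contr K S n.+1) z))
  (g := fun z => tfunl (@bar_contr K S n) (tmap (idbh M) (bard S n) z)
    + (-1 : K) ^+ n.+1 *: z)) => [||m p].
- exact: (linear_fun_comp (bh_lin _) (cl _)).
- move=> k u v; rewrite (bh_lin (tmap _ _)) cl !scalerDr !scalerA [_ * k]mulrC; zmod.
rewrite [tfunl _ _](tlin_pure _ _ (cb n.+1)) !tmap_pure.
rewrite [tfunl _ _](tlin_pure _ _ (cb n)) bard_contr.
by rewrite (lfD (@tpure_linr _ _ _ _ M _ m)) (lfZ (@tpure_linr _ _ _ _ M _ m)).
Qed.

Lemma tensl_bar_exact_aux n (z : tens M (barX S n.+1)) :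
  tmap (idbh M) (bard S n) z = 0 -> exists y, tmap (idbh M) (bard S n.+1) y = z.
Proof.
move=> z0; have cl := tfunl_lin (M := M) (@bar_contr_lin K S n) (@bar_contr_lact K S n).
exists ((-1 : K) ^+ n.+1 *: tfunl (@bar_contr K S n.+1) z).
rewrite (lfZ (bh_lin _)) tensl_bar_contr z0 (lf0 cl) add0r scalerA.
by rewrite -exprD addnn -signr_odd odd_double scale1r.
Qed.

(** The contraction gives exactness, and projectivity over [K] of [M] and [S] gives projectivity of
    the terms. This is the resolution of the right module [M] to be compared with the one hidden in
    [Tor_eq0]. *)
Lemma tensl_bar_resolution : projective_module M -> projective_module S ->
  projective_resolution
    (resbh (unit_hom R) (id_hom S) tensl_bar_eps : bihom (resC _ _ X 0%N) _).
Proof.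
move=> Mp Sp; split=> [n|m|x|n x].
- exact: tens_projl (projective_module_res Mp) (@barX_proj K S Sp n).
- split=> // _; exists (tpure (m : M) (@lpure _ _ (reg S) (kone S) (kone S))).
  by rewrite [LHS]tensl_bar_eps_pure kmul1x ract_one.
- split=> [/rmult_inj|[y <-]]; first exact: (@tensl_bar_exact_aux 0).
  exact: (tensl_bar_eps_d y).
exact: (@tensl_bar_exact_aux n.+1).
Qed.

(** [Tor_eq0] speaks of some resolution [P] of [M]. The comparison maps between [P] and [X], and the
    homotopy on [X], are right linear, so tensoring with [N] transfers the vanishing to [C]. *)
Lemma Tor_exact i : Tor_eq0 i.+1 M N -> projective_module M -> projective_module S ->
  forall x, cd C i x = 0 -> exists y, cd C i.+1 y = x.
Proof.
move=> [P [eps [Pres Ph]]] Mp Sp x xd.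
have Xres := tensl_bar_resolution Mp Sp.
have [u ue] := resolution_cmap Xres Pres (fun _ => id).
have [v ve] := resolution_cmap Pres Xres (fun _ => id).
have [||h [_ hd]] := @resolution_homotopic _ _ _ _ _ _ _ _ (compcm v u) (idcm _) _ Xres.
- by case: Xres.
- by move=> z; exact: (etrans (ve (u 0%N z)) (ue z)).
have rU n (p : X n) s : u n (ract p s) = ract (u n p) s by exact: (bh_r (u n)).
have rV n (p : P n) s : v n (ract p s) = ract (v n p : X n) s by exact: (bh_r (v n)).
have rH n (p : X n) s : h n (ract p s) = ract (h n p : X n.+1) s by exact: (bh_r (h n)).
pose U n := tfunr (N := N) (u n : X n -> P n).
pose V n := tfunr (N := N) (v n : P n -> X n).
pose H n := tfunr (N := N) (h n : X n -> X n.+1).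
have uL n : linear_fun (u n : X n -> P n) by exact: (bh_lin (u n)).
have vL n : linear_fun (v n : P n -> X n) by exact: (bh_lin (v n)).
have hL n : linear_fun (h n : X n -> X n.+1) by exact: (bh_lin (h n)).
have Ul n : linear_fun (U n) := @tfunr_lin K _ _ _ _ (X n) (P n) N _ (uL n) (rU n).
have Vl n : linear_fun (V n) := @tfunr_lin K _ _ _ _ (P n) (X n) N _ (vL n) (rV n).
have Hl n : linear_fun (H n) := @tfunr_lin K _ _ _ _ (X n) (X n.+1) N _ (hL n) (rH n).
have Up n (p : X n) m : U n (tpure p m) = tpure (u n p) m
  := @tfunr_pure K _ _ _ _ (X n) (P n) N _ (uL n) (rU n) p m.
have Vp n (p : P n) m : V n (tpure p m) = tpure (v n p : X n) m
  := @tfunr_pure K _ _ _ _ (P n) (X n) N _ (vL n) (rV n) p m.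
have Hp n (p : X n) m : H n (tpure p m) = tpure (h n p : X n.+1) m
  := @tfunr_pure K _ _ _ _ (X n) (X n.+1) N _ (hL n) (rH n) p m.
have hd' n (p : X n.+1) : (v n.+1 (u n.+1 p) : X n.+1) - p =
    cd X n.+1 (h n.+1 p : X n.+2) + (h n (cd X n p) : X n.+1) by exact: (hd n p).
have dU n z : U n (cd C n z) = cd (tensr P N) n (U n.+1 z).
  apply: (tens_ext (f := fun z => U n (cd C n z)) 
    (g := fun z => cd (tensr P N) n (U n.+1 z))) z => [||p m].
  - exact: (linear_fun_comp (Ul n) (bh_lin _)).
  - exact: (linear_fun_comp (bh_lin _) (Ul n.+1)).
  rewrite [cd C n _]tmap_pure !Up [RHS]tmap_pure; congr tpure; exact: (cm_d u).
have dV n z : V n (cd (tensr P N) n z) = cd C n (V n.+1 z).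
  apply: (tens_ext (f := fun z => V n (cd (tensr P N) n z)) 
    (g := fun z => cd C n (V n.+1 z))) z => [||p m].
  - exact: (linear_fun_comp (Vl n) (bh_lin _)).
  - exact: (linear_fun_comp (bh_lin _) (Vl n.+1)).
  rewrite [cd _ n _]tmap_pure !Vp [RHS]tmap_pure; congr tpure; exact: (cm_d v).
have VU n z : V n.+1 (U n.+1 z) = z + (cd C n.+1 (H n.+1 z) + H n (cd C n z)).
  apply: (tens_ext (f := fun z => V n.+1 (U n.+1 z))
    (g := fun z => z + (cd C n.+1 (H n.+1 z) + H n (cd C n z)))) z => [|k y z|p m].
  - exact: (linear_fun_comp (Vl _) (Ul _)).
  - rewrite Hl !bh_lin Hl !scalerDr; zmod.
  rewrite Up Vp Hp ![cd C _ _]tmap_pure Hp.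
  rewrite -!(lfD (@tpure_linl _ _ _ _ (X n.+1) N _)); congr tpure.
  by rewrite -hd' addrC subrK.
have [y yP] : exists y, cd (tensr P N) i.+1 y = U i.+1 x.
  have cU : cyc (tensr P N) i.+1 (U i.+1 x).
    by rewrite /= -[LHS]/(cd (tensr P N) i _) -dU xd (lf0 (Ul i)).
  by have := Ph (hcl _ _ (U i.+1 x)); rewrite hcl_eq0.
(* Solve V U x = x + d H x + H d x for [x], where d x = 0 and V U x = V (d y) = d (V y). *)
exists (V i.+2 y - H i.+1 x).
by rewrite (lfB (bh_lin _)) -dV yP VU xd (lf0 (Hl i)) addr0 addrK.
Qed.

(** Right exactness, by an explicit inverse: m (x) n |-> class of m (x) (1 (x) 1) (x) n is a
    well-defined map [tlin s] into the cokernel of the differential, and following the augmentation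
    by it gives the quotient map. *)
Lemma bar_tens_exact0 x :
  tmap tensl_bar_eps (idbh N) x = 0 -> exists y, cd C 0%N y = x.
Proof.
move=> x0; pose Q := quoM (bnd C 0%N).
pose cls z : Q := (\pi_(quoM (bnd C 0%N)) z)%qT.
have cl : linear_fun cls by move=> k u v; rewrite /cls pi_qadd pi_qscale.
pose one m : X 0%N := tpure m (@lpure _ _ (reg S) (kone S) (kone S)).
pose s m n : Q := cls (tpure (one m) n).
have sb : balanced s.
  split; first split=> [n|m].
  - apply: (linear_fun_comp cl); apply: (linear_fun_comp (@tpure_linl _ _ _ _ (X 0%N) N n)).
    exact: (@tpure_linl _ _ _ _ M (bar S 0%N)).
  - exact: (linear_fun_comp cl (@tpure_linr _ _ _ _ (X 0%N) N (one m))).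
  move=> m a n; apply/quoM_eq.
  (* The bar element 1 (x) a (x) 1 has boundary a (x) 1 - 1 (x) a, which moves [a] from [m] to
     [n]. *)
  exists (tpure (tpure m (lpure (kone S) (@lpure _ _ (reg S) a (kone S))) : X 1%N) n).
  rewrite [LHS]tmap_pure [cd X 0%N _]tmap_pure [cd (bar S) 0%N _]bard_pure.
  rewrite lact_one [bard S 0 _]bard0_pure kmulx1.
  rewrite (lfB (@tpure_linr _ _ _ _ M (bar S 0%N) _)) (lfB (@tpure_linl _ _ _ _ (X 0%N) N _)).
  congr (_ - _).
    by rewrite /one tpure_bal lact_lpure kmulx1.
  rewrite -tpure_bal /one ract_tpure; congr tpure; congr tpure.
  by rewrite ract_lpure /= kmul1x.
have E z : tlin s (tmap tensl_bar_eps (idbh N) z) = cls z.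
  apply: (tens_ext (f := fun z => tlin s (tmap tensl_bar_eps (idbh N) z))) z => [||z n].
  - exact: (linear_fun_comp (tlin_lin sb) (bh_lin _)).
  - exact: cl.
  rewrite tmap_pure (tlin_pure _ _ sb).
  have sl : linear_fun (s^~ n) by case: sb => [[h _] _]; exact: h.
  apply: (tens_ext (f := fun z => s (tensl_bar_eps z) n) 
    (g := fun z => cls (tpure z n))) z => [||m p].
  - exact: (linear_fun_comp sl (bh_lin _)).
  - exact: (linear_fun_comp cl (@tpure_linl _ _ _ _ (X 0%N) N n)).
  rewrite tensl_bar_epsE.
  apply: (ltens_ext (f := fun p => s (ract m (bard S 0 p)) n)
    (g := fun p => cls (tpure (tpure m p : X 0%N) n))) p => [||a b].
  - apply: (linear_fun_comp sl); apply: (linear_fun_comp _ (bh_lin _)).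
    by have [_ h] := ract_bilinear M; exact: h.
  - apply: (linear_fun_comp cl); apply: (linear_fun_comp (@tpure_linl _ _ _ _ (X 0%N) N n)).
    exact: (@tpure_linr _ _ _ _ M (bar S 0%N)).
  rewrite bard0_pure ract_mul; case: sb => _ ->; rewrite /s -tpure_bal; congr cls; congr tpure.
  rewrite /one ract_tpure tpure_bal; congr tpure.
  by rewrite ract_lpure lact_lpure kmulx1 /= kmul1x.
have : cls x = 0 by rewrite -E x0 (lf0 (tlin_lin sb)).
rewrite -[RHS](lf0 cl) => /quoM_eq; by rewrite subr0.
Qed.

Lemma aug3E (V : bimod R T) (mu : bihom (tens M N) V) x :
  aug3 (bar_eps S) mu x = mu (tmap tensl_bar_eps (idbh N) x).
Proof. by []. Qed.

Lemma bar_tens_eps_d y : tmap tensl_bar_eps (idbh N) (cd C 0%N y) = 0.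
Proof.
apply: (tens_ext (f := fun y => tmap tensl_bar_eps (idbh N) (cd C 0%N y)) 
  (g := fun=> 0)) y => [|k u v|z n].
- exact: (linear_fun_comp (bh_lin _) (bh_lin _)).
- by rewrite scaler0 addr0.
rewrite [cd C 0%N _]tmap_pure tmap_pure tensl_bar_eps_d.
exact: (lf0 (@tpure_linl _ _ _ _ M N _)).
Qed.

(** The common source of [bar_AA_resolution] and [bar_BeB_resolution]: Tor vanishing gives exactness
    in positive degrees, and injectivity of [mu] identifies the homology in degree 0. *)
Lemma bar_tens_resolves (V : bimod R T) (mu : bihom (tens M N) V) (Y : V -> Prop) :
  injective mu -> (forall v, Y v <-> exists z, mu z = v) ->
  biprojective (res (id_hom R) (unit_hom S) M) ->
  biprojective (res (unit_hom S) (id_hom T) N) ->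
  projective_module M -> projective_module S ->
  (forall i, (0 < i)%N -> Tor_eq0 i M N) ->
  resolves (aug3 (bar_eps S) mu) Y.
Proof.
move=> mi mY Ml Nr Mp Sp tor; split=> [n|v|x|n x].
- apply/biprojective_res_id/tens_projr => //.
  by apply/biprojective_res_id/tens_projl => //; exact: barX_proj.
- rewrite mY; split=> [[z <-]|[x <-]]; last by exists (tmap tensl_bar_eps (idbh N) x).
  have [x <-] : exists x, tmap tensl_bar_eps (idbh N) x = z; last by exists x.
  elim/tens_ind: z => [|m n z [x <-]]; first by exists 0; rewrite (lf0 (bh_lin _)).
  exists (tpure (tpure m (@lpure _ _ (reg S) (kone S) (kone S)) : X 0%N) n + x).
  by rewrite (lfD (bh_lin _)) tmap_pure tensl_bar_eps_pure kmul1x ract_one.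
- split=> [x0|[y <-]].
    apply: bar_tens_exact0; apply: mi; rewrite (lf0 (bh_lin _)); exact: x0.
  by rewrite aug3E bar_tens_eps_d (lf0 (bh_lin _)).
by move=> x0; apply: Tor_exact => //; exact: tor.
Qed.

End TensoredBar.

(** * Bimodule maps out of M (x) X (x) N for cyclic M and N *)

Section Sandwich.
Variables (K : comPzRingType) (R S : kalg K) (M : bimod R S) (N : bimod S R).
Variables (kap : M -> R) (kap' : N -> R).
Hypotheses (kap_lin : linear_fun kap) (kap'_lin : linear_fun kap').
Hypothesis kap_l : forall x m, kap (lact x m) = x ** kap m.
Hypothesis kap'_r : forall n x, kap' (ract n x) = kap' n ** x.

Lemma tens3_ext (X : bimod S S) (W : lmodType K) (f g : tens (tens M X) N -> W) :
  linear_fun f -> linear_fun g ->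
  (forall m x n, f (tpure (tpure m x : tens M X) n) = g (tpure (tpure m x : tens M X) n)) ->
  forall z, f z = g z.
Proof.
move=> fl gl fg; apply: (tens_ext fl gl) => y n.
apply: (tens_ext (f := fun y => f (tpure y n)) (g := fun y => g (tpure y n))) => [||m x] //.
- exact: (linear_fun_comp fl (@tpure_linl _ _ _ _ (tens M X) N n)).
- exact: (linear_fun_comp gl (@tpure_linl _ _ _ _ (tens M X) N n)).
Qed.

Section Lift.
Variables (X : bimod S S) (W : bimod R R) (q : X -> W).
Hypothesis q_lin : linear_fun q.
Hypothesis q_l : forall m s x,
  lact (kap (ract m s)) (q x) = lact (kap m) (q (lact s x)).
Hypothesis q_r : forall x s n,
  ract (q (ract x s)) (kap' n) = ract (q x) (kap' (lact s n)).

Definition sandwichl : tens M X -> W := tlin (fun m x => lact (kap m) (q x)).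
Definition sandwich_fun : tens (tens M X) N -> W :=
  tlin (fun z n => ract (sandwichl z) (kap' n)).

Lemma sandwichl_balanced : balanced (fun m x => lact (kap m) (q x) : W).
Proof.
have [h1 h2] := lact_bilinear W; split; last exact: q_l.
split=> [x|m]; first exact: (linear_fun_comp (h1 (q x)) kap_lin).
exact: (linear_fun_comp (h2 (kap m)) q_lin).
Qed.

Lemma sandwichl_lin : linear_fun sandwichl.
Proof. exact: tlin_lin sandwichl_balanced. Qed.

Lemma sandwichl_pure m x : sandwichl (tpure m x) = lact (kap m) (q x).
Proof. exact: (tlin_pure _ _ sandwichl_balanced). Qed.

Lemma sandwich_balanced : balanced (fun (z : tens M X) n => ract (sandwichl z) (kap' n) : W).
Proof.
have [h1 h2] := ract_bilinear W; split.
  split=> [n|z]; first exact: (linear_fun_comp (h1 (kap' n)) sandwichl_lin).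
  exact: (linear_fun_comp (h2 (sandwichl z)) kap'_lin).
move=> z s n; apply: (tens_ext (f := fun z => ract (sandwichl (ract z s)) (kap' n))
  (g := fun z => ract (sandwichl z) (kap' (lact s n)))) z => [||m x].
- apply: (linear_fun_comp (h1 _)); apply: (linear_fun_comp sandwichl_lin).
  exact: ract_lin.
- exact: (linear_fun_comp (h1 _) sandwichl_lin).
by rewrite ract_tpure !sandwichl_pure !lract q_r.
Qed.

Lemma sandwich_fun_pure m x n : sandwich_fun (tpure (tpure m x : tens M X) n) =
  ract (lact (kap m) (q x)) (kap' n).
Proof. by rewrite /sandwich_fun (tlin_pure _ _ sandwich_balanced) sandwichl_pure. Qed.

Lemma sandwich_is_bihom : is_bihom sandwich_fun.
Proof.
have sl : linear_fun sandwich_fun by exact: (tlin_lin sandwich_balanced).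
split=> // [a z|z a].
  apply: (tens3_ext (f := fun z => sandwich_fun (lact a z))
    (g := fun z => lact a (sandwich_fun z))) z => [||m x n].
  - exact: (linear_fun_comp sl (lact_lin _)).
  - exact: (linear_fun_comp (lact_lin _) sl).
  by rewrite !lact_tpure !sandwich_fun_pure kap_l lact_mul lract.
apply: (tens3_ext (f := fun z => sandwich_fun (ract z a))
  (g := fun z => ract (sandwich_fun z) a)) z => [||m x n].
- exact: (linear_fun_comp sl (ract_lin _)).
- exact: (linear_fun_comp (ract_lin _) sl).
by rewrite !ract_tpure !sandwich_fun_pure kap'_r ract_mul.
Qed.

(* [m (x) x (x) n |-> kap m * q x * kap' n] *)
Definition sandwich : bihom (tens (tens M X) N) W := Bihom sandwich_is_bihom.

Lemma sandwich_pure m x n : sandwich (tpure (tpure m x : tens M X) n) =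
  ract (lact (kap m) (q x)) (kap' n).
Proof. exact: sandwich_fun_pure. Qed.

End Lift.

Section Adjunction.
Variables (u : M) (u' : N).
Hypothesis kap_u : forall m, lact (kap m) u = m.
Hypothesis kap'_u : forall n, ract u' (kap' n) = n.
Variables (V : bimod R R) (V0 : bimod S S) (j : V0 -> V) (r : V -> V0).
Hypotheses (j_lin : linear_fun j) (r_lin : linear_fun r).
Hypothesis rj : forall v, r (j v) = v.
Hypothesis jr : forall v, lact (kap u) v = v -> ract v (kap' u') = v -> j (r v) = v.
Hypothesis j_l : forall s v, lact (kap (ract u s)) (j v) = j (lact s v).
Hypothesis j_r : forall v s, ract (j v) (kap' (lact s u')) = j (ract v s).
Variable P : cplx S S.
Local Notation C := (tensr (tensl M P) N).

Let in3 n (x : P n) : C n := tpure (tpure u x : tensl M P n) u'.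

(** Restriction to [u] (x) x (x) [u']. The values lie in the part of [V] fixed by [kap u] and
    [kap' u'], for which [V0] is a model with inclusion [j] and retraction [r]. In one instance [V0]
    is [A] over [B], in the other [eBe] inside [B]. *)
Definition adj_fun n (F : C n -> V) : P n -> V0 := fun x => r (F (in3 x)).

Lemma adj_fun_lin n : linear_fun (@adj_fun n).
Proof. by move=> k F G; apply/funext => x; exact: r_lin. Qed.

Lemma in3_lin n : linear_fun (@in3 n).
Proof.
apply: (linear_fun_comp (@tpure_linl _ _ _ _ (tensl M P n) N u')).
exact: (@tpure_linr _ _ _ _ M (P n) u).
Qed.

Lemma in3_d n (x : P n.+1) : cd C n (in3 x) = in3 (cd P n x).
Proof. by rewrite [LHS]tmap_pure [cd (tensl M P) n _]tmap_pure. Qed.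

(** Since [u] and [u'] generate [M] and [N], a bimodule map is determined by [adj_fun]; this is the
    injectivity in the adjunction, while [coadj] gives surjectivity. *)
Lemma in3_gen n (F : C n -> V) m x p : is_bihom F ->
  F (tpure (tpure m x : tensl M P n) p) = ract (lact (kap m) (F (in3 x))) (kap' p).
Proof.
move=> [_ Fl Fr]; rewrite -Fl -Fr /in3.
rewrite [lact (kap m) _](@lact_tpure _ _ _ _ (tensl M P n) N).
rewrite [lact (kap m) _](@lact_tpure _ _ _ _ M (P n)) kap_u.
by rewrite [ract _ (kap' p)](@ract_tpure _ _ _ _ (tensl M P n) N) kap'_u.
Qed.

Lemma j_adj n (F : C n -> V) x : is_bihom F -> j (adj_fun F x) = F (in3 x).
Proof.
move=> Fh; have [_ Fl Fr] := Fh; apply: jr.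
  rewrite -Fl /in3 [lact (kap u) _](@lact_tpure _ _ _ _ (tensl M P n) N).
  by rewrite [lact (kap u) _](@lact_tpure _ _ _ _ M (P n)) kap_u.
by rewrite -Fr /in3 [ract _ _](@ract_tpure _ _ _ _ (tensl M P n) N) kap'_u.
Qed.

Lemma adj_bihom n (F : C n -> V) : is_bihom F -> is_bihom (adj_fun F).
Proof.
move=> Fh; have [Fl _ _] := Fh; split=> [k x y|s x|x s].
- by rewrite /adj_fun in3_lin Fl r_lin.
- rewrite -[RHS]rj -j_l j_adj // /adj_fun; congr r.
  have := in3_gen (ract u s) x u' Fh; rewrite (tpure_bal _ _ x) => E.
  rewrite /in3 E; have [_ _ Fr] := Fh.
  by rewrite lract -Fr /in3 [ract _ (kap' u')](@ract_tpure _ _ _ _ (tensl M P n) N) kap'_u.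
rewrite -[RHS]rj -j_r j_adj // /adj_fun; congr r.
have := in3_gen u x (lact s u') Fh; rewrite -(tpure_bal (tpure u x : tensl M P n)).
rewrite [ract _ s](@ract_tpure _ _ _ _ M (P n)) /in3 => ->; congr ract.
have [_ Fl' _] := Fh; rewrite -Fl' [lact _ _](@lact_tpure _ _ _ _ (tensl M P n) N).
by rewrite [lact _ _](@lact_tpure _ _ _ _ M (P n)) kap_u.
Qed.

Lemma adj_cocycle n F : ext_cocycle C V n F -> ext_cocycle P V0 n (adj_fun F).
Proof.
move=> [Fh Fd]; split=> [|x]; first exact: adj_bihom.
by rewrite /adj_fun -in3_d Fd (lf0 r_lin).
Qed.

Lemma adj_coboundary n F : ext_coboundary C V n F -> ext_coboundary P V0 n (adj_fun F).
Proof.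
case: n F => [|n] F /= => [->|[G [Gh ->]]].
  by apply/funext => x; exact: (lf0 r_lin).
exists (adj_fun G); split; first exact: adj_bihom.
by apply/funext => x; rewrite /adj_fun -in3_d.
Qed.

Lemma j_sandwich_l (W : bimod S S) (g : W -> V0) :
  is_bihom g -> forall m s x,
  lact (kap (ract m s)) (j (g x)) = lact (kap m) (j (g (lact s x))).
Proof.
move=> [_ gl _] m s x; rewrite gl -j_l -lact_mul -kap_l; congr (lact (kap _) _).
by rewrite -lract kap_u.
Qed.

Lemma j_sandwich_r (W : bimod S S) (g : W -> V0) :
  is_bihom g -> forall x s n,
  ract (j (g (ract x s))) (kap' n) = ract (j (g x)) (kap' (lact s n)).
Proof.
move=> [_ _ gr] x s n; rewrite gr -j_r -ract_mul -kap'_r; congr (ract _ (kap' _)).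
by rewrite lract kap'_u.
Qed.

Definition coadj n (g : P n -> V0) (gh : is_bihom g) : bihom (C n) V :=
  sandwich (linear_fun_comp j_lin (let: And3 gl _ _ := gh in gl))
    (j_sandwich_l gh) (j_sandwich_r gh).

Lemma coadj_pure n (g : P n -> V0) (gh : is_bihom g) m x p :
  coadj gh (tpure (tpure m x : tensl M P n) p) = ract (lact (kap m) (j (g x))) (kap' p).
Proof. exact: sandwich_pure. Qed.

Lemma adj_bij n : bijective (fun a : Ext C V n =>
  hcl (ext_cocycle P V0 n) (ext_coboundary P V0 n) (adj_fun (hrep a))).
Proof.
apply: (ind_bij (@adj_fun_lin n)); [exact: adj_cocycle|exact: adj_coboundary|..].
  case: n => [|n] F [Fh Fd] /= => [F0|[g [gh Fg]]].
    apply/funext => z; have [Fl _ _] := Fh.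
    apply: (tens3_ext (f := F) (g := 0)) z => // [k a b|m x p].
      by rewrite scaler0 addr0.
    have [h _] := ract_bilinear V.
    rewrite in3_gen // -j_adj // F0 (lf0 j_lin) (lf0 (lact_lin _)) (lf0 (h _)) //.
  exists (coadj gh); split; first exact: bhP.
  apply/funext => z; have [Fl _ _] := Fh.
  apply: (tens3_ext (f := F) (g := fun z => coadj gh (cd C n z))) z => // [|m x p].
    exact: (linear_fun_comp (bh_lin _) (bh_lin _)).
  rewrite in3_gen // -j_adj // Fg [cd C n _]tmap_pure [cd (tensl M P) n _]tmap_pure.
  by rewrite coadj_pure.
move=> g [gh gd]; have gl : linear_fun g by case: gh.
exists (bh (coadj gh)).
  split=> [|z]; first exact: bhP.
  apply: (tens3_ext (f := fun z => coadj gh (cd C n z)) (g := fun=> 0)) z => [|k a b|m x p].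
  - exact: (linear_fun_comp (bh_lin _) (bh_lin _)).
  - by rewrite scaler0 addr0.
  have [h _] := ract_bilinear V.
  rewrite [cd C n _]tmap_pure [cd (tensl M P) n _]tmap_pure coadj_pure gd.
  by rewrite (lf0 j_lin) (lf0 (lact_lin _)) (lf0 (h _)).
rewrite (_ : adj_fun (coadj gh) = g) ?subrr; first exact: sm_0.
apply/funext => x; rewrite /adj_fun /in3 coadj_pure -[u in kap u](ract_one u) j_l.
by rewrite lact_one -[u' in kap' u'](lact_one u') j_r ract_one rj.
Qed.

Lemma adj_hcl n F : ext_cocycle C V n F ->
  hcl (ext_cocycle P V0 n) (ext_coboundary P V0 n)
    (adj_fun (hrep (hcl _ _ F : Ext C V n))) = hcl _ _ (adj_fun F).
Proof.
apply: (ind_hcl (@adj_fun_lin n)); [exact: adj_cocycle|exact: adj_coboundary].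
Qed.

Lemma adj_linear n : linear_fun (fun a : Ext C V n =>
  hcl (ext_cocycle P V0 n) (ext_coboundary P V0 n) (adj_fun (hrep a))).
Proof.
apply: (ind_lin (@adj_fun_lin n)); [exact: adj_cocycle|exact: adj_coboundary].
Qed.

End Adjunction.
End Sandwich.

(** * Quotient algebras *)

Section QuotientPart.
Variables (K : comPzRingType) (B A : kalg K) (pi : alghom B A).
Hypothesis pi_surj : forall a, exists b, pi b = a.
Hypotheses (B_proj : projective_module B) (A_proj : projective_module A).

Let pil : linear_fun pi := ah_linear pi.

Lemma bar_AA_resolution :
  (forall i, (0 < i)%N -> Tor_eq0 i (AB pi) (BA pi)) ->
  projective_resolution (bar_AA_eps pi).
Proof.
move=> tor; apply: bar_tens_resolves => //.
(* As [pi] is surjective, any right factor comes from [B] and can be moved to the left, so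
   multiplication on the tensor square of [A] over [B] is injective. *)
- have E z : z = tpure (mul_AB_BA pi z : AB pi) (kone A : BA pi).
    apply: (tens_ext (f := id) 
      (g := fun z => tpure (mul_AB_BA pi z : AB pi) (kone A : BA pi))) z => // [|m n].
      exact: (linear_fun_comp (@tpure_linl _ _ _ _ (AB pi) (BA pi) _) (bh_lin (mul_AB_BA pi))).
    have [b bn] := pi_surj n; rewrite [mul_AB_BA pi _]tlift_pure.
    have -> : n = lact b (kone A : BA pi) by rewrite /= kmulx1.
    by rewrite -tpure_bal /= kmulx1.
  by move=> x y xy; rewrite (E x) (E y) xy.
- move=> v; split=> // _; exists (tpure (v : AB pi) (kone A : BA pi)).
  by rewrite [LHS]tlift_pure /= kmulx1.
- by apply: (cyclic_projl (u := kone A : AB pi) (kap := id)) => // m; exact: kmulx1.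
by apply: (cyclic_projr (u := kone A : BA pi) (kap := id)) => // m; exact: kmul1x.
Qed.

Lemma AA_l n m s (x : bar B n) :
  lact (id (ract (m : AB pi) s)) (barmap pi x : bar A n) =
  lact (id m) (barmap pi (lact s x)).
Proof. by rewrite (@barmap_lact _ _ _ _ pil (ah_mul pi) n.+1) -lact_mul. Qed.

Lemma AA_r n (x : bar B n) s m :
  ract (barmap pi (ract x s) : bar A n) (id m) =
  ract (barmap pi x : bar A n) (id (lact s (m : BA pi))).
Proof. by rewrite (@barmap_ract _ _ _ _ pil (ah_mul pi) n.+1) -ract_mul. Qed.

(** The comparison map a (x) x (x) a' |-> a pi(x) a'. Being explicit, it lets [restrict] be computed
    on cochains. *)
Definition phi_AA n : bihom (bar_AA pi n) (bar A n) :=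
  sandwich (M := AB pi) (N := BA pi) (kap := id) (kap' := id)
    (@id_linear _ A) (@id_linear _ A) (fun _ _ => erefl) (fun _ _ => erefl)
    (@barmap_lin _ _ _ _ pil n.+1) (@AA_l n) (@AA_r n).

Lemma phi_AA_pure n m (x : bar B n) p :
  phi_AA n (tpure (tpure (m : AB pi) x : tensl (AB pi) (bar B) n) (p : BA pi)) =
  ract (lact m (barmap pi x : bar A n)) p.
Proof. exact: sandwich_pure. Qed.

Lemma phi_AA_d n x : phi_AA n (cd (bar_AA pi) n x) = cd (bar A) n (phi_AA n.+1 x).
Proof.
apply: (tens3_ext (f := fun x => phi_AA n (cd (bar_AA pi) n x))
  (g := fun x => cd (bar A) n (phi_AA n.+1 x))) x => [||m x p].
- exact: (linear_fun_comp (bh_lin _) (bh_lin _)).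
- exact: (linear_fun_comp (bh_lin _) (bh_lin _)).
rewrite [cd (bar_AA pi) n _]tmap_pure [cd (tensl _ _) n _]tmap_pure !phi_AA_pure.
by rewrite bh_r bh_l; congr (ract (lact _ _) _); exact: (barmap_bard pil (ah_mul pi)).
Qed.

Definition phi_cmap : cmap (bar_AA pi) (bar A) := Cmap phi_AA_d.

Lemma phi_AA_eps z : bar_eps A (phi_cmap 0%N z) = bar_AA_eps pi z.
Proof.
apply: (tens3_ext (f := fun z => bar_eps A (phi_AA 0%N z)) (g := bar_AA_eps pi)) z => [||m x p].
- exact: (linear_fun_comp (bh_lin _) (bh_lin _)).
- exact: (bh_lin _).
rewrite phi_AA_pure bh_r bh_l [bar_AA_eps pi _]aug3E tmap_pure tensl_bar_epsE.
rewrite [RHS]tlift_pure /=; congr (_ ** _ ** _).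
exact/esym/(@barmap_bard _ _ _ _ pil (ah_mul pi) 0).
Qed.

Lemma adj_AA_bij n : bijective (@adj_AA K B A pi n).
Proof.
apply: (@adj_bij K A B (AB pi) (BA pi) id id _ _ _ _ (kone A) (kone A) _ _
  (reg A) (BAB pi) id id) => //.
- exact: kmulx1.
- exact: kmul1x.
- by move=> s v /=; rewrite kmul1x.
- by move=> v s /=; rewrite kmulx1.
Qed.

Lemma adj_AA_hcl n F : ext_cocycle (bar_AA pi) (reg A) n F ->
  adj_AA (hcl _ _ F : Ext (bar_AA pi) (reg A) n) =
  hcl _ _ (fun x : bar B n =>
    F (tpure (tpure (kone A : AB pi) x : tensl (AB pi) (bar B) n) (kone A : BA pi))).
Proof.
apply: (@adj_hcl K A B (AB pi) (BA pi) id id (kone A) (kone A) _ _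
  (reg A) (BAB pi) id id) => //.
- exact: kmulx1.
- exact: kmul1x.
- by move=> s v /=; rewrite kmul1x.
- by move=> v s /=; rewrite kmulx1.
Qed.

Lemma adj_AA_lin n : linear_fun (@adj_AA K B A pi n).
Proof.
apply: (@adj_linear K A B (AB pi) (BA pi) id id (kone A) (kone A) _ _
  (reg A) (BAB pi) id id) => //.
- exact: kmulx1.
- exact: kmul1x.
- by move=> s v /=; rewrite kmul1x.
- by move=> v s /=; rewrite kmulx1.
Qed.

Lemma adj_AA_cocycle n F : ext_cocycle (bar_AA pi) (reg A) n F ->
  ext_cocycle (bar B) (BAB pi) n (fun x : bar B n =>
    F (tpure (tpure (kone A : AB pi) x : tensl (AB pi) (bar B) n) (kone A : BA pi))).
Proof.
apply: (@adj_cocycle K A B (AB pi) (BA pi) id id (kone A) (kone A) _ _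
  (reg A) (BAB pi) id id) => //.
- exact: kmulx1.
- exact: kmul1x.
- by move=> s v /=; rewrite kmul1x.
- by move=> v s /=; rewrite kmulx1.
Qed.

Definition restrict n (a : Ext (bar A) (reg A) n) : HH (BAB pi) n :=
  ext_to_HH (adj_AA (ext_pull (phi_cmap n) a)).

(** [phi_AA] takes 1 (x) word (x) 1 to the image word under [pi], so the three identifications
    amount to precomposition with [pi]. *)
Lemma restrict_hcl n F : ext_cocycle (bar A) (reg A) n F ->
  restrict (hcl _ _ F) = hcl _ _ (fun s => bar_ev F (map pi s)).
Proof.
move=> ZF; have ZF' := pull_cocycle (cmap_compatible phi_cmap n) ZF.
rewrite /restrict (ext_pull_hcl (cmap_compatible phi_cmap n)) //.
rewrite adj_AA_hcl // ext_to_HH_hcl; last exact: (adj_AA_cocycle ZF').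
congr hcl; apply/funext => s; rewrite /bar_ev size_map; case: eqP => // ss.
rewrite [phi_cmap n]/(phi_AA n) phi_AA_pure lact_one ract_one.
rewrite (@barmap_word _ _ _ _ pil n.+1); last by rewrite /= ss.
by rewrite ah_one ract_one /= ah_one.
Qed.

Lemma restrict_lin n : linear_fun (@restrict n).
Proof.
apply: (linear_fun_comp (@ext_to_HH_lin _ _ _ n)).
apply: (linear_fun_comp (@adj_AA_lin n)).
exact: (ext_pull_lin (cmap_compatible phi_cmap n)).
Qed.

End QuotientPart.

(** * Transport of long exact sequences along isomorphisms *)

Lemma can_linear (K : comPzRingType) (U V : lmodType K) (h : U -> V) (h' : V -> U) :
  cancel h h' -> cancel h' h -> linear_fun h -> linear_fun h'.
Proof. by move=> hK h'K hl k u v; rewrite -{1}[u]h'K -{1}[v]h'K -hl hK. Qed.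

Lemma bijective_family (T U : nat -> Type) (f : forall n, T n -> U n) :
  (forall n, bijective (f n)) -> exists g : forall n, U n -> T n,
    (forall n, cancel (f n) (g n)) /\ (forall n, cancel (g n) (f n)).
Proof.
move=> fb; have inv n : exists g, cancel (f n) g /\ cancel g (f n).
  by have [g h1 h2] := fb n; exists g.
by exists (fun n => sval (cid (inv n))); split=> n; case: (svalP (cid (inv n))).
Qed.

(** [xi] runs from the new terms to the old ones, against [eta] and [zeta]: the new first map then
    contains no inverse and can be matched with the map of the statement. *)
Lemma long_exact_iso (K : comPzRingType) (X X' Y Y' Z Z' : nat -> lmodType K)
    (f : forall n, X n -> Y n) (g : forall n, Y n -> Z n) (d : forall n, Z n -> X n.+1)
    (xi : forall n, X' n -> X n) (xi' : forall n, X n -> X' n)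
    (eta : forall n, Y n -> Y' n) (eta' : forall n, Y' n -> Y n)
    (zeta : forall n, Z n -> Z' n) (zeta' : forall n, Z' n -> Z n) :
  (forall n, cancel (xi n) (xi' n)) -> (forall n, cancel (xi' n) (xi n)) ->
  (forall n, cancel (eta n) (eta' n)) -> (forall n, cancel (eta' n) (eta n)) ->
  (forall n, cancel (zeta n) (zeta' n)) -> (forall n, cancel (zeta' n) (zeta n)) ->
  (forall n, linear_fun (xi n)) -> (forall n, linear_fun (eta n)) ->
  (forall n, linear_fun (zeta n)) ->
  long_exact f g d ->
  long_exact (fun n x => eta n (f n (xi n x))) (fun n y => zeta n (g n (eta' n y)))
    (fun n z => xi' n.+1 (d n (zeta' n z))).
Proof.
move=> xiK xi'K etaK eta'K zetaK zeta'K xil etal zetal [lin f0 ey ez ex].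
have xi'l n := can_linear (xiK n) (xi'K n) (xil n).
have eta'l n := can_linear (etaK n) (eta'K n) (etal n).
have zeta'l n := can_linear (zetaK n) (zeta'K n) (zetal n).
have eq0 (U V : lmodType K) (h : U -> V) (h' : V -> U) u :
    cancel h h' -> linear_fun h -> (h u = 0 <-> u = 0).
  move=> hK hl; split=> [h0|->]; last exact: lf0.
  by apply: (can_inj hK); rewrite h0 (lf0 hl).
split.
- move=> n; have [fl gl dl] := lin n; split.
  + exact: (linear_fun_comp (etal n) (linear_fun_comp fl (xil n))).
  + exact: (linear_fun_comp (zetal n) (linear_fun_comp gl (eta'l n))).
  exact: (linear_fun_comp (xi'l n.+1) (linear_fun_comp dl (zeta'l n))).
- move=> x y /(can_inj (etaK _)) /f0; exact: (can_inj (xiK _)).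
- move=> n y; rewrite (eq0 _ _ _ _ _ (zetaK n)) // ey; split=> [[x fx]|[x <-]].
    by exists (xi' n x); rewrite xi'K fx eta'K.
  by exists (xi n x); rewrite etaK.
- move=> n z; rewrite (eq0 _ _ _ _ _ (xi'K n.+1)) // ez; split=> [[y gy]|[y <-]].
    by exists (eta n y); rewrite etaK gy zeta'K.
  by exists (eta' n y); rewrite zetaK.
move=> n x; rewrite (eq0 _ _ _ _ _ (etaK n.+1)) // ex; split=> [[z dz]|[z <-]].
  by exists (zeta n z); rewrite zetaK dz xiK.
by exists (zeta' n z); rewrite xi'K.
Qed.

Lemma eq_long_exact (K : comPzRingType) (X Y Z : nat -> lmodType K)
    (f f' : forall n, X n -> Y n) (g g' : forall n, Y n -> Z n)
    (d d' : forall n, Z n -> X n.+1) :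
  (forall n x, f n x = f' n x) -> (forall n y, g n y = g' n y) ->
  (forall n z, d n z = d' n z) -> long_exact f g d -> long_exact f' g' d'.
Proof.
move=> ff gg dd; have -> : f = f' by apply/functional_extensionality_dep => n; apply/funext.
have -> : g = g' by apply/functional_extensionality_dep => n; apply/funext.
by have -> : d = d' by apply/functional_extensionality_dep => n; apply/funext.
Qed.

Lemma linear_section (K : comPzRingType) (U V : lmodType K) (f : U -> V) :
  projective_module V -> linear_fun f -> (forall v, exists u, f u = v) ->
  exists s : V -> U, linear_fun s /\ forall v, f (s v) = v.
Proof.
move=> Vp fl fs; pose fL := GRing.isLinear.Build K U V *:%R f fl.
pose f' : {linear U -> V} := HB.pack f fL.
have [h hP] := Vp U V f' idfun fs.
by exists h; split=> [k u v|v]; [rewrite linearP|exact: hP].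
Qed.

(** * The long exact sequence of a K-split sequence of coefficients *)

Section CoefficientSequence.
Variables (K : comPzRingType) (B : kalg K) (M1 M M2 : bimod B B).
Variables (i : M1 -> M) (p : M -> M2) (s : M2 -> M) (r : M -> M1).
Hypotheses (ih : is_bihom i) (ph : is_bihom p) (sl : linear_fun s) (rl : linear_fun r).
Hypotheses (ps : forall x, p (s x) = x) (ri : forall x, r (i x) = x).
Hypothesis ir : forall x, i (r x) = x - s (p x).
Hypothesis pi0 : forall x, p (i x) = 0.
Local Notation Z := hh_cocycle.
Local Notation D := hh_coboundary.

Let il : linear_fun i. Proof. by case: ih. Qed.
Let pl : linear_fun p. Proof. by case: ph. Qed.

Lemma map_cochain (U V : bimod B B) (u : U -> V) n (f : seq B -> U) :
  linear_fun u -> is_cochain n f -> is_cochain n (fun t => u (f t) : V).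
Proof.
move=> ul [f0 fl]; split=> [t tn|s1 s2 k x y]; first by rewrite f0 // (lf0 ul).
by rewrite fl ul.
Qed.

Lemma map_hdiff (U V : bimod B B) (u : U -> V) (f : seq B -> U) :
  is_bihom u -> hdiff (fun t => u (f t) : V) = fun t => u (hdiff f t).
Proof.
move=> [ul uL uR]; apply/funext => t.
have := @hdiff_map _ B B U V id u f t (@id_linear _ B) ul (fun _ _ => erefl).
rewrite !map_id => ->; last 2 first.
- by move=> x v; rewrite map_id; exact: uL.
- by move=> x v; rewrite map_id; exact: uR.
by congr hdiff; apply/funext => v; rewrite map_id.
Qed.

Lemma map_lin (U V : bimod B B) (u : U -> V) : linear_fun u ->
  linear_fun (fun f : seq B -> U => (fun t => u (f t)) : seq B -> V).
Proof. by move=> ul k f g; apply/funext => t; exact: ul. Qed.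

Lemma map_cocycle (U V : bimod B B) (u : U -> V) n (f : seq B -> U) :
  is_bihom u -> Z U n f -> Z V n (fun t => u (f t) : V).
Proof.
move=> uh [fc fd]; have [ul _ _] := uh; split; first exact: map_cochain.
by rewrite map_hdiff // fd; apply/funext => t; exact: lf0.
Qed.

Lemma map_coboundary (U V : bimod B B) (u : U -> V) n (f : seq B -> U) :
  is_bihom u -> D U n f -> D V n (fun t => u (f t) : V).
Proof.
move=> uh; have [ul _ _] := uh; case: n => [|n] /= => [->|[g [gc ->]]].
  by apply/funext => t; exact: lf0.
by exists (fun t => u (g t)); split; [exact: map_cochain|rewrite map_hdiff].
Qed.

Lemma HH_map_hcl (U V : bimod B B) (u : U -> V) n (f : seq B -> U) :
  is_bihom u -> Z U n f ->
  HH_map u (hcl _ _ f : HH U n) = hcl (Z V n) (D V n) (fun t => u (f t)).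
Proof.
move=> uh; have [ul _ _] := uh; apply: (ind_hcl (map_lin ul)) => f' ?.
  exact: map_cocycle.
exact: map_coboundary.
Qed.

Lemma HH_map_lin (U V : bimod B B) (u : U -> V) n : is_bihom u ->
  linear_fun (@HH_map K B U V u n).
Proof.
move=> uh; have [ul _ _] := uh; apply: (ind_lin (map_lin ul)) => f' ?.
  exact: map_cocycle.
exact: map_coboundary.
Qed.

(** The snake construction with the [K]-linear splittings as lifts. It is defined, and linear, on
    all functions; [i_conn] shows that [r] loses nothing on cocycles. *)
Definition conn (f : seq B -> M2) : seq B -> M1 :=
  fun t => r (hdiff (fun t => s (f t) : M) t).

Lemma conn_lin : linear_fun (conn : _ -> seq B -> M1).
Proof.
move=> k f g; apply/funext => t; rewrite -[RHS]/(k *: conn f t + conn g t) /conn -rl.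
by rewrite -hdiff_lfun; congr (r (hdiff _ t)); apply/funext => v; exact: sl.
Qed.

Lemma i_conn n f : Z M2 n f -> forall t, i (conn f t) = hdiff (fun t => s (f t) : M) t.
Proof.
move=> [fc fd] t; rewrite ir -[p _](congr1 (fun h => h t) (map_hdiff _ ph)).
rewrite (_ : (fun t => p (s (f t))) = f); last by apply/funext => v; rewrite ps.
by rewrite fd -[(0 : seq B -> M2) t]/(0 : M2) (lf0 sl) subr0.
Qed.

Lemma i_inj : injective i. Proof. exact: (can_inj ri). Qed.

Lemma hdiff_i (f : seq B -> M1) t : i (hdiff f t) = hdiff (fun t => i (f t) : M) t.
Proof. by rewrite map_hdiff. Qed.

Lemma conn_cocycle n f : Z M2 n f -> Z M1 n.+1 (conn f).
Proof.
move=> zf; split.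
  by apply: map_cochain => //; apply/hdiff_cochain/map_cochain => //; case: zf.
apply/funext => t; apply: i_inj; rewrite hdiff_i.
rewrite (_ : (fun t => _) = hdiff (fun t => s (f t) : M)); last first.
  by apply/funext => v; rewrite (i_conn zf).
by rewrite hdiff_hdiff; exact/esym/(lf0 il).
Qed.

(* If [f] is a cochain of [M] and [p f] a cocycle then [conn (p f)] is
   cohomologous to the lift of [hdiff f] to [M1]. *)
Lemma conn_lift n (f : seq B -> M) (g : seq B -> M1) :
  is_cochain n f -> (forall t, hdiff f t = i (g t)) ->
  Z M2 n (fun t => p (f t)) /\ D M1 n.+1 (conn (fun t => p (f t)) - g).
Proof.
move=> fc fg.
have zp : Z M2 n (fun t => p (f t)).
  split; first exact: map_cochain.
  by rewrite map_hdiff //; apply/funext => t; rewrite fg pi0.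
split=> //; exists (-1 *: (fun t => r (f t) : M1) + 0); split.
  by apply: is_cochain_lin; [exact: map_cochain|exact: is_cochain_0].
apply/funext => t; apply: i_inj; rewrite -[i (_ t)]/(i (_ - _)) (lfB il) (i_conn zp) -fg.
rewrite hdiff_i (_ : (fun t => i _) = -1 *: (f - (fun t => s (p (f t)))) + 0); last first.
  by apply/funext => v; rewrite -[LHS]/(i (-1 *: r (f v) + 0)) !addr0 (lfZ il) ir.
rewrite hdiff_lin hdiffB hdiff_0 addr0 scaleN1r opprB; reflexivity.
Qed.

Lemma conn_coboundary n f : D M2 n f -> D M1 n.+1 (conn f).
Proof.
case: n => [|n] /= => [->|[h [hc fh]]].
  rewrite (lf0 conn_lin); exists 0; split; first exact: is_cochain_0.
  by rewrite hdiff_0.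
have Fc : is_cochain n.+1 (hdiff (fun t => s (h t) : M)) by apply/hdiff_cochain/map_cochain.
have [|_] := @conn_lift n.+1 _ 0 Fc.
  by move=> t; rewrite hdiff_hdiff; exact/esym/(lf0 il).
rewrite (_ : (fun t => p _) = f) ?subr0 //; apply/funext => t.
rewrite -[LHS](congr1 (fun h => h t) (map_hdiff _ ph)) fh.
by congr (hdiff _ t); apply/funext => v; rewrite ps.
Qed.

Definition conn_HH n (x : HH M2 n) : HH M1 n.+1 := hcl _ _ (conn (hrep x)).

Lemma conn_HH_hcl n f : Z M2 n f ->
  conn_HH (hcl _ _ f : HH M2 n) = hcl (Z M1 n.+1) (D M1 n.+1) (conn f).
Proof. by apply: (ind_hcl conn_lin) => ?; [exact: conn_cocycle|exact: conn_coboundary]. Qed.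

Lemma conn_HH_lift n (f : seq B -> M) (g : seq B -> M1) :
  is_cochain n f -> is_cochain n.+1 g -> hdiff f = (fun t => i (g t)) ->
  conn_HH (hcl _ _ (fun t => p (f t)) : HH M2 n) = hcl (Z M1 n.+1) (D M1 n.+1) g.
Proof.
move=> fc gc fg; have [|zp dp] := @conn_lift n f g fc; first by move=> t; rewrite fg.
rewrite conn_HH_hcl //; apply/hcl_eq => //; first exact: conn_cocycle.
split=> //; apply/funext => t; apply: i_inj; rewrite hdiff_i -fg hdiff_hdiff.
exact/esym/(lf0 il).
Qed.

Lemma HH_long_exact : long_exact (fun n => @HH_map K B M1 M i n)
  (fun n => @HH_map K B M M2 p n) conn_HH.
Proof.
split.
- move=> n; split; [exact: HH_map_lin|exact: HH_map_lin|].
  by apply: (ind_lin conn_lin) => ?; [exact: conn_cocycle|exact: conn_coboundary].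
- move=> x y; have [f zf ->] := hclW x; have [g zg ->] := hclW y.
  rewrite !HH_map_hcl //; move/hcl_eq => /(_ (map_cocycle ih zf) (map_cocycle ih zg)) /= fg.
  congr hcl; apply/funext => t; apply: i_inj; apply/eqP; rewrite -subr_eq0; apply/eqP.
  exact: (congr1 (fun h => h t) fg).
- move=> n y; split=> [|[x <-]]; last first.
    have [g zg ->] := hclW x; rewrite !HH_map_hcl //; last exact: map_cocycle.
    by rewrite (_ : (fun t => _) = 0) ?hcl0 //; apply/funext => t; rewrite pi0.
  have [f zf ->] := hclW y; rewrite HH_map_hcl // => /hcl_eq0 => /(_ (map_cocycle ph zf)) dpf.
  (* A primitive [w] of [p f] is lifted by [s]; subtracting the differential of the lift makes the
     cocycle vanish under [p], so it comes from [M1]. In degree 0 the cochain [p f] is already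
     zero. *)
  have [h zh [dh h0]] : exists2 h, Z M n h & D M n (h - f) /\ forall t, p (h t) = 0.
    case: n f zf {y} dpf => [|n] f zf /= dpf.
      by exists f => //; split=> [|t]; [rewrite subrr|exact: (congr1 (fun h => h t) dpf)].
    have [w [wc pf]] := dpf; pose c := hdiff (fun t => s (w t) : M).
    have dc : D M n.+1 c by exists (fun t => s (w t)); split=> //; exact: map_cochain.
    exists (f - c); first by apply: (smB (P := Z M n.+1)) => //; exact: coboundary_cocycle.
    split=> [|t]; first by rewrite addrAC subrr add0r; exact: (smN (P := D M n.+1)).
    rewrite -[(f - c) t]/(f t - c t) (lfB pl) -[p (c t)](congr1 (fun h => h t) (map_hdiff _ ph)).
    rewrite (_ : (fun t => p (s (w t))) = w); last by apply/funext => v; rewrite ps.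
    by rewrite -pf subrr.
  have irh t : i (r (h t)) = h t by rewrite ir h0 (lf0 sl) subr0.
  have zrh : Z M1 n (fun t => r (h t)).
    case: zh => hc hd; split; first exact: map_cochain.
    apply/funext => t; apply: i_inj; rewrite hdiff_i.
    rewrite (_ : (fun t => _) = h); last by apply/funext => v; rewrite irh.
    by rewrite hd; exact/esym/(lf0 il).
  exists (hcl _ _ (fun t => r (h t))); rewrite HH_map_hcl //; apply/hcl_eq => //.
    exact: map_cocycle.
  by rewrite (_ : (fun t => i _) = h) //; apply/funext => t; rewrite irh.
- move=> n z; split=> [|[y <-]]; last first.
    have [f [fc fd] ->] := hclW y; rewrite HH_map_hcl //.
    rewrite (@conn_HH_lift n f 0) ?hcl0 //; first exact: is_cochain_0.
    by rewrite fd; apply/funext => t; exact/esym/(lf0 il).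
  have [f zf ->] := hclW z; rewrite conn_HH_hcl // => /hcl_eq0 => /(_ (conn_cocycle zf)).
  (* The lift [s f] fails to be a cocycle by [i (conn f) = i (hdiff w)]; subtracting [i w] repairs
     this and does not change the image under [p]. *)
  move=> [w [wc cw]]; pose h : seq B -> M := (fun t => s (f t)) - (fun t => i (w t)).
  have zh : Z M n h.
    split; last first.
      rewrite /h hdiffB; apply/funext => t; rewrite -[LHS]/(_ t - _ t) -(i_conn zf) -hdiff_i.
      by rewrite cw subrr.
    rewrite /h addrC -scaleN1r; apply: is_cochain_lin; apply: map_cochain => //.
    by case: zf.
  exists (hcl _ _ h); rewrite HH_map_hcl //; congr hcl; apply/funext => t.
  by rewrite -[h t]/(s (f t) - i (w t)) (lfB pl) ps pi0 subr0.
move=> n x; split=> [|[z <-]]; last first.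
  have [f zf ->] := hclW z; rewrite conn_HH_hcl // HH_map_hcl; [|by []|exact: conn_cocycle].
  apply/hcl_eq0; first exact/map_cocycle/conn_cocycle.
  exists (fun t => s (f t)); split; first by case: zf => fc _; exact: map_cochain.
  by apply/funext => t; rewrite (i_conn zf).
have [g zg ->] := hclW x; rewrite HH_map_hcl // => /hcl_eq0 => /(_ (map_cocycle ih zg)).
move=> [f [fc fg]]; exists (hcl _ _ (fun t => p (f t))).
by apply: conn_HH_lift => //; case: zg.
Qed.

End CoefficientSequence.

Section QuotientTheorem.
Variables (K : comPzRingType) (B A : kalg K) (I : ideal B) (pi : alghom B A).
Hypothesis pi_surj : forall a, exists b, pi b = a.
Hypothesis pi_ker : forall b, pi b = 0 <-> I b.
Hypotheses (B_proj : projective_module B) (A_proj : projective_module A).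
Hypothesis tor : forall i, (0 < i)%N -> Tor_eq0 i (AB pi) (BA pi).

Let pil : linear_fun pi := ah_linear pi.

Lemma pull_phi_bij n :
  bijective (fun a : Ext (bar A) (reg A) n => ext_pull (phi_cmap pi n) a).
Proof.
apply: (@ext_pull_bij K A A (reg A) (bar_AA pi) (bar A) (reg A) 
  (bar_AA_eps pi) (bar_eps A) (fun=> True)).
- exact: bar_AA_resolution.
- exact: bar_resolution.
exact: phi_AA_eps.
Qed.

Lemma restrict_bij n : bijective (@restrict K B A pi n).
Proof.
have h := bij_comp (@ext_to_HH_bij K B (BAB pi) n)
  (bij_comp (@adj_AA_bij K B A pi n) (@pull_phi_bij n)).
exact: h.
Qed.

(** [theta] inverts restriction along [pi]. It is not given by a formula on cochains, so the last
    clause is the means to evaluate it: on cochains that factor through [pi]. *)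
Lemma unrestrict_exists : exists (theta theta' : forall n, _),
  (forall n, cancel (theta n) (theta' n)) /\ (forall n, cancel (theta' n) (theta n)) /\
  (forall n, linear_fun (theta n)) /\
  (forall n (a : Ext (bar A) (reg A) n), theta n (restrict pi a) = ext_to_HH a :> HH (reg A) n) /\
  forall n (f : seq A -> reg A), hh_cocycle (reg A) n f ->
    hh_cocycle (BAB pi) n (fun s => f (map pi s)) /\
    theta n (hcl _ _ (fun s => f (map pi s))) = hcl _ _ f.
Proof.
have [u [uK Ku]] := bijective_family restrict_bij.
have [v [vK Kv]] := bijective_family (@ext_to_HH_bij K A (reg A)).
exists (fun n x => ext_to_HH (u n x)), (fun n y => restrict pi (v n y)).
split; first by move=> n; exact: (can_comp (vK n) (Ku n)).
split; first by move=> n; exact: (can_comp (uK n) (Kv n)).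
split.
  move=> n; apply: (linear_fun_comp (@ext_to_HH_lin _ _ _ n)).
  exact: (can_linear (uK n) (Ku n) (@restrict_lin _ _ _ pi n)).
split=> [n a|n f zf]; first by rewrite uK.
have zc := cochbi_cocycle zf.
have fE : bar_ev (@cochbi K A (reg A) n f) = f by apply: bar_ev_cochbi; case: zf.
split.
  case: zf => [[f0 fl] fd]; split; first split.
  - by move=> s sn; rewrite f0 // size_map.
  - by move=> s1 s2 k x y; rewrite !map_cat /= pil fl.
  apply/funext => s; have := @hdiff_map _ A B (reg A) (BAB pi) pi id f s pil (@id_linear _ A)
    (ah_mul pi) (fun _ _ => erefl) (fun _ _ => erefl).
  by rewrite /= => <-; rewrite fd.
have -> : hcl (hh_cocycle (BAB pi) n) (hh_coboundary (BAB pi) n) (fun s => f (map pi s)) =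
    restrict pi (hcl _ _ (cochbi f)) by rewrite restrict_hcl // fE.
by rewrite uK ext_to_HH_hcl // fE.
Qed.

Lemma quotient_theorem :
  [/\ bar_computes_HH B, bar_computes_HH A
     & projective_resolution (bar_AA_eps pi)] /\
   exists (phi : cmap (bar_AA pi) (bar A))
          (theta : forall n, HH (BAB pi) n -> HH (reg A) n)
          (delta : forall n, HH (reg A) n -> HH (ideal_bimod I) n.+1),
     let j n : HH (reg B) n -> HH (BAB pi) n :=
       @HH_map K B (reg B) (BAB pi) pi n in
     let k n : HH (reg B) n -> HH (reg A) n := fun x => theta n (j n x) in
     [/\ (forall z, bar_eps A (phi 0%N z) = bar_AA_eps pi z) /\
         (forall n,
            [/\ bijective (fun a : Ext (bar A) (reg A) n =>
                             ext_pull (phi n) a),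
                bijective (@adj_AA K B A pi n)
              & forall a : Ext (bar A) (reg A) n,
                  theta n (ext_to_HH (adj_AA (ext_pull (phi n) a)))
                  = ext_to_HH a]),
         (forall n (f : seq B -> reg B) (g : seq B -> ideal_bimod I),
            is_cochain n f -> is_cochain n.+1 g ->
            hdiff f = (fun s => val (g s)) ->
            delta n (theta n (hcl _ _ (fun s => pi (f s)))) = hcl _ _ g),
         long_exact (fun n => @HH_map K B (ideal_bimod I) (reg B) val n) k delta
       & gerstenhaber_hom k].
Proof.
split; first by split; [exact: bar_computes|exact: bar_computes|exact: bar_AA_resolution].
have [theta [theta' [thK [th'K [thl [th_ext th_hcl]]]]]] := unrestrict_exists.
have [s [sl ps]] := linear_section A_proj pil pi_surj.
have rI b : I (b - s (pi b)) by apply/pi_ker; rewrite (lfB pil) ps subrr.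
pose r b : ideal_bimod I := inM (rI b).
have vh : is_bihom (val : ideal_bimod I -> reg B) by [].
have ph : is_bihom (pi : reg B -> BAB pi).
  by split=> [|x m|m x]; [exact: pil|exact: ah_mul|exact: ah_mul].
have rl : linear_fun (r : reg B -> _).
  move=> k u v; apply: val_inj; rewrite /= pil sl scalerBr; zmod.
have p0 (x : ideal_bimod I) : pi (val x) = 0 by apply/pi_ker; exact: subMP.
have rv (x : ideal_bimod I) : r (val x) = x.
  by apply: val_inj; rewrite /= p0 (lf0 sl) subr0.
pose c n := @conn_HH K B (ideal_bimod I) (reg B) (BAB pi) s r n.
exists (phi_cmap pi), theta, (fun n z => c n (theta' n z)).
split.
- split=> [|n]; first exact: phi_AA_eps.
  by split; [exact: pull_phi_bij|exact: adj_AA_bij|exact: th_ext].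
- move=> n f g fc gc fg; rewrite thK.
  exact: (conn_HH_lift vh ph sl rl ps rv (fun=> erefl) p0 fc gc fg).
- have les := HH_long_exact vh ph sl rl ps rv (fun=> erefl) p0.
  exact: (long_exact_iso (fun _ => frefl _) (fun _ => frefl _) (fun _ => frefl _)
    (fun _ => frefl _) thK th'K (fun _ => @id_lin _ _) (fun _ => @id_lin _ _) thl les).
have jl n : linear_fun (@HH_map K B (reg B) (BAB pi) pi n) := HH_map_lin ph.
pose rel (n : nat) (f : seq B -> reg B) (F : seq A -> reg A) :=
  forall t, pi (f t) = F (map pi t).
apply: (@gerstenhaber_of_relation _ _ _ _ rel rel) => //.
- by move=> n; exact: (linear_fun_comp (thl n) (jl n)).
- move=> n f F zf zF fF; rewrite (HH_map_hcl ph zf) -(th_hcl n F zF).2; congr (theta n (hcl _ _ _)).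
  by apply/funext => t; exact: fF.
- move=> n a; have [f zf ->] := hclW a.
  have [g _ gK] := restrict_bij n.
  (* Surjectivity of [restrict] gives a cocycle of [A] whose composite with [pi] is cohomologous to
     [pi f]. What remains is to turn this into an equality. *)
  have [b jb] : exists b : Ext (bar A) (reg A) n, restrict pi b =
      @HH_map K B (reg B) (BAB pi) pi n (hcl _ _ f).
    by exists (g (@HH_map K B (reg B) (BAB pi) pi n (hcl _ _ f))); rewrite gK.
  move: {g gK} jb.
  have [F ZF bF] := hclW b; rewrite bF restrict_hcl // HH_map_hcl //.
  have ZeF := bar_ev_cocycle ZF.
  move=> /hcl_eq => /(_ (th_hcl n _ ZeF).1 (map_cocycle ph zf)) d.
  have {}d : hh_coboundary (BAB pi) n ((fun t => pi (f t)) - (fun t => bar_ev F (map pi t))).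
    by rewrite -opprB; exact: smN.
  case: n f zf a b F ZF bF ZeF d => [|n] f zf a b F ZF bF ZeF /= d.
    exists f, (bar_ev F); split=> // t; apply/eqP; rewrite -subr_eq0; apply/eqP.
    exact: (congr1 (fun h => h t) d).
  (* Lifting [h] along the section [s] corrects [f] to a cocycle with [pi f = F o pi]. *)
  have [h [hc hE]] := d; pose w := hdiff (fun t => s (h t) : reg B).
  have dw : hh_coboundary (reg B) n.+1 w by exists (fun t => s (h t)); split=> //;
      exact: (map_cochain (U := BAB pi) (V := reg B) sl hc).
  have zw := coboundary_cocycle dw.
  have zfw : hh_cocycle (reg B) n.+1 (f - w) by exact: (smB (P := hh_cocycle (reg B) n.+1)).
  exists (f - w), (bar_ev F); split=> //; last first.
    by apply/hcl_eq => //; rewrite opprB addrC subrK.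
  move=> t; rewrite -[(f - w) t]/(f t - w t) (lfB pil).
  rewrite -[pi (w t)](congr1 (fun h => h t) (map_hdiff (fun t => s (h t) : reg B) ph)).
  rewrite (_ : (fun t => pi (s (h t))) = h); last by apply/funext => v; rewrite ps.
  by rewrite -hE -[((_ : seq B -> BAB pi) - _) t]/(pi (f t) - bar_ev F (map pi t)); zmod.
- by case=> [|x t]; [exact: ah_one|exact: (lf0 pil)].
- move=> n k f g F G fF gG t; rewrite -[(k *: f + g) t]/(k *: f t + g t) pil fF gG //.
- by move=> m n f g F G fF gG t; rewrite /cup ah_mul fF gG map_take map_drop.
move=> m n f g F G fF gG t; rewrite /circ (lf_sum pil); apply: eq_bigr => i _.
by rewrite (lfZ pil) fF map_cat /= gG map_take map_drop map_take map_drop.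
Qed.

End QuotientTheorem.

(** * Mapping cones *)

Section ProductBimodule.
Variables (K : comPzRingType) (R S : kalg K) (M N : bimod R S).

Definition prod_lact (x : R) (m : M * N) : M * N := (lact x m.1, lact x m.2).
Definition prod_ract (m : M * N) (x : S) : M * N := (ract m.1 x, ract m.2 x).

Fact prod_l_bilinear : @bilinear_fun K R (M * N)%type (M * N)%type prod_lact.
Proof.
have [h1 h2] := lact_bilinear M; have [h3 h4] := lact_bilinear N.
by split=> [m k x y|x k m m']; rewrite /prod_lact ?h1 ?h3 ?h2 ?h4.
Qed.
Fact prod_r_bilinear : @bilinear_fun K (M * N)%type S (M * N)%type prod_ract.
Proof.
have [h1 h2] := ract_bilinear M; have [h3 h4] := ract_bilinear N.
by split=> [x k m m'|m k x y]; rewrite /prod_ract ?h1 ?h3 ?h2 ?h4.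
Qed.
Fact prod_lact_mul x y m : prod_lact (x ** y) m = prod_lact x (prod_lact y m).
Proof. by rewrite /prod_lact !lact_mul. Qed.
Fact prod_lact_one m : prod_lact (kone R) m = m.
Proof. by case: m => a b; rewrite /prod_lact !lact_one. Qed.
Fact prod_ract_mul m x y : prod_ract m (x ** y) = prod_ract (prod_ract m x) y.
Proof. by rewrite /prod_ract !ract_mul. Qed.
Fact prod_ract_one m : prod_ract m (kone S) = m.
Proof. by case: m => a b; rewrite /prod_ract !ract_one. Qed.
Fact prod_lract x m y : prod_ract (prod_lact x m) y = prod_lact x (prod_ract m y).
Proof. by rewrite /prod_ract /prod_lact !lract. Qed.

Definition prodbm : bimod R S :=
  Bimod prod_l_bilinear prod_r_bilinear prod_lact_mul prod_lact_one prod_ract_mul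
    prod_ract_one prod_lract.

Fact fst_is_bihom : is_bihom (fun m : prodbm => m.1). Proof. by []. Qed.
Fact snd_is_bihom : is_bihom (fun m : prodbm => m.2). Proof. by []. Qed.
Fact inl_is_bihom : is_bihom (fun m : M => (m, 0) : prodbm).
Proof.
split=> [k u v|x m|m x]; apply: injective_projections => //=.
- by rewrite scaler0 addr0.
- by rewrite (lf0 (lact_lin _)).
by rewrite (lf0 (ract_lin _)).
Qed.
Fact inr_is_bihom : is_bihom (fun n : N => (0, n) : prodbm).
Proof.
split=> [k u v|x m|m x]; apply: injective_projections => //=.
- by rewrite scaler0 addr0.
- by rewrite (lf0 (lact_lin _)).
by rewrite (lf0 (ract_lin _)).
Qed.
Definition fstbh := Bihom fst_is_bihom.
Definition sndbh := Bihom snd_is_bihom.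
Definition inlbh := Bihom inl_is_bihom.
Definition inrbh := Bihom inr_is_bihom.

Fact pair_is_bihom (P : bimod R S) (f : bihom P M) (g : bihom P N) :
  is_bihom (fun x => (f x, g x) : prodbm).
Proof. by split=> [k u v|x m|m x]; rewrite ?bh_lin ?bh_l ?bh_r. Qed.
Definition pairbh P f g := Bihom (@pair_is_bihom P f g).

Fact sum_is_bihom (P : bimod R S) (f : bihom M P) (g : bihom N P) :
  is_bihom (fun x : prodbm => f x.1 + g x.2).
Proof.
split=> [k u v|x m|m x].
- by rewrite !bh_lin scalerDr; zmod.
- by rewrite !bh_l (lfD (lact_lin _)).
by rewrite !bh_r (lfD (ract_lin _)).
Qed.
Definition sumbh P f g := Bihom (@sum_is_bihom P f g).

Lemma prodbm_proj : biprojective M -> biprojective N -> biprojective prodbm.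
Proof.
move=> Mp Np U V g f gs.
have [h hP] := Mp U V g (compbh f inlbh) gs.
have [h' h'P] := Np U V g (compbh f inrbh) gs.
exists (sumbh h h') => -[m n]; rewrite /= (lfD (bh_lin g)) hP h'P /= -(lfD (bh_lin f)).
by congr (f (_, _)); rewrite /= ?addr0 ?add0r.
Qed.

End ProductBimodule.

Section BihomOpp.
Variables (K : comPzRingType) (R S : kalg K).
Fact oppbh_is_bihom (M N : bimod R S) (f : bihom M N) : is_bihom (fun x => - f x).
Proof.
split=> [k u v|x m|m x]; rewrite ?bh_lin ?bh_l ?bh_r.
- by rewrite opprD scalerN.
- by rewrite (lfN (lact_lin _)).
by rewrite (lfN (ract_lin _)).
Qed.
Definition oppbh (M N : bimod R S) (f : bihom M N) := Bihom (oppbh_is_bihom f).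
End BihomOpp.

Section BihomAdd.
Variables (K : comPzRingType) (R S : kalg K) (M N : bimod R S).
Definition addbh (f g : bihom M N) : bihom M N :=
  compbh (sumbh f g) (pairbh (idbh M) (idbh M)).
End BihomAdd.

(* The sign of [psi] is chosen so that the second component [sigma] of a chain map [w]
   into the cone satisfies [epsP sigma = - tau d], where [tau := epsX w]. *)
Section Cone.
Variables (K : comPzRingType) (R S : kalg K) (P X : cplx R S) (psi : cmap P X).

Definition cone_ob (n : nat) : bimod R S :=
  match n with 0%N => X 0%N | n'.+1 => prodbm (X n'.+1) (P n') end.

Definition cone_d (n : nat) : bihom (cone_ob n.+1) (cone_ob n) :=
  match n return bihom (cone_ob n.+1) (cone_ob n) with
  | 0%N => sumbh (cd X 0%N) (oppbh (psi 0%N))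
  | n'.+1 => pairbh (sumbh (cd X n'.+1) (oppbh (psi n'.+1)))
                    (oppbh (compbh (cd P n') (sndbh _ _)))
  end.

Fact cone_dd n (x : cone_ob n.+2) : cone_d n (cone_d n.+1 x) = 0.
Proof.
case: n x => [|n] [x y] /=.
  by rewrite (lfD (bh_lin _)) !(lfN (bh_lin _)) cdd cm_d; zmod.
congr (_, _).
  by rewrite (lfD (bh_lin _)) !(lfN (bh_lin _)) cdd cm_d; zmod.
by rewrite (lfN (bh_lin _)) cdd !oppr0.
Qed.

Definition cone : cplx R S := Cplx cone_dd.

Definition cone_in (n : nat) : bihom (X n) (cone n) :=
  match n return bihom (X n) (cone n) with
  | 0%N => idbh _
  | n'.+1 => inlbh _ _
  end.

Fact cone_in_d n x : cone_in n (cd X n x) = cd cone n (cone_in n.+1 x).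
Proof.
case: n x => [|n] x /=; rewrite (lf0 (bh_lin _)) oppr0 addr0 //.
by rewrite (lf0 (bh_lin _)) oppr0.
Qed.
Definition cone_incl : cmap X cone := Cmap cone_in_d.

Definition cone_pr n : bihom (cone n.+1) (P n) := sndbh _ _.

Lemma cone_pr_d n x : cone_pr n (cd cone n.+1 x) = - cd P n (cone_pr n.+1 x).
Proof. by []. Qed.

Lemma cone_pr_compatible n : ext_compatible (cone_pr n).
Proof.
split=> [x|]; first by exists (- cone_pr n.+1 x); rewrite (lfN (bh_lin _)).
by case: n => //= n; exists (oppbh (cone_pr n)) => x; rewrite /= opprK.
Qed.

Section Resolution.
Variables (M V : bimod R S) (I : M -> Prop) (epsX : bihom (X 0%N) M)
  (epsP : bihom (P 0%N) M) (p : bihom M V).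
Hypothesis resX : projective_resolution epsX.
Hypothesis resP : resolves epsP I.
Hypothesis eps_psi : forall z, epsX (psi 0%N z) = epsP z.
Hypothesis p_surj : forall v, exists m, p m = v.
Hypothesis p_ker : forall m, p m = 0 <-> I m.

Definition cone_eps : bihom (cone 0%N) V := compbh p epsX.

(** [psi] lifts the inclusion of [I] into [M], so its cone resolves the quotient, which [p]
    identifies with [V]. *)
Lemma cone_resolution : projective_resolution cone_eps.
Proof.
have [Xp Xe X0 Xx] := resX; have [Pp Pe P0 Px] := resP; split.
- case=> [|n]; [exact: Xp|exact: prodbm_proj].
- move=> v; split=> // _; have [m <-] := p_surj v.
  by have [x <-] := (Xe m).1 Coq.Init.Logic.I; exists x.
- move=> x; split=> [|[[x' y] <-]] /=.
    move=> /p_ker /Pe [y yx].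
    have [|x' x'P] := (X0 (x - psi 0%N y)).1.
      by rewrite (lfB (bh_lin _)) eps_psi yx subrr.
    by exists (x', - y); rewrite /= x'P (lfN (bh_lin _)) opprK subrK.
  apply/p_ker; have -> : epsX (cd X 0%N x' - psi 0%N y) = epsP (- y).
    rewrite (lfB (bh_lin _)) eps_psi (lfN (bh_lin _)).
    have /X0 -> : exists z, cd X 0%N z = cd X 0%N x' by exists x'.
    by rewrite add0r.
  by apply/Pe; exists (- y).
(* Once [y] is known to be a boundary, x - psi y' is a cycle of [X]. Degree 0 and higher degrees
   differ only in how [y'] is found. *)
have fin n (x : X n.+1) (y : P n) y' : cd X n x - psi n y = 0 -> cd P n y' = y ->
    exists z, cone_d n.+1 z = (x, y).
  move=> dx dy; have [|x' x'P] := Xx n (x - psi n.+1 y').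
    by rewrite (lfB (bh_lin _)) -cm_d dy.
  exists (x', - y'); rewrite /= x'P (lfN (bh_lin _)) (lfN (bh_lin _)) dy !opprK.
  by rewrite subrK.
case=> [|n] [x y] /=.
  move=> d0; have [|y' y'P] := (P0 y).1; last exact: fin y'P.
  rewrite -eps_psi; have -> : psi 0%N y = cd X 0%N x.
    by apply/eqP; rewrite eq_sym -subr_eq0; apply/eqP.
  by apply: (X0 _).2; exists x.
move=> [d0 /eqP]; rewrite oppr_eq0 => /eqP dy.
by have [y' y'P] := Px _ _ dy; exact: fin y'P.
Qed.
End Resolution.

Section ExtSequence.
Variable M : bimod R S.

Lemma pair_split n (F : cone n.+1 -> M) x y : linear_fun F ->
  F (x, y) = F (x, 0) + F (0, y).
Proof. by move=> Fl; rewrite -(lfD Fl); congr (F (_, _)); rewrite ?addr0 ?add0r. Qed.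

Lemma cone_long_exact : long_exact
  (fun n (a : Ext cone M n) => ext_pull (cone_incl n) a)
  (fun n (a : Ext X M n) => ext_pull (psi n) a)
  (fun n (a : Ext P M n) => ext_pull (cone_pr n) a).
Proof.
have ci n := cmap_compatible cone_incl n.
have cp n := cmap_compatible psi n.
have cr := cone_pr_compatible.
split.
- by move=> n; split; apply: ext_pull_lin.
- move=> x y; have [F zF ->] := hclW x; have [G zG ->] := hclW y.
  rewrite !(ext_pull_hcl (ci 0%N)) // => /hcl_eq FG.
  apply/hcl_eq => //; apply: FG; first exact: (pull_cocycle (ci 0%N) zF).
  exact: (pull_cocycle (ci 0%N) zG).
- move=> n y; split=> [|[x <-]]; last first.
    have [F zF ->] := hclW x; rewrite (ext_pull_hcl (ci n)) //.
    have zF' := pull_cocycle (ci n) zF.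
    rewrite (ext_pull_hcl (cp n)) //; apply/hcl_eq0; first exact: (pull_cocycle (cp n) zF').
    case: n x y F zF zF' => [|n] x y F [[Fl FL FR] Fd] zF' /=.
      apply/funext => z; have := Fd (0, - z); rewrite /= (lf0 (bh_lin _)) add0r.
      by rewrite (lfN (bh_lin _)) opprK.
    exists (oppbh (compbh (Bihom (And3 Fl FL FR)) (inrbh _ _))); split; first exact: bhP.
    apply/funext => z; have := Fd (0, - z).
    rewrite /= (lf0 (bh_lin _)) add0r !(lfN (bh_lin _)) !opprK.
    rewrite (@pair_split n) // => /eqP; rewrite addr_eq0 => /eqP ->; reflexivity.
  have [F zF ->] := hclW y; rewrite (ext_pull_hcl (cp n)) // => /hcl_eq0.
  move=> /(_ (pull_cocycle (cp n) zF)).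
  case: n y F zF => [|n] y F [Fh Fd] /=.
    move=> F0; have zF : ext_cocycle cone M 0 F.
      split=> // -[x z] /=; case: Fh => Fl _ _; rewrite (lfB Fl) Fd.
      by rewrite [F _](congr1 (fun h => h z) F0) subr0.
    by exists (hcl _ _ F); rewrite (ext_pull_hcl (ci 0%N)).
  move=> [G [Gh FG]].
  (* F psi = G d says exactly that extending [F] by - G on the summand from [P] gives a cocycle on
     the cone. *)
  pose H : bihom (cone n.+1) M := sumbh (Bihom Fh) (oppbh (Bihom Gh)).
  have zH : ext_cocycle cone M n.+1 H.
    split=> [|[x z]]; first exact: bhP.
    have [Fl _ _] := Fh; have [Gl _ _] := Gh.
    rewrite /= (lfB Fl) Fd (lfN Gl) opprK -[G _](congr1 (fun h => h z) FG); zmod.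
  exists (hcl _ _ (bh H)); rewrite (ext_pull_hcl (ci n.+1)) //; congr hcl.
  by apply/funext => x /=; have [Gl _ _] := Gh; rewrite (lf0 Gl) subr0.
- move=> n z; split=> [|[y <-]]; last first.
    have [F zF ->] := hclW y; rewrite (ext_pull_hcl (cp n)) //.
    have zF' := pull_cocycle (cp n) zF.
    rewrite (ext_pull_hcl (cr n)) //; apply/hcl_eq0; first exact: (pull_cocycle (cr n) zF').
    have [Fh Fd] := zF; have [Fl _ _] := Fh.
    case: n y z F zF zF' Fh Fd Fl => [|n] y z F zF zF' Fh Fd Fl.
      exists (oppbh (Bihom Fh)); split; first exact: bhP.
      by apply/funext => -[x w] /=; rewrite (lfB Fl) Fd; zmod.
    exists (compbh (oppbh (Bihom Fh)) (fstbh _ _)); split; first exact: bhP.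
    by apply/funext => -[x w] /=; rewrite (lfB Fl) Fd; zmod.
  have [G zG ->] := hclW z; rewrite (ext_pull_hcl (cr n)) // => /hcl_eq0.
  move=> /(_ (pull_cocycle (cr n) zG)) [H [Hh GH]]; have [Hl _ _] := Hh.
  have GHx x w : G w = H (cone_d n (x, w)) := congr1 (fun h => h ((x, w) : cone n.+1)) GH.
  have [[Gl _ _] _] := zG.
  (* The cochain [H] has the projection of [G] as coboundary. Its restriction to [X], negated
     because [psi] enters [cone_d] negatively, pulls back to [G] up to the coboundary of its
     restriction to [P]. *)
  pose F := oppbh (compbh (Bihom Hh) (cone_in n)).
  have zF : ext_cocycle X M n F.
    split=> [|x]; first exact: bhP.
    rewrite -[LHS]/(- H (cone_in n (cd X n x))) cone_in_d.
    by rewrite -[H _]/(H (cone_d n (x, 0))) -(GHx x 0) (lf0 Gl) oppr0.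
  exists (hcl _ _ (bh F)); rewrite (ext_pull_hcl (cp n)) //; apply/hcl_eq => //.
    exact: (pull_cocycle (cp n) zF).
  have FE w : F w = - H (cone_in n w) by [].
  case: n z G zG H Hh GH Hl GHx Gl F zF FE => [|n] z G zG H Hh GH Hl GHx Gl F zF FE /=.
    apply/funext => w; rewrite -[RHS]/(0 : M) -[LHS]/(F (psi 0%N w) - G w) FE (GHx 0 w) /=.
    by rewrite (lf0 (bh_lin _)) add0r (lfN Hl); zmod.
  exists (compbh (Bihom Hh) (inrbh _ _)); split; first exact: bhP.
  apply/funext => w; rewrite -[LHS]/(F (psi n.+1 w) - G w) FE (GHx 0 w) /=.
  rewrite (lf0 (bh_lin _)) add0r (@pair_split n H (- psi n.+1 w) _ Hl).
  have -> : (- psi n.+1 w, 0) = - ((psi n.+1 w, 0) : cone n.+1).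
    by apply: injective_projections; rewrite /= ?oppr0.
  have -> : (0, - cd P n w) = - ((0, cd P n w) : cone n.+1).
    by apply: injective_projections; rewrite /= ?oppr0.
  by rewrite !(lfN Hl); zmod.
move=> n x; split=> [|[z <-]]; last first.
  have [G zG ->] := hclW z; have zG' := pull_cocycle (cr n) zG.
  rewrite (ext_pull_hcl (cr n)) // (ext_pull_hcl (ci n.+1)) //.
  rewrite (_ : (fun x => _) = 0) ?hcl0 //; apply/funext => w.
  by have [[Gl _ _] _] := zG; exact: (lf0 Gl).
have [F zF ->] := hclW x; rewrite (ext_pull_hcl (ci n.+1)) // => /hcl_eq0.
move=> /(_ (pull_cocycle (ci n.+1) zF)) [G [Gh FG]].
have FGx w : F ((w, 0) : cone n.+1) = G (cd X n w) := congr1 (fun h => h w) FG.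
have [Fh Fd] := zF; have [Fl _ _] := Fh; have [Gl _ _] := Gh.
(* Subtracting from [F] the coboundary of [G], extended by zero to the cone, removes its values on
   [X]; what is left on [P] is [Z]. *)
pose Z : bihom (P n) M := addbh (compbh (Bihom Fh) (inrbh _ _)) (compbh (Bihom Gh) (psi n)).
have zZ : ext_cocycle P M n Z.
  split=> [|w]; first exact: bhP.
  have := Fd (0, - w) => /=.
  rewrite (lf0 (bh_lin _)) add0r !(lfN (bh_lin _)) !opprK (@pair_split n _ _ _ Fl) FGx.
  by rewrite addrC cm_d.
exists (hcl _ _ (bh Z)); rewrite (ext_pull_hcl (cr n)) //; apply/hcl_eq => //.
  exact: (pull_cocycle (cr n) zZ).
have ZE w : Z w = F ((0, w) : cone n.+1) + G (psi n w) by [].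
case: n x F zF G FG FGx Fh Fd Fl Gh Gl Z zZ ZE => [|n] x F zF G FG FGx Fh Fd Fl Gh Gl Z zZ ZE /=.
  exists (oppbh (Bihom Gh)); split; first exact: bhP.
  apply/funext => -[a b]; rewrite -[LHS]/(Z b - F (a, b)) ZE /= (lfB Gl).
  by rewrite (@pair_split 0 F a b Fl) FGx; zmod.
exists (oppbh (compbh (Bihom Gh) (fstbh _ _))); split; first exact: bhP.
apply/funext => -[a b]; rewrite -[LHS]/(Z b - F (a, b)) ZE /= (lfB Gl).
by rewrite (@pair_split n.+1 F a b Fl) FGx; zmod.
Qed.
End ExtSequence.

End Cone.

(** * Stratifying idempotents *)

Section StratifyingPart.
Variables (K : comPzRingType) (B : kalg K) (e : B) (ee : e ** e = e).
Local Notation C := (corner ee).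
Local Notation vC := (val : C -> B).

Lemma to_corner_lin : linear_fun (to_corner ee : B -> C).
Proof.
move=> k u v; apply: val_inj; rewrite /= (kmul_linr e) (kmul_linl e); reflexivity.
Qed.

Lemma to_cornerK (c : C) : to_corner ee (val c) = c.
Proof. by apply: val_inj; exact: (subMP c). Qed.

Lemma corner_val_lin : linear_fun vC. Proof. by []. Qed.
Lemma corner_val_mul (x y : C) : vC (x ** y) = vC x ** vC y. Proof. by []. Qed.

Lemma corner_proj : projective_module B -> projective_module C.
Proof. exact: (projective_retract corner_val_lin to_corner_lin to_cornerK). Qed.

Lemma Be_proj : projective_module B -> projective_module (Be ee).
Proof.
have rP b : Be_sub e (b ** e) by rewrite /= -kmulA ee.
apply: (projective_retract (i := val : Be ee -> B) (r := fun b => inM (rP b))) => //.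
  by move=> k u v; apply: val_inj; exact: (kmul_linl e).
by move=> m; apply: val_inj; exact: (subMP m).
Qed.

Let kapl : linear_fun (val : Be ee -> B). Proof. by []. Qed.
Let kapr : linear_fun (val : eB ee -> B). Proof. by []. Qed.

Lemma Be_gen (m : Be ee) : lact (val m) (Be_e ee) = m.
Proof. by apply: val_inj; exact: (subMP m). Qed.
Lemma eB_gen (n : eB ee) : ract (eB_e ee) (val n) = n.
Proof. by apply: val_inj; exact: (subMP n). Qed.

Lemma bar_BeB_resolution (I : B -> Prop) : projective_module B ->
  stratifying ee -> (forall x, I x <-> BeB e x) -> resolves (bar_BeB_eps ee) I.
Proof.
move=> Bp [tor mi mP] IP; apply: bar_tens_resolves => //.
- by move=> v; rewrite IP; exact: mP.
- exact: (cyclic_projl (u := Be_e ee) (kap := val) _ _ Be_gen).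
- exact: (cyclic_projr (u := eB_e ee) (kap := val) _ _ eB_gen).
- exact: Be_proj.
exact: corner_proj.
Qed.

Lemma BeB_l n (m : Be ee) s (x : bar C n) :
  lact (val (ract m s)) (barmap vC x : bar B n) =
  lact (val m) (barmap vC (lact s x)).
Proof. by rewrite (@barmap_lact _ _ _ _ corner_val_lin corner_val_mul n.+1) -lact_mul. Qed.

Lemma BeB_r n (x : bar C n) s (m : eB ee) :
  ract (barmap vC (ract x s) : bar B n) (val m) =
  ract (barmap vC x : bar B n) (val (lact s m)).
Proof. by rewrite (@barmap_ract _ _ _ _ corner_val_lin corner_val_mul n.+1) -ract_mul. Qed.

Definition psi_BeB n : bihom (bar_BeB ee n) (bar B n) :=
  sandwich (M := Be ee) (N := eB ee) (kap := val) (kap' := val)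
    kapl kapr (fun _ _ => erefl) (fun _ _ => erefl)
    (@barmap_lin _ _ _ _ corner_val_lin n.+1) (@BeB_l n) (@BeB_r n).

Lemma psi_BeB_pure n m (x : bar C n) p :
  psi_BeB n (tpure (tpure (m : Be ee) x : tensl (Be ee) (bar C) n) (p : eB ee)) =
  ract (lact (val m) (barmap vC x : bar B n)) (val p).
Proof. exact: sandwich_pure. Qed.

Lemma psi_BeB_d n x : psi_BeB n (cd (bar_BeB ee) n x) = cd (bar B) n (psi_BeB n.+1 x).
Proof.
apply: (tens3_ext (f := fun x => psi_BeB n (cd (bar_BeB ee) n x))
  (g := fun x => cd (bar B) n (psi_BeB n.+1 x))) x => [||m x p].
- exact: (linear_fun_comp (bh_lin _) (bh_lin _)).
- exact: (linear_fun_comp (bh_lin _) (bh_lin _)).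
rewrite [cd (bar_BeB ee) n _]tmap_pure [cd (tensl _ _) n _]tmap_pure !psi_BeB_pure.
by rewrite bh_r bh_l; congr (ract (lact _ _) _); exact: (barmap_bard corner_val_lin corner_val_mul).
Qed.

Definition psi_cmap : cmap (bar_BeB ee) (bar B) := Cmap psi_BeB_d.

Lemma psi_BeB_eps z : bar_eps B (psi_cmap 0%N z) = bar_BeB_eps ee z.
Proof.
apply: (tens3_ext (f := fun z => bar_eps B (psi_BeB 0%N z)) (g := bar_BeB_eps ee)) z => [||m x p].
- exact: (linear_fun_comp (bh_lin _) (bh_lin _)).
- exact: (bh_lin _).
rewrite psi_BeB_pure bh_r bh_l [bar_BeB_eps ee _]aug3E tmap_pure tensl_bar_epsE.
rewrite [RHS]tlift_pure /=; congr (_ ** _ ** _).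
exact/esym/(@barmap_bard _ _ _ _ corner_val_lin corner_val_mul 0).
Qed.

Section Adjunction.
Let rj : forall v : C, to_corner ee (val v) = v := to_cornerK.
Let jr (v : reg B) : lact (val (Be_e ee)) v = v -> ract v (val (eB_e ee)) = v ->
  val (to_corner ee v) = v.
Proof. by move=> /= ev ve; rewrite ev. Qed.
Let j_l (s : C) (v : reg C) :
  lact (val (ract (Be_e ee) s)) (val v : reg B) = val (lact s v : reg C).
Proof. by rewrite /= cornerl. Qed.
Let j_r (v : reg C) (s : C) :
  ract (val v : reg B) (val (lact s (eB_e ee))) = val (ract v s : reg C).
Proof. by rewrite /= cornerr. Qed.

Lemma adj_BeB_bij n : bijective (@adj_BeB K B e ee n).
Proof.
exact: (adj_bij kapl kapr (fun _ _ => erefl) (fun _ _ => erefl) Be_gen eB_gen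
  (V := reg B) (V0 := reg C) (j := val) (r := to_corner ee)
  corner_val_lin to_corner_lin rj jr j_l j_r).
Qed.

Lemma adj_BeB_lin n : linear_fun (@adj_BeB K B e ee n).
Proof.
exact: (adj_linear Be_gen eB_gen (V := reg B) (V0 := reg C) (j := val)
  to_corner_lin rj jr j_l j_r).
Qed.

Lemma adj_BeB_hcl n F : ext_cocycle (bar_BeB ee) (reg B) n F ->
  adj_BeB (hcl _ _ F : Ext (bar_BeB ee) (reg B) n) =
  hcl (ext_cocycle (bar C) (reg C) n) (ext_coboundary (bar C) (reg C) n)
    (adj_fun (Be_e ee) (eB_e ee) (to_corner ee : reg B -> reg C) F).
Proof.
exact: (adj_hcl Be_gen eB_gen (V := reg B) (V0 := reg C) (j := val)
  to_corner_lin rj jr j_l j_r).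
Qed.

Lemma adj_BeB_cocycle n F : ext_cocycle (bar_BeB ee) (reg B) n F ->
  ext_cocycle (bar C) (reg C) n
    (adj_fun (Be_e ee) (eB_e ee) (to_corner ee : reg B -> reg C) F).
Proof.
exact: (adj_cocycle Be_gen eB_gen (V := reg B) (V0 := reg C) (j := val)
  to_corner_lin rj jr j_l j_r).
Qed.
End Adjunction.

Lemma corner_bar_ev n (F : bar B n -> reg B) : is_bihom F ->
  bar_ev (adj_fun (Be_e ee) (eB_e ee) (to_corner ee : reg B -> reg C)
    (fun x => F (psi_cmap n x))) = fun t => to_corner ee (bar_ev F (map vC t)).
Proof.
move=> [_ FL FR]; apply/funext => s; rewrite /bar_ev size_map; case: eqP => ss; last first.
  by rewrite (lf0 to_corner_lin).
rewrite /adj_fun [psi_cmap n]/(psi_BeB n) psi_BeB_pure.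
rewrite (@barmap_word _ _ _ _ corner_val_lin n.+1); last by rewrite /= ss.
(* The leading unit of the word is that of [eBe], i.e. [e]; together with the trailing one it
   accounts for the two factors in [e f e]. *)
have -> : bar_word n.+1 [seq vC i | i <- kone C :: s] =
    lact e (bar_word n.+1 (kone B :: [seq vC i | i <- s])).
  by rewrite [RHS]lact_lpure kmulx1.
by rewrite !(FL, FR); apply: val_inj; rewrite /= !kmulA !ee -!kmulA !ee.
Qed.

Lemma corner_ext_hcl n F : ext_cocycle (bar B) (reg B) n F ->
  ext_to_HH (adj_BeB (ext_pull (psi_cmap n) (hcl _ _ F : Ext (bar B) (reg B) n))) =
  hcl (hh_cocycle (reg C) n) (hh_coboundary (reg C) n)
    (fun t => to_corner ee (bar_ev F (map vC t))).
Proof.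
move=> ZF; have ZF' := pull_cocycle (cmap_compatible psi_cmap n) ZF.
rewrite (ext_pull_hcl (cmap_compatible psi_cmap n)) // (adj_BeB_hcl ZF').
by rewrite (ext_to_HH_hcl (adj_BeB_cocycle ZF')) corner_bar_ev //; case: ZF.
Qed.

Lemma compress_cocycle n f : hh_cocycle (reg B) n f ->
  hh_cocycle (reg C) n (fun t => to_corner ee (f (map vC t)) : reg C).
Proof.
move=> zf; have ZF := cochbi_cocycle zf.
have ZF' := pull_cocycle (cmap_compatible psi_cmap n) ZF.
have := bar_ev_cocycle (adj_BeB_cocycle ZF').
by rewrite corner_bar_ev; [rewrite bar_ev_cochbi //; case: zf|case: ZF].
Qed.

End StratifyingPart.

(** * Representatives linear over K e + K (1 - e) *)

Section IdempotentSplitting.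
Variables (K : comPzRingType) (B : kalg K) (e : B) (ee : e ** e = e).
Local Notation C := (corner ee).
Let e' : B := kone B - e.

Let ee'0 : e ** e' = 0.
Proof. by rewrite /e' (lfB (kmul_linr _)) kmulx1 ee subrr. Qed.
Let e'e0 : e' ** e = 0.
Proof. by rewrite /e' (lfB (kmul_linl _)) kmul1x ee subrr. Qed.
Let e'e' : e' ** e' = e'.
Proof. by rewrite {1}/e' (lfB (kmul_linl _)) kmul1x ee'0 subr0. Qed.

Definition split_at (X : bimod B B) (a : B) (x : X) : ltens X :=
  lpure (a ** e) (lact e x) + lpure (a ** e') (lact e' x).

Lemma split_at_bilinear (X : bimod B B) : bilinear_fun (@split_at X).
Proof.
split=> [x k a b|a k x y]; rewrite /split_at.
  by rewrite !(kmul_linl _) !(@lpure_linl _ _ _ _) scalerDr; zmod.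
by rewrite !lact_lin !(@lpure_linr _ _ _ _) scalerDr; zmod.
Qed.

(* The chain endomorphism [x0 (x) .. (x) xn |-> \sum x0 c1 (x) c1 x1 c2 (x) .. (x) cn xn]
   of the bar complex, where the [ci] range over [e] and [1 - e]. Cochains that
   factor through it are linear over the separable subalgebra [K e + K (1 - e)]. *)
Fixpoint nu (n : nat) : barX B n -> barX B n :=
  match n return barX B n -> barX B n with
  | 0%N => id
  | n'.+1 => ltlin (fun a x => split_at a (@nu n' x))
  end.

Lemma nu_bilinear n : linear_fun (@nu n) -> bilinear_fun (fun a x => split_at a (@nu n x)).
Proof.
have [h1 h2] := split_at_bilinear (barX B n) => nl.
split=> [x|a]; first exact: h1.
exact: (linear_fun_comp (h2 a) nl).
Qed.

Lemma nu_lin n : linear_fun (@nu n).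
Proof. by elim: n => // n IH; apply: ltlin_lin; exact: nu_bilinear. Qed.

Lemma nu_pure n a x : @nu n.+1 (lpure a x) = split_at a (nu x).
Proof. exact: (ltlin_pure _ _ (nu_bilinear (@nu_lin n))). Qed.

Lemma nu_lact n a x : @nu n (lact a x) = lact a (nu x).
Proof.
case: n x => // n x.
apply: (ltens_ext (f := fun x => @nu n.+1 (lact a x)) 
  (g := fun x => lact a (@nu n.+1 x))) x => [||b x].
- exact: (linear_fun_comp (@nu_lin n.+1) (lact_lin _)).
- exact: (linear_fun_comp (lact_lin _) (@nu_lin n.+1)).
by rewrite lact_lpure !nu_pure /split_at (lfD (lact_lin _)) !lact_lpure !kmulA.
Qed.

Lemma nu_ract n x a : @nu n (ract x a) = ract (nu x) a.
Proof.
elim: n x => // n IH x.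
apply: (ltens_ext (f := fun x => @nu n.+1 (ract x a)) 
  (g := fun x => ract (@nu n.+1 x) a)) x => [||b x].
- exact: (linear_fun_comp (@nu_lin n.+1) (ract_lin _)).
- exact: (linear_fun_comp (ract_lin _) (@nu_lin n.+1)).
by rewrite ract_lpure !nu_pure /split_at (lfD (ract_lin _)) !ract_lpure IH !lract.
Qed.

(** The separability idempotent multiplies to 1. Hence merging two factors undoes the insertion
    between them, which makes [nu] commute with [bard]. *)
Lemma lact_split (X : bimod B B) (a : B) (x : X) :
  lact (a ** e) (lact e x) + lact (a ** e') (lact e' x) = lact a x.
Proof.
have [h _] := lact_bilinear X.
rewrite -!lact_mul -!kmulA ee e'e' -(lfD (h x)) -(lfD (kmul_linr a)).
by rewrite /e' addrC subrK kmulx1.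
Qed.

Lemma nu_bard n x : nu (bard B n x) = bard B n (nu x).
Proof.
elim: n x => [|n IH] x.
  apply: (ltens_ext (f := fun x => @nu 0 (bard B 0 x)) 
    (g := fun x => bard B 0 (@nu 1 x))) x => [||a x].
  - exact: (bh_lin (bard B 0)).
  - exact: (linear_fun_comp (bh_lin _) (@nu_lin 1)).
  rewrite nu_pure /split_at (lfD (bh_lin _)) !bard0_pure.
  exact: (esym (@lact_split (reg B) a x)).
apply: (ltens_ext (f := fun x => @nu n.+1 (bard B n.+1 x))
  (g := fun x => bard B n.+1 (@nu n.+2 x))) x => [||a x].
- exact: (linear_fun_comp (@nu_lin n.+1) (bh_lin _)).
- exact: (linear_fun_comp (bh_lin _) (@nu_lin n.+2)).
rewrite bard_pure (lfB (@nu_lin n.+1)) nu_lact !nu_pure IH.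
rewrite /split_at (lfD (bh_lin _)) !bard_pure !bh_l -[lact a _]lact_split; zmod.
Qed.

Lemma nu_is_bihom n : is_bihom (@nu n).
Proof. by split; [exact: nu_lin|exact: nu_lact|exact: nu_ract]. Qed.
Definition nubh n := Bihom (nu_is_bihom n).

Definition nu_cmap : cmap (bar B) (bar B) :=
  @Cmap K B B (bar B) (bar B) (fun n => nubh n.+1) (fun n => @nu_bard n.+1).

Lemma nu_homotopic : projective_module B -> homotopic nu_cmap (idcm (bar B)).
Proof.
move=> Bp; have rB := bar_resolution Bp.
apply: (@resolution_homotopic _ _ _ _ _ _ (bar_eps B) (fun=> True)) => // [|x].
  by case: rB.
by rewrite -[LHS]/(bard B 0 (@nu 1 x)) -nu_bard.
Qed.

(** The inserted idempotent commutes with [e]: both sides reduce to the single summand a e (x) e x,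
    as e (1 - e) = 0. *)
Lemma nu_middle n a (x : barX B n) :
  @nu n.+1 (lpure (a ** e) x) = @nu n.+1 (lpure a (lact e x)).
Proof.
rewrite !nu_pure nu_lact /split_at -!kmulA ee ee'0 -!lact_mul ee e'e0.
rewrite (lf0 (kmul_linr a)) (lf0 (@lpure_linl _ _ _ _)).
have [h _] := lact_bilinear (barX B n).
by rewrite (lf0 (h _)) (lf0 (@lpure_linr _ _ _ _)).
Qed.

Lemma bar_wordS n a s : bar_word n.+1 (a :: s) = lpure a (bar_word n s) :> barX B n.+1.
Proof. by []. Qed.

Lemma nu_word n u x y w : (size u + 1 < n)%N ->
  nu (bar_word n (u ++ x ** e :: y :: w)) = nu (bar_word n (u ++ x :: e ** y :: w)).
Proof.
elim: n u => // n IH [|a u] un; last by rewrite !cat_cons !bar_wordS !nu_pure IH.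
case: n IH un => // n _ _; rewrite !cat0s !bar_wordS nu_middle.
by rewrite [lact e _]lact_lpure.
Qed.

Lemma nu_word_rcons u x :
  nu (ract (bar_word (size u).+1 (rcons u x)) e) = nu (bar_word (size u).+1 (rcons u (x ** e))).
Proof.
elim: u => [|a u IH]; last first.
  change (@nu (size u).+2 (ract (bar_word (size u).+2 (a :: rcons u x)) e) =
    @nu (size u).+2 (bar_word (size u).+2 (a :: rcons u (x ** e)))).
  by rewrite !bar_wordS ract_lpure [LHS]nu_pure [RHS]nu_pure IH.
change (@nu 1 (ract (@lpure _ _ (reg B) x (kone B)) e) =
  @nu 1 (@lpure _ _ (reg B) (x ** e) (kone B))).
rewrite (@nu_middle 0) ract_lpure.
by rewrite [ract _ e]/= [lact e _]/= kmul1x kmulx1.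
Qed.

Section Cochain.
Variables (n : nat) (f : seq B -> reg B).
Hypothesis fZ : hh_cocycle (reg B) n f.

Let F : bar B n -> reg B := fun x => cochbi f (nu x : bar B n).

Let F_bihom : is_bihom F.
Proof.
by apply: (is_bihom_comp (nubh n.+1)); apply: cochbi_bihom; case: fZ => [[_ fl] _].
Qed.

Definition relative_cochain : seq B -> reg B := bar_ev F.
Local Notation g := relative_cochain.

Lemma relative_cocycle : hh_cocycle (reg B) n g.
Proof.
apply: bar_ev_cocycle; exact: (pull_cocycle (cmap_compatible nu_cmap n) (cochbi_cocycle fZ)).
Qed.

Lemma relative_class : projective_module B ->
  hcl (hh_cocycle (reg B) n) (hh_coboundary (reg B) n) g = hcl _ _ f.
Proof.
move=> Bp; have zF := cochbi_cocycle fZ.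
have zF' := pull_cocycle (cmap_compatible nu_cmap n) zF.
rewrite -(ext_to_HH_hcl zF') -(ext_pull_hcl (cmap_compatible nu_cmap n)) //.
rewrite (ext_pull_homotopic _ (nu_homotopic Bp)) ext_pull_id ext_to_HH_hcl //.
by rewrite bar_ev_cochbi //; case: fZ.
Qed.

Lemma relative_middle u x y w : g (u ++ x ** e :: y :: w) = g (u ++ x :: e ** y :: w).
Proof.
rewrite /g /bar_ev !size_cat; case: eqP => // s; congr (cochbi f _).
by rewrite -!cat_cons nu_word // -s /= !addnS addn0 !ltnS leq_addr.
Qed.

Lemma relative_left x w : e ** g (x :: w) = g (e ** x :: w).
Proof.
rewrite /g /bar_ev; case: eqP => [s|_]; last exact: (lf0 (kmul_linr _)).
have [_ FL _] := F_bihom; rewrite -[LHS](FL e (bar_word n.+1 [:: kone B, x & w])).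
rewrite /F; congr (cochbi f _); rewrite -s.
rewrite -[lact _ _](_ : bar_word (size (x :: w)).+1 [:: e, x & w] = _); last first.
  by rewrite [RHS]lact_lpure kmulx1.
(* The [e] on the left is the leading factor [1 ** e], which moves across the first tensor sign. *)
by have := @nu_word (size (x :: w)).+1 [::] (kone B) x w isT; rewrite kmul1x.
Qed.

Lemma relative_right u x : g (rcons u x) ** e = g (rcons u (x ** e)).
Proof.
rewrite /g /bar_ev !size_rcons; case: eqP => [s|_]; last exact: (lf0 (kmul_linl _)).
have [_ _ FR] := F_bihom; rewrite -[LHS](FR (bar_word n.+1 (kone B :: rcons u x)) e).
rewrite /F; congr (cochbi f _); rewrite -s -!rcons_cons.
exact: (nu_word_rcons (kone B :: u)).
Qed.

(** In positive degree [e] moves into the outermost arguments, which absorb it. In degree 0 the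
    cocycle is a central element. *)
Lemma relative_comm (t : seq C) : g (map val t) ** e = e ** g (map val t).
Proof.
have [gc gd] := relative_cocycle.
case: t => [|c t].
  have [n0|n0] := posnP n; first exact: (cochain0_nil gc n0 gd).
  have [g0 _] := gc; rewrite g0; last by rewrite eq_sym -lt0n.
  by rewrite (lf0 (kmul_linl _)) (lf0 (kmul_linr _)).
have right (s : seq C) : (0 < size s)%N -> g (map val s) ** e = g (map val s).
  by case/lastP: s => // s d _; rewrite map_rcons relative_right cornerr.
by rewrite right // [RHS]relative_left cornerl.
Qed.

(** An outer [e] is absorbed by the neighbour of [x], or reaches [x] directly if there is none;
    since that neighbour lies in [eBe] it can equally release an [e] towards [x]. *)
Lemma relative_compress (u w : seq C) x :
  e ** g (map val u ++ x :: map val w) ** e =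
  e ** g (map val u ++ e ** x ** e :: map val w) ** e.
Proof.
have left y v : e ** g (map val u ++ y :: v) = e ** g (map val u ++ e ** y :: v).
  case/lastP: u => [|u c].
    by rewrite !cat0s !relative_left kmulA ee.
  by rewrite map_rcons !cat_rcons -relative_middle cornerr.
have right v y : g (v ++ y :: map val w) ** e = g (v ++ y ** e :: map val w) ** e.
  case: w => [|c w]; first by rewrite !cats1 !relative_right -kmulA ee.
  by rewrite relative_middle cornerl.
by rewrite left -[LHS]kmulA right kmulA.
Qed.

End Cochain.

End IdempotentSplitting.

Section StratifyingTheorem.
Variables (K : comPzRingType) (B A : kalg K) (I : ideal B) (pi : alghom B A).
Hypothesis pi_surj : forall a, exists b, pi b = a.
Hypothesis pi_ker : forall b, pi b = 0 <-> I b.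
Hypothesis B_proj : projective_module B.
Variables (e : B) (ee : e ** e = e).
Hypotheses (e_strat : stratifying ee) (IP : forall x, I x <-> BeB e x).
Variables (Q : cplx B B) (epsQ : bihom (Q 0%N) (BAB pi)).
Hypothesis Q_res : projective_resolution epsQ.
Local Notation C := (corner ee).

Lemma compress_gerstenhaber (l : forall n, HH (reg B) n -> HH (reg C) n) :
  (forall n, linear_fun (l n)) ->
  (forall n (f : seq B -> reg B), hh_cocycle (reg B) n f ->
     l n (hcl _ _ f) = hcl _ _ (fun t => to_corner ee (f (map val t)))) ->
  gerstenhaber_hom l.
Proof.
move=> ll lE.
pose weak (n : nat) (f : seq B -> reg B) (F : seq C -> reg C) :=
  forall t, F t = to_corner ee (f (map val t)).
(* In positive degree [f] even maps the corner to itself, but a cocycle of degree 0 is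
   a central element, which need not lie there. *)
pose strong n f F := [/\ weak n f F,
  forall t : seq C, f (map val t) ** e = e ** f (map val t) &
  forall (u w : seq C) x, e ** f (map val u ++ x :: map val w) ** e =
    e ** f (map val u ++ e ** x ** e :: map val w) ** e].
have cl := to_corner_lin ee.
apply: (@gerstenhaber_of_relation _ _ _ _ strong weak) => //.
- move=> n f F zf _ fF; rewrite lE //; congr hcl; apply/funext => t; exact/esym/fF.
- by move=> n f F [].
- move=> n a; have [f zf ->] := hclW a; have zg := relative_cocycle ee zf.
  exists (relative_cochain e n f), (fun t => to_corner ee (relative_cochain e n f (map val t))).
  split=> //; [exact: compress_cocycle| |exact/esym/relative_class].
  by split=> // [t|u w x]; [exact: relative_comm|exact: relative_compress].
- case=> [|c t]; last exact: (esym (lf0 cl)).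
  by apply: val_inj; rewrite /= kmulx1 ee.
- move=> n k f g F G fF gG t; rewrite -[LHS]/(k *: F t + G t) fF gG -cl; reflexivity.
- move=> m n f g F G [fF fc _] [gG _ _] t; rewrite /cup fF gG !map_take !map_drop.
  set x := f _; set y := g _; apply: val_inj => /=.
  (* Commuting [e] past [x] turns [e x y e] into [e x e e y e]. *)
  have xe : x ** e = e ** x by rewrite /x -map_take; exact: fc.
  rewrite !kmulA; congr (_ ** _); rewrite -!kmulA (kmulA e e) ee !kmulA.
  by rewrite -(kmulA e x e) xe kmulA ee.
move=> m n f g F G [fF _ fc] [gG _ _] t; rewrite /circ (lf_sum cl); apply: eq_bigr => i _.
rewrite (lfZ cl) fF; congr (_ *: _); apply: val_inj => /=.
rewrite map_cat [map _ (_ :: _)]/= gG -!map_drop -!map_take.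
exact/esym/fc.
Qed.

Lemma stratifying_theorem :
   [/\ bar_computes_HH B, bar_computes_HH (corner ee)
     & resolves (bar_BeB_eps ee) I] /\
   exists (chi : cmap (bar B) Q) (psi : cmap (bar_BeB ee) (bar B))
          (tau : bihom (Q 0%N) (reg B))
          (sigma : forall n, bihom (Q n.+1) (bar_BeB ee n))
          (l : forall n, HH (reg B) n -> HH (reg (corner ee)) n)
          (delta : forall n, HH (reg (corner ee)) n -> Ext Q (reg B) n.+1),
     [/\ [/\ forall x, epsQ (chi 0%N x) = pi (bar_eps B x),
             forall z, bar_eps B (psi 0%N z) = bar_BeB_eps ee z,
             forall x, pi (tau x) = epsQ x,
             forall x, bar_BeB_eps ee (sigma 0%N x) = - tau (cd Q 0%N x)
           & forall n x, cd (bar_BeB ee) n (sigma n.+1 x)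
                         = - sigma n (cd Q n.+1 x)],
         (forall n,
            [/\ bijective (@adj_BeB K B e ee n),
                forall a : Ext (bar B) (reg B) n,
                  l n (ext_to_HH a) = ext_to_HH (adj_BeB (ext_pull (psi n) a))
              & forall c : Ext (bar_BeB ee) (reg B) n,
                  delta n (ext_to_HH (adj_BeB c)) = ext_pull (sigma n) c]),
         long_exact (fun n (a : Ext Q (reg B) n) =>
                       ext_to_HH (ext_pull (chi n) a)) l delta
       & gerstenhaber_hom l].
Proof.
have P_res := bar_BeB_resolution B_proj e_strat IP.
split.
  by split=> //; apply: bar_computes => //; exact: corner_proj.
pose psi := psi_cmap ee.
have ph : is_bihom (pi : reg B -> BAB pi).
  by split=> [|x m|m x]; [exact: (ah_linear pi)|exact: ah_mul|exact: ah_mul].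
have X_res := bar_resolution B_proj.
pose D := cone psi.
have D_res : projective_resolution (cone_eps psi (bar_eps B) (Bihom ph)).
  by apply: (cone_resolution X_res P_res (@psi_BeB_eps _ _ _ ee)) => //.
(* [Q] is an arbitrary resolution of [A], so the maps of the statement are those of the cone
   transported along the comparison maps [w] and [v]. *)
have [w wE] := resolution_cmap Q_res D_res (fun _ => id).
have [v vE] := resolution_cmap D_res Q_res (fun _ => id).
pose chi := compcm v (cone_incl psi).
pose tau : bihom (Q 0%N) (reg B) := compbh (bar_eps B) (w 0%N).
pose sigma n : bihom (Q n.+1) (bar_BeB ee n) := compbh (cone_pr psi n) (w n.+1).
have [u [uK Ku]] := bijective_family (@ext_to_HH_bij K B (reg B)).
pose zeta n (c : Ext (bar_BeB ee) (reg B) n) : HH (reg C) n := ext_to_HH (adj_BeB c).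
have zeta_bij n : bijective (@zeta n).
  exact: (bij_comp (@ext_to_HH_bij K C (reg C) n) (@adj_BeB_bij K B e ee n)).
have [zeta' [zK Kz]] := bijective_family zeta_bij.
have zeta_lin n : linear_fun (@zeta n).
  exact: (linear_fun_comp (@ext_to_HH_lin _ _ _ n) (@adj_BeB_lin _ _ _ ee n)).
pose l n y := zeta n (ext_pull (psi n) (u n y)).
pose delta n z := ext_pull (sigma n) (zeta' n z) : Ext Q (reg B) n.+1.
exists chi, psi, tau, sigma, l, delta; split.
- split.
  + by move=> x; exact: (vE x).
  + exact: psi_BeB_eps.
  + by move=> x; exact: (wE x).
  + move=> x; rewrite -[tau _]/(bar_eps B (w 0%N (cd Q 0%N x))) cm_d.
    rewrite -[sigma 0%N x]/((w 1%N x).2); case: (w 1%N x) => a b.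
    rewrite [cd _ _ _]/= (lfB (bh_lin (bar_eps B))) psi_BeB_eps.
    have -> : bar_eps B (bard B 1 a) = 0 by exact: (@bar_dd _ _ 0).
    by rewrite sub0r opprK.
  move=> n x; rewrite -[sigma n _]/(cone_pr psi n (w n.+1 (cd Q n.+1 x))) cm_d.
  by rewrite cone_pr_d opprK.
- move=> n; split; first exact: adj_BeB_bij.
    by move=> a; rewrite /l uK.
  by move=> c; rewrite /delta -[ext_to_HH (adj_BeB c)]/(zeta n c) zK.
- have vw n : cancel (fun a : Ext Q (reg B) n => ext_pull (v n) a)
      (fun a => ext_pull (w n) a) by exact: (ext_pull_can D_res Q_res vE wE).
  have wv n : cancel (fun a : Ext D (reg B) n => ext_pull (w n) a)
      (fun a => ext_pull (v n) a) by exact: (ext_pull_can Q_res D_res wE vE).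
  have les := long_exact_iso vw wv
    uK Ku zK Kz
    (fun n => ext_pull_lin (cmap_compatible v n)) (@ext_to_HH_lin K B (reg B))
    zeta_lin (cone_long_exact psi (reg B)).
  apply: eq_long_exact les.
  + move=> n x; rewrite ext_pull_comp //; exact: cmap_compatible.
  + by [].
  + move=> n z; rewrite ext_pull_comp //; [exact: cmap_compatible|exact: cone_pr_compatible].
apply: compress_gerstenhaber => [n|n f zf].
  apply: (linear_fun_comp (zeta_lin n)).
  apply: (linear_fun_comp (ext_pull_lin (cmap_compatible psi n))).
  exact: (can_linear (uK n) (Ku n) (@ext_to_HH_lin K B (reg B) n)).
have zF := cochbi_cocycle zf.
have fE : bar_ev (@cochbi K B (reg B) n f) = f by apply: bar_ev_cochbi; case: zf.
have -> : hcl (hh_cocycle (reg B) n) (hh_coboundary (reg B) n) f =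
    ext_to_HH (hcl _ _ (cochbi f) : Ext (bar B) (reg B) n) by rewrite ext_to_HH_hcl // fE.
by rewrite /l uK /zeta corner_ext_hcl // fE.
Qed.

End StratifyingTheorem.

Theorem theorem8p11 (K : comPzRingType) (B A : kalg K) (I : ideal B)
    (pi : alghom B A) (pi_surj : forall a, exists b, pi b = a)
    (pi_ker : forall b, pi b = 0 <-> I b)
    (B_proj : projective_module B) (A_proj : projective_module A) :
  ((forall i, (0 < i)%N -> Tor_eq0 i (AB pi) (BA pi)) ->
   [/\ bar_computes_HH B, bar_computes_HH A
     & projective_resolution (bar_AA_eps pi)] /\
   exists (phi : cmap (bar_AA pi) (bar A))
          (theta : forall n, HH (BAB pi) n -> HH (reg A) n)
          (delta : forall n, HH (reg A) n -> HH (ideal_bimod I) n.+1),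
     let j n : HH (reg B) n -> HH (BAB pi) n :=
       @HH_map K B (reg B) (BAB pi) pi n in
     let k n : HH (reg B) n -> HH (reg A) n := fun x => theta n (j n x) in
     [/\ (forall z, bar_eps A (phi 0%N z) = bar_AA_eps pi z) /\
         (forall n,
            [/\ bijective (fun a : Ext (bar A) (reg A) n =>
                             ext_pull (phi n) a),
                bijective (@adj_AA K B A pi n)
              & forall a : Ext (bar A) (reg A) n,
                  theta n (ext_to_HH (adj_AA (ext_pull (phi n) a)))
                  = ext_to_HH a]),
         (forall n (f : seq B -> reg B) (g : seq B -> ideal_bimod I),
            is_cochain n f -> is_cochain n.+1 g ->
            hdiff f = (fun s => val (g s)) ->
            delta n (theta n (hcl _ _ (fun s => pi (f s)))) = hcl _ _ g),
         long_exact (fun n => @HH_map K B (ideal_bimod I) (reg B) val n) k delta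
       & gerstenhaber_hom k]) /\
  (forall (e : B) (ee : e ** e = e),
   stratifying ee -> (forall x, I x <-> BeB e x) ->
   forall (Q : cplx B B) (epsQ : bihom (Q 0%N) (BAB pi)),
   projective_resolution epsQ ->
   [/\ bar_computes_HH B, bar_computes_HH (corner ee)
     & resolves (bar_BeB_eps ee) I] /\
   exists (chi : cmap (bar B) Q) (psi : cmap (bar_BeB ee) (bar B))
          (tau : bihom (Q 0%N) (reg B))
          (sigma : forall n, bihom (Q n.+1) (bar_BeB ee n))
          (l : forall n, HH (reg B) n -> HH (reg (corner ee)) n)
          (delta : forall n, HH (reg (corner ee)) n -> Ext Q (reg B) n.+1),
     [/\ [/\ forall x, epsQ (chi 0%N x) = pi (bar_eps B x),
             forall z, bar_eps B (psi 0%N z) = bar_BeB_eps ee z,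
             forall x, pi (tau x) = epsQ x,
             forall x, bar_BeB_eps ee (sigma 0%N x) = - tau (cd Q 0%N x)
           & forall n x, cd (bar_BeB ee) n (sigma n.+1 x)
                         = - sigma n (cd Q n.+1 x)],
         (forall n,
            [/\ bijective (@adj_BeB K B e ee n),
                forall a : Ext (bar B) (reg B) n,
                  l n (ext_to_HH a) = ext_to_HH (adj_BeB (ext_pull (psi n) a))
              & forall c : Ext (bar_BeB ee) (reg B) n,
                  delta n (ext_to_HH (adj_BeB c)) = ext_pull (sigma n) c]),
         long_exact (fun n (a : Ext Q (reg B) n) =>
                       ext_to_HH (ext_pull (chi n) a)) l delta
       & gerstenhaber_hom l]).
Proof.
split; first exact: (quotient_theorem pi_surj pi_ker B_proj A_proj).
move=> e ee e_strat IP Q epsQ Q_res.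
exact: (stratifying_theorem pi_surj pi_ker B_proj e_strat IP Q_res).
Qed.
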